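(* Let $d\ge1$. The set of all regular monomials forms a linear basis of the affine periplectic Brauer algebra $\widehat P_d^-$ over $\mathbb C$.
   Context: The affine periplectic Brauer algebra $\widehat P_d^-$ is the associative unital $\mathbb C$-algebra generated by $s_a,\varepsilon_a$ ($1\le a\le d-1$), $y_j$ ($1\le j\le d$), subject to (for all indices for which the symbols make sense): (P.1) $s_a^2=1$; (P.2) $s_as_b=s_bs_a$ for $|a-b|>1$; $s_cs_{c+1}s_c=s_{c+1}s_cs_{c+1}$; $s_ay_i=y_is_a$ for $i\notin\{a,a+1\}$; (P.3) $\varepsilon_a^2=0$; (P.4) $\varepsilon_1y_1^k\varepsilon_1=0$ for all integers $k\ge1$; (P.5) $s_a\varepsilon_b=\varepsilon_bs_a$ and $\varepsilon_a\varepsilon_b=\varepsilon_b\varepsilon_a$ for $|a-b|>1$; $\varepsilon_ay_i=y_i\varepsilon_a$ for $i\notin\{a,a+1\}$; $y_iy_j=y_jy_i$; (P.6) $\varepsilon_as_a=-\varepsilon_a=-s_a\varepsilon_a$; $s_c\varepsilon_{c+1}\varepsilon_c=-s_{c+1}\varepsilon_c$, $\varepsilon_c\varepsilon_{c+1}s_c=\varepsilon_cs_{c+1}$; $\varepsilon_{c+1}\varepsilon_cs_{c+1}=-\varepsilon_{c+1}s_c$, $s_{c+1}\varepsilon_c\varepsilon_{c+1}=s_c\varepsilon_{c+1}$; $\varepsilon_{c+1}\varepsilon_c\varepsilon_{c+1}=-\varepsilon_{c+1}$, $\varepsilon_c\varepsilon_{c+1}\varepsilon_c=-\varepsilon_c$;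 (P.7) $s_ay_a-y_{a+1}s_a=\varepsilon_a-1$, $y_as_a-s_ay_{a+1}=-\varepsilon_a-1$; (P.8) $\varepsilon_a(y_a-y_{a+1})=\varepsilon_a$, $(y_a-y_{a+1})\varepsilon_a=-\varepsilon_a$. Brauer diagrams. $\mathcal G(d)$ is the set of Brauer $(d,d)$-diagrams, i.e. partitions into pairs (edges) of the $2d$ vertices $1,\dots,d$ (top row) and $\bar1,\dots,\bar d$ (bottom row, $\bar i$ below $i$). The generator $s_a$ corresponds to the diagram with edges $\{a,\overline{a+1}\},\{a+1,\bar a\}$ and $\{j,\bar j\}$ for $j\ne a,a+1$; $\varepsilon_a$ corresponds to the diagram with edges $\{a,a+1\},\{\bar a,\overline{a+1}\}$ and $\{j,\bar j\}$ for $j\neq a,a+1$. A product corresponds to vertical concatenation with the left factor on top. Each $\gamma\in\mathcal G(d)$ is regarded as an element of $\widehat P_d^-$ by choosing a word in the $s_a,\varepsilon_a$ whose concatenation produces $\gamma$ without closed loops; the resulting element is independent of the word up to sign, and one fixes one choice for each $\gamma$. An edge of $\gamma$ joining $\{i,j\}$ or joining $\{\bar i,\bar j\}$, $i<j$, is called horizontal, and $j$, respectively $\bar j$, is its right end. A monomial of the form $y_1^{i_1}\cdots y_d^{i_d}\cdot\gamma\cdot y_1^{j_1}\cdots y_d^{j_d}$, with $\gamma\in\mathcal G(d)$ and all exponents non-negative integers, is called regular if: $i_k=0$ whenever $k$ is the right end of a horizontal edge of $\gamma$ in the top row; and $j_t\ne0$ only if $\bar t$ is the right end of a horizontal edge of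 $\gamma$ in the bottom row. *)

(* Defs.v *)
From HB Require Import structures.
From mathcomp Require Import all_boot all_order all_algebra.
From mathcomp Require Import boolp reals.
From mathcomp Require Import complex.
From mathcomp Require Import monalg.

Set Implicit Arguments.
Unset Strict Implicit.
Unset Printing Implicit Defensive.

Import GRing.Theory.
Local Open Scope ring_scope.
Local Open Scope quotient_scope.

Definition free_algebra (K : comNzRingType) (X : choiceType) :=
  {malg K[{fmonom X}]}.

HB.instance Definition _ (K : comNzRingType) (X : choiceType) :=
  GRing.Lalgebra.on (free_algebra K X).

Section FreeAlgebra.
Variables (K : comNzRingType) (X : choiceType).

Definition free_gen (x : X) : free_algebra K X := << fmu x >>.

Fact free_scalerAr (c : K) (p q : free_algebra K X) :
  c *: (p * q) = p * (c *: q).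
Proof.
have central (r : free_algebra K X) : c%:MP * r = r * c%:MP :> free_algebra K X.
  rewrite !malgM_def fgmulUg fgmulgU.
  by apply: eq_bigr => k _; rewrite mulrC mul1m mulm1.
by rewrite -(mul_malgC c (p * q)) -(mul_malgC c q) mulrA central -mulrA.
Qed.

HB.instance Definition _ :=
  GRing.Lalgebra_isAlgebra.Build K (free_algebra K X) free_scalerAr.

End FreeAlgebra.

Section Presentation.
Variables (K : comNzRingType) (X : choiceType).
Variable rel : free_algebra K X -> free_algebra K X -> Prop.

(* The two-sided ideal generated by the differences of related elements. *)
Inductive relation_ideal : free_algebra K X -> Prop :=
| relation_ideal_base p q : rel p q -> relation_ideal (p - q)
| relation_ideal0 : relation_ideal 0
| relation_idealD p q :
    relation_ideal p -> relation_ideal q -> relation_ideal (p + q)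
| relation_idealMl a p : relation_ideal p -> relation_ideal (a * p)
| relation_idealMr a p : relation_ideal p -> relation_ideal (p * a).

Definition relation_ideal_pred : {pred free_algebra K X} :=
  fun p => `[< relation_ideal p >].

Fact relation_ideal_zmod_closed : zmod_closed relation_ideal_pred.
Proof.
split=> [|p q /asboolP Ip /asboolP Iq]; apply/asboolP.
  exact: relation_ideal0.
by apply: relation_idealD => //; rewrite -mulN1r; apply: relation_idealMl.
Qed.

HB.instance Definition _ :=
  GRing.isZmodClosed.Build _ relation_ideal_pred relation_ideal_zmod_closed.

Definition presented_algebra := {ideal_quot relation_ideal_pred}.

HB.instance Definition _ := GRing.Zmodule.on presented_algebra.
HB.instance Definition _ :=
  EqQuotient.on presented_algebra.

Definition presented_class : free_algebra K X -> presented_algebra :=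
  \pi_presented_algebra.

Lemma presented_classP p q :
  (presented_class p = presented_class q) <-> relation_ideal (p - q).
Proof.
have IE : reflect (relation_ideal (p - q)) (presented_class p == presented_class q).
  by rewrite /presented_class -Quotient.idealrBE; apply: asboolP.
by split=> [/eqP/IE | /IE/eqP].
Qed.

Lemma presented_class_surj (u : presented_algebra) :
  exists p, u = presented_class p.
Proof. by exists (repr u); rewrite /presented_class reprK. Qed.

Lemma presented_classD : {morph presented_class : p q / p + q}.
Proof. exact: raddfD. Qed.

Lemma repr_presented_class p : relation_ideal (repr (presented_class p) - p).
Proof. by apply/presented_classP; rewrite /presented_class reprK. Qed.

Definition presented_one : presented_algebra := presented_class 1.

Definition presented_mul (u v : presented_algebra) : presented_algebra :=
  presented_class (repr u * repr v).

Definition presented_scale (c : K) (u : presented_algebra) :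
  presented_algebra := presented_class (c *: repr u).

Lemma presented_classM :
  {morph presented_class : p q / p * q >-> presented_mul p q}.
Proof.
move=> p q; apply/esym/presented_classP.
set p' := repr _; set q' := repr _.
have -> : p' * q' - p * q = (p' - p) * q' + p * (q' - q).
  by rewrite mulrBl mulrBr addrA subrK.
by apply: relation_idealD; [apply: relation_idealMr | apply: relation_idealMl];
  apply: repr_presented_class.
Qed.

Lemma presented_classZ c :
  {morph presented_class : p / c *: p >-> presented_scale c p}.
Proof.
move=> p; apply/esym/presented_classP; rewrite -scalerBr -[_ - p]mul1r scalerAl.
by apply: relation_idealMl; apply: repr_presented_class.
Qed.

Fact presented_mulA : associative presented_mul.
Proof.
move=> u v w; case: (presented_class_surj u) (presented_class_surj v)
  (presented_class_surj w) => p -> [q ->] [r ->].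
by rewrite -!presented_classM mulrA.
Qed.

Fact presented_mul1 : left_id presented_one presented_mul.
Proof.
move=> u; case: (presented_class_surj u) => p ->.
by rewrite -presented_classM mul1r.
Qed.

Fact presented_mulr1 : right_id presented_one presented_mul.
Proof.
move=> u; case: (presented_class_surj u) => p ->.
by rewrite -presented_classM mulr1.
Qed.

Fact presented_mulDl : left_distributive presented_mul +%R.
Proof.
move=> u v w; case: (presented_class_surj u) (presented_class_surj v)
  (presented_class_surj w) => p -> [q ->] [r ->].
by rewrite -presented_classD -!presented_classM -presented_classD mulrDl.
Qed.

Fact presented_mulDr : right_distributive presented_mul +%R.
Proof.
move=> u v w; case: (presented_class_surj u) (presented_class_surj v)
  (presented_class_surj w) => p -> [q ->] [r ->].
by rewrite -presented_classD -!presented_classM -presented_classD mulrDr.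
Qed.

HB.instance Definition _ := GRing.Zmodule_isPzRing.Build presented_algebra
  presented_mulA presented_mul1 presented_mulr1 presented_mulDl presented_mulDr.

Fact presented_scaleA a b u :
  presented_scale a (presented_scale b u) = presented_scale (a * b) u.
Proof.
by case: (presented_class_surj u) => p ->; rewrite -!presented_classZ scalerA.
Qed.

Fact presented_scale1 : left_id 1 presented_scale.
Proof.
move=> u; case: (presented_class_surj u) => p ->.
by rewrite -presented_classZ scale1r.
Qed.

Fact presented_scaleDr : right_distributive presented_scale +%R.
Proof.
move=> c u v; case: (presented_class_surj u) (presented_class_surj v)
  => p -> [q ->].
by rewrite -presented_classD -!presented_classZ -presented_classD scalerDr.
Qed.

Fact presented_scaleDl u : {morph presented_scale^~ u : a b / a + b}.
Proof.
move=> a b; case: (presented_class_surj u) => p ->.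
by rewrite -!presented_classZ -presented_classD scalerDl.
Qed.

HB.instance Definition _ :=
  GRing.Zmodule_isLmodule.Build K presented_algebra
    presented_scaleA presented_scale1 presented_scaleDr presented_scaleDl.

Fact presented_scalerAl (c : K) (u v : presented_algebra) :
  c *: (u * v) = (c *: u) * v.
Proof.
case: (presented_class_surj u) (presented_class_surj v) => p -> [q ->].
change (presented_scale c (presented_mul (presented_class p) (presented_class q))
  = presented_mul (presented_scale c (presented_class p)) (presented_class q)).
by rewrite -presented_classM -!presented_classZ -presented_classM scalerAl.
Qed.

Fact presented_scalerAr (c : K) (u v : presented_algebra) :
  c *: (u * v) = u * (c *: v).
Proof.
case: (presented_class_surj u) (presented_class_surj v) => p -> [q ->].
change (presented_scale c (presented_mul (presented_class p) (presented_class q))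
  = presented_mul (presented_class p) (presented_scale c (presented_class q))).
by rewrite -presented_classM -!presented_classZ -presented_classM scalerAr.
Qed.

End Presentation.

(* Generators, indexed from 0: inl (inl a), inl (inr a) and inr j stand for
   s_(a+1), eps_(a+1) and y_(j+1), the ordinal a being less than d - 1. *)
Definition brauer_letter (d : nat) : choiceType := ('I_d.-1 + 'I_d.-1)%type.

Definition periplectic_gen (d : nat) : choiceType :=
  (brauer_letter d + 'I_d)%type.

Definition pos_left (d : nat) (a : 'I_d.-1) : 'I_d :=
  widen_ord (leq_pred d) a.

Definition pos_right (d : nat) (a : 'I_d.-1) : 'I_d :=
  Ordinal (etrans (esym (ltn_predRL a d)) (ltn_ord a)).

Definition far_apart (d : nat) (a b : 'I_d.-1) := (a.+1 < b)%N || (b.+1 < a)%N.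

Section PeriplecticRelations.
Variables (d : nat) (A : nzRingType) (s e : 'I_d.-1 -> A) (y : 'I_d -> A).

Implicit Types (a b c : 'I_d.-1) (i j : 'I_d).

(* In the relations on three strands, c' is the index c + 1. *)
Inductive periplectic_rel : A -> A -> Prop :=
| rel_ss a : periplectic_rel (s a * s a) 1
| rel_s_comm a b : far_apart a b -> periplectic_rel (s a * s b) (s b * s a)
| rel_braid c c' : c' = c.+1 :> nat ->
    periplectic_rel (s c * s c' * s c) (s c' * s c * s c')
| rel_sy a i : i != pos_left a -> i != pos_right a ->
    periplectic_rel (s a * y i) (y i * s a)
| rel_ee a : periplectic_rel (e a * e a) 0
| rel_eye a k : a = 0%N :> nat -> (0 < k)%N ->
    periplectic_rel (e a * y (pos_left a) ^+ k * e a) 0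
| rel_se_comm a b : far_apart a b -> periplectic_rel (s a * e b) (e b * s a)
| rel_ee_comm a b : far_apart a b -> periplectic_rel (e a * e b) (e b * e a)
| rel_ey a i : i != pos_left a -> i != pos_right a ->
    periplectic_rel (e a * y i) (y i * e a)
| rel_yy i j : periplectic_rel (y i * y j) (y j * y i)
| rel_es a : periplectic_rel (e a * s a) (- e a)
| rel_se a : periplectic_rel (- e a) (- (s a * e a))
| rel_see c c' : c' = c.+1 :> nat ->
    periplectic_rel (s c * e c' * e c) (- (s c' * e c))
| rel_ees c c' : c' = c.+1 :> nat ->
    periplectic_rel (e c * e c' * s c) (e c * s c')
| rel_ees' c c' : c' = c.+1 :> nat ->
    periplectic_rel (e c' * e c * s c') (- (e c' * s c))
| rel_see' c c' : c' = c.+1 :> nat ->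
    periplectic_rel (s c' * e c * e c') (s c * e c')
| rel_eee' c c' : c' = c.+1 :> nat ->
    periplectic_rel (e c' * e c * e c') (- e c')
| rel_eee c c' : c' = c.+1 :> nat ->
    periplectic_rel (e c * e c' * e c) (- e c)
| rel_sy_ys a : periplectic_rel
    (s a * y (pos_left a) - y (pos_right a) * s a) (e a - 1)
| rel_ys_sy a : periplectic_rel
    (y (pos_left a) * s a - s a * y (pos_right a)) (- e a - 1)
| rel_eyy a : periplectic_rel
    (e a * (y (pos_left a) - y (pos_right a))) (e a)
| rel_yye a : periplectic_rel
    ((y (pos_left a) - y (pos_right a)) * e a) (- e a).

End PeriplecticRelations.

Lemma periplectic_rel_morph (d : nat) (A B : nzRingType)
    (f : {rmorphism A -> B}) (s e : 'I_d.-1 -> A) (y : 'I_d -> A)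
    (s' e' : 'I_d.-1 -> B) (y' : 'I_d -> B) p q :
  (forall a, f (s a) = s' a) -> (forall a, f (e a) = e' a) ->
  (forall j, f (y j) = y' j) ->
  periplectic_rel s e y p q -> periplectic_rel s' e' y' (f p) (f q).
Proof.
move=> fs fe fy.
by case=> *; rewrite ?(rmorphD, rmorphB, rmorphM, rmorphN, rmorphXn, rmorph1,
  rmorph0) /= ?(fs, fe, fy); constructor.
Qed.

Section AffinePeriplectic.
Variables (K : comNzRingType) (d : nat).

Definition free_s (a : 'I_d.-1) : free_algebra K (periplectic_gen d) :=
  free_gen K (inl (inl a) : periplectic_gen d).
Definition free_eps (a : 'I_d.-1) : free_algebra K (periplectic_gen d) :=
  free_gen K (inl (inr a) : periplectic_gen d).
Definition free_y (j : 'I_d) : free_algebra K (periplectic_gen d) :=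
  free_gen K (inr j : periplectic_gen d).

Definition affine_periplectic :=
  presented_algebra (periplectic_rel free_s free_eps free_y).

HB.instance Definition _ := GRing.PzRing.on affine_periplectic.
HB.instance Definition _ := GRing.Lmodule.on affine_periplectic.

Definition periplectic_class (x : periplectic_gen d) : affine_periplectic :=
  presented_class (periplectic_rel free_s free_eps free_y) (free_gen K x).

(* The character s |-> 1, eps |-> 0, y_j |-> j, which shows that the
   presented algebra is not the zero ring. *)
Definition periplectic_char_gen (x : periplectic_gen d) : K :=
  match x with inl (inl _) => 1 | inl (inr _) => 0 | inr j => j%:R end.

Definition periplectic_char_word (m : {fmonom periplectic_gen d}) : K :=
  \prod_(x <- (m : seq _)) periplectic_char_gen x.

Fact periplectic_char_wordM : mmorphism periplectic_char_word.
Proof.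
split=> [m n|]; rewrite /periplectic_char_word; first by rewrite fmM big_cat.
by rewrite fm1 big_nil.
Qed.

HB.instance Definition _ :=
  isMultiplicative.Build _ _ periplectic_char_word periplectic_char_wordM.

Definition periplectic_char (p : free_algebra K (periplectic_gen d)) : K := mmap idfun periplectic_char_word p.

HB.instance Definition _ := GRing.RMorphism.copy periplectic_char
  (mmap idfun periplectic_char_word).

Lemma periplectic_char_genE x :
  periplectic_char (free_gen K x) = periplectic_char_gen x.
Proof.
by rewrite /periplectic_char mmapU mul1r /= /periplectic_char_word fmU big_seq1.
Qed.

Lemma periplectic_rel_scalar (p q : K) :
  periplectic_rel (fun _ : 'I_d.-1 => 1) (fun _ => 0) (fun j : 'I_d => j%:R) p q
  -> p = q.
Proof.
have sumN (n : nat) : n%:R - n.+1%:R = -1 :> K.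
  by rewrite -natr1 opprD addrA subrr sub0r.
by case=> *; rewrite /= ?(mul0r, mulr0, mul1r, mulr1, oppr0, sub0r, sumN) //;
  apply: mulrC.
Qed.

Lemma periplectic_char_rel p q :
  periplectic_rel free_s free_eps free_y p q ->
  periplectic_char p = periplectic_char q.
Proof.
by move=> pq; apply: periplectic_rel_scalar;
  apply: (periplectic_rel_morph (f := periplectic_char) _ _ _ pq) => x;
  rewrite [LHS]periplectic_char_genE.
Qed.

Fact affine_periplectic_neq0 : 1 != 0 :> affine_periplectic.
Proof.
apply/eqP => one0.
have ch0 p : relation_ideal (periplectic_rel free_s free_eps free_y) p ->
    periplectic_char p = 0.
  elim=> [q r /periplectic_char_rel qr||q r _ q0 _ r0|a q _ q0|a q _ q0].
  - by rewrite (rmorphB periplectic_char q r) /= qr subrr.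
  - exact: rmorph0.
  - by rewrite (rmorphD periplectic_char q r) /= q0 r0 addr0.
  - by rewrite (rmorphM periplectic_char a q) /= q0 mulr0.
  - by rewrite (rmorphM periplectic_char q a) /= q0 mul0r.
have /presented_classP/ch0 : presented_class
    (periplectic_rel free_s free_eps free_y) 1
  = presented_class (periplectic_rel free_s free_eps free_y) 0.
  by rewrite [RHS](raddf0 \pi_affine_periplectic) -one0.
rewrite subr0 (rmorph1 periplectic_char) => /eqP; apply/negP; exact: oner_neq0.
Qed.

HB.instance Definition _ :=
  GRing.PzSemiRing_isNonZero.Build affine_periplectic affine_periplectic_neq0.
HB.instance Definition _ := GRing.Lmodule_isLalgebra.Build K affine_periplectic
  (@presented_scalerAl _ _ (periplectic_rel free_s free_eps free_y)).
HB.instance Definition _ := GRing.Lalgebra_isAlgebra.Build K affine_periplectic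
  (@presented_scalerAr _ _ (periplectic_rel free_s free_eps free_y)).

End AffinePeriplectic.

Section BrauerDiagrams.
Variable d : nat.

(* inl i is the top vertex i, inr i is the bottom vertex below it. *)
Definition vertex : finType := ('I_d + 'I_d)%type.

Definition is_brauer (g : {set {set vertex}}) : bool :=
  partition g [set: vertex] && [forall B in g, #|B| == 2].

Definition brauer_diagram : finType := {g : {set {set vertex}} | is_brauer g}.

Definition vertical_edge (i : 'I_d) : {set vertex} := [set inl i; inr i].

Definition id_diagram : {set {set vertex}} := [set vertical_edge j | j : 'I_d].

Definition letter_diagram (l : brauer_letter d) : {set {set vertex}} :=
  match l with
  | inl a =>
      [set [set inl (pos_left a); inr (pos_right a)];
           [set inl (pos_right a); inr (pos_left a)]]
      :|: [set vertical_edge j | j : 'I_d & j \notin [:: pos_left a; pos_right a]]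
  | inr a =>
      [set [set inl (pos_left a); inl (pos_right a)];
           [set inr (pos_left a); inr (pos_right a)]]
      :|: [set vertical_edge j | j : 'I_d & j \notin [:: pos_left a; pos_right a]]
  end.

(* Vertices of two stacked diagrams: inl (inl i), inl (inr i) and inr i are the
   i-th vertices of the top, middle and bottom row. *)
Definition stacked_vertex : finType := ('I_d + 'I_d + 'I_d)%type.

Definition in_upper (v : vertex) : stacked_vertex := inl v.

Definition in_lower (v : vertex) : stacked_vertex :=
  match v with inl i => inl (inr i) | inr i => inr i end.

Definition in_outer (v : vertex) : stacked_vertex :=
  match v with inl i => inl (inl i) | inr i => inr i end.

Definition stacked_edge (g h : {set {set vertex}}) : rel stacked_vertex :=
  fun u v => [set u; v] \in [set in_upper @: B | B : {set vertex} in g]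
                        :|: [set in_lower @: B | B : {set vertex} in h].

Definition concat_diagram (g h : {set {set vertex}}) : {set {set vertex}} :=
  [set [set p.1; p.2] | p : vertex * vertex &
    (p.1 != p.2) && connect (stacked_edge g h) (in_outer p.1) (in_outer p.2)].

(* A closed loop is a connected component lying in the middle row. *)
Definition no_closed_loop (g h : {set {set vertex}}) : bool :=
  [forall i : 'I_d, exists v : vertex,
    connect (stacked_edge g h) (inl (inr i)) (in_outer v)].

Fixpoint word_diagram (w : seq (brauer_letter d)) : {set {set vertex}} :=
  if w is l :: w' then concat_diagram (letter_diagram l) (word_diagram w')
  else id_diagram.

Fixpoint loop_free (w : seq (brauer_letter d)) : bool :=
  if w is l :: w' then
    no_closed_loop (letter_diagram l) (word_diagram w') && loop_free w'
  else true.

Definition word_produces (w : seq (brauer_letter d)) (g : brauer_diagram) :=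
  loop_free w && (word_diagram w == val g).

Definition top_right_end (g : brauer_diagram) (k : 'I_d) : bool :=
  [exists i : 'I_d, (i < k)%N && ([set inl i; inl k] \in val g)].

Definition bottom_right_end (g : brauer_diagram) (k : 'I_d) : bool :=
  [exists i : 'I_d, (i < k)%N && ([set inr i; inr k] \in val g)].

(* Data (i, gamma, j) of the monomial y^i * gamma * y^j. *)
Definition monomial_data : choiceType :=
  ({ffun 'I_d -> nat} * brauer_diagram * {ffun 'I_d -> nat})%type.

Definition regular (m : monomial_data) : bool :=
  let: (i, g, j) := m in
  [forall k, top_right_end g k ==> (i k == 0%N)] &&
  [forall t, (j t != 0%N) ==> bottom_right_end g t].

Definition regular_data : choiceType := {m : monomial_data | regular m}.

End BrauerDiagrams.

Section Monomials.
Variables (K : comNzRingType) (d : nat).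

Definition word_elt (w : seq (brauer_letter d)) : affine_periplectic K d :=
  \prod_(l <- w) periplectic_class K (inl l : periplectic_gen d).

Definition y_monomial (i : {ffun 'I_d -> nat}) : affine_periplectic K d :=
  \prod_(k < d) periplectic_class K (inr k : periplectic_gen d) ^+ i k.

(* lift gamma is the word chosen to represent gamma. *)
Definition monomial (lift : brauer_diagram d -> seq (brauer_letter d))
    (m : monomial_data d) : affine_periplectic K d :=
  let: (i, g, j) := m in y_monomial i * word_elt (lift g) * y_monomial j.

End Monomials.

Section Basis.
Variables (K : comNzRingType) (V : lmodType K) (I : choiceType) (b : I -> V).

Definition lin_independent : Prop :=
  forall (r : seq I) (c : I -> K), uniq r ->
    \sum_(i <- r) c i *: b i = 0 -> forall i, i \in r -> c i = 0.

Definition spanning : Prop :=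
  forall v : V, exists (r : seq I) (c : I -> K), v = \sum_(i <- r) c i *: b i.

Definition is_basis : Prop := lin_independent /\ spanning.

End Basis.

(* Main.v *)
(** Spanning: filter the algebra by the number of y's. In the associated graded
    algebra a dot (a factor y) slides freely along an edge of a diagram, and
    s_a, eps_a send a dotted diagram, up to sign, to a dotted diagram or to 0.
    So dotted diagrams span, and each dot can be moved to the end of its edge
    allowed in a regular monomial.

    Independence: let the algebra act on the tensor power V^(N + d) of a
    superspace V with an odd form, s_a and eps_a acting on the last d factors
    and y_j as the Jucys-Murphy element of factor N + j. In a linear relation
    let k be the largest degree of a monomial with nonzero coefficient, and m
    such a monomial. Take N = k, one auxiliary factor for every dot of m, and
    the matrix entry at two words that differ in all k auxiliary factors. Each
    y changes at most one auxiliary factor, so monomials of degree < k do not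
    contribute; colouring the basis of V by the edges of the diagram of m and
    by heights on them, m is the only monomial of degree k that does, and its
    entry is a sign. *)

Require Import Defs.
From HB Require Import structures.
From mathcomp Require Import all_boot all_order all_algebra all_fingroup.
From mathcomp Require Import boolp reals complex monalg.
From mathcomp Require Import ring zify.

Set Implicit Arguments.
Unset Strict Implicit.
Unset Printing Implicit Defensive.

Import GRing.Theory Num.Theory.
Local Open Scope ring_scope.

(** * Jucys-Murphy elements *)

(** Diagrams given as set partitions, concatenated through connected components, are awkward to
    multiply. In the algebra a diagram is therefore a product of a partial matching and a
    permutation. A relation on a few strands is then a conjugate of a defining one, and the only
    ambiguity in such a product is the stabiliser of the matching, which acts by signs. Signs are
    never tracked: identities between diagrams are proved up to sign, and matrix entries are
    arranged so that a single term survives and nothing can cancel. For this reason colours carry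
    heights: they distinguish the dots on one edge, so each dot can trade with one auxiliary factor
    only. The link with set-theoretic diagrams also comes from the tensor representation: a nonzero
    matrix entry of a word forces colours to be constant along the edges of its diagram. The
    relations $\varepsilon_1y_1^k\varepsilon_1=0$ have to be verified for Jucys-Murphy elements for
    all $k$ at once; characteristic 0 enters there. In the spanning half the same relations kill
    closed loops carrying dots. *)

Record brauer_pair (A : pzRingType) (n : nat) (s e : nat -> A) : Prop := {
  bp_ss : forall a, (a < n)%N -> s a * s a = 1;
  bp_sC : forall a b, (a.+1 < b < n)%N -> s a * s b = s b * s a;
  bp_braid : forall a, (a.+1 < n)%N -> s a * s a.+1 * s a = s a.+1 * s a * s a.+1;
  bp_ee : forall a, (a < n)%N -> e a * e a = 0;
  bp_eC : forall a b, (a.+1 < b < n)%N -> e a * e b = e b * e a;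
  bp_seC : forall a b, (a.+1 < b < n)%N -> s a * e b = e b * s a;
  bp_esC : forall a b, (a.+1 < b < n)%N -> e a * s b = s b * e a;
  bp_es : forall a, (a < n)%N -> e a * s a = - e a;
  bp_se : forall a, (a < n)%N -> s a * e a = e a;
  bp_see : forall a, (a.+1 < n)%N -> s a * e a.+1 * e a = - (s a.+1 * e a);
  bp_ees : forall a, (a.+1 < n)%N -> e a * e a.+1 * s a = e a * s a.+1;
  bp_ees' : forall a, (a.+1 < n)%N -> e a.+1 * e a * s a.+1 = - (e a.+1 * s a);
  bp_see' : forall a, (a.+1 < n)%N -> s a.+1 * e a * e a.+1 = s a * e a.+1;
  bp_eee' : forall a, (a.+1 < n)%N -> e a.+1 * e a * e a.+1 = - e a.+1;
  bp_eee : forall a, (a.+1 < n)%N -> e a * e a.+1 * e a = - e a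
}.

(** The rings are noncommutative, so [ring] does not apply. Sums are reified with products as opaque
    atoms, and an identity is checked by comparing the integer coefficients of the atoms. *)
Inductive zexpr := ZVar of nat | ZZero | ZAdd of zexpr & zexpr | ZOpp of zexpr.

Fixpoint zdenote (V : zmodType) (env : seq V) (t : zexpr) : V :=
  match t with
  | ZVar i => nth 0 env i
  | ZZero => 0
  | ZAdd a b => zdenote env a + zdenote env b
  | ZOpp a => - zdenote env a
  end.

Fixpoint zcoef (i : nat) (t : zexpr) : int :=
  match t with
  | ZVar j => if i == j then 1 else 0
  | ZZero => 0
  | ZAdd a b => zcoef i a + zcoef i b
  | ZOpp a => - zcoef i a
  end.

Lemma zdenoteE (V : zmodType) (env : seq V) t :
  zdenote env t = \sum_(i < size env) env`_i *~ zcoef i t.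
Proof.
elim: t => [j||a IHa b IHb|a IHa] /=.
- case: (ltnP j (size env)) => [lj|gj].
    rewrite (bigD1 (Ordinal lj)) //= eqxx mulr1z big1 ?addr0 // => i ni.
    by rewrite -val_eqE /= in ni; rewrite (negPf ni) mulr0z.
  rewrite nth_default // big1 // => i _.
  by rewrite (_ : _ == j = false) ?mulr0z //; apply/eqP => ij; rewrite -ij leqNgt ltn_ord in gj.
- by rewrite big1 // => i _; rewrite mulr0z.
- by rewrite IHa IHb -big_split; apply: eq_bigr => i _; rewrite mulrzDr.
- by rewrite IHa -sumrN; apply: eq_bigr => i _; rewrite mulrNz.
Qed.

Lemma zdenote_eq (V : zmodType) (env : seq V) t u :
  all (fun i => zcoef i t == zcoef i u) (iota 0 (size env)) ->
  zdenote env t = zdenote env u.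
Proof.
move=> /allP tu; rewrite !zdenoteE; apply: eq_bigr => i _.
have /eqP -> // : zcoef i t == zcoef i u.
by apply: tu; rewrite mem_iota ltn_ord.
Qed.

Ltac zmem x env :=
  lazymatch env with
  | nil => constr:(false)
  | ?y :: ?env' =>
    match constr:(Set) with
    | _ => let _ := match goal with _ => unify x y end in constr:(true)
    | _ => zmem x env'
    end
  end.
Ltac zlook x env :=
  lazymatch env with
  | ?y :: ?env' =>
    match constr:(Set) with
    | _ => let _ := match goal with _ => unify x y end in constr:(0%N)
    | _ => let i := zlook x env' in constr:(i.+1)
    end
  end.
Ltac zenv env t :=
  lazymatch t with
  | (?a + ?b)%R => let env1 := zenv env a in zenv env1 b
  | (- ?a)%R => zenv env a
  | 0%R => env
  | ?x => let m := zmem x env in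
          lazymatch m with true => env | false => constr:(x :: env) end
  end.
Ltac zquote env t :=
  lazymatch t with
  | (?a + ?b)%R => let u := zquote env a in let v := zquote env b in constr:(ZAdd u v)
  | (- ?a)%R => let u := zquote env a in constr:(ZOpp u)
  | 0%R => constr:(ZZero)
  | ?x => let i := zlook x env in constr:(ZVar i)
  end.
(* Decides equalities that hold in every abelian group. *)
Ltac abel :=
  lazymatch goal with
  | |- @eq ?V ?t ?u =>
    let env0 := zenv (@nil V) t in
    let env := zenv env0 u in
    let qt := zquote env t in
    let qu := zquote env u in
    exact: (@zdenote_eq _ env qt qu erefl)
  end.

Lemma brauer_pair_shift (A : pzRingType) (n m : nat) (s e : nat -> A) :
  brauer_pair (m + n) s e -> brauer_pair n (fun a => s (m + a)%N) (fun a => e (m + a)%N).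
Proof.
case=> h1 h2 h3 h4 h5 h6 h7 h8 h9 h10 h11 h12 h13 h14 h15.
split=> *; rewrite ?addnS;
 [apply: h1 | apply: h2 | apply: h3 | apply: h4 | apply: h5 | apply: h6 | apply: h7
 | apply: h8 | apply: h9 | apply: h10 | apply: h11 | apply: h12 | apply: h13 | apply: h14
 | apply: h15]; lia.
Qed.

Section BrauerConsequences.
Variables (A : pzRingType) (n : nat) (s e : nat -> A).
Hypothesis H : brauer_pair n s e.
Variable a : nat.
Hypothesis an : (a.+1 < n)%N.

Let an0 : (a < n)%N. Proof. by rewrite ltnW. Qed.

(** Each product of neighbouring [e]'s is found in two forms, by cancelling $s_a^2=1$ or
    $s_{a+1}^2=1$ in (P.6). Comparing the two forms gives [ss_e] and [e_ss]. *)
Lemma eS_e : e a.+1 * e a = - (s a * s a.+1 * e a).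
Proof.
by rewrite -[LHS]mul1r -(bp_ss H an0) -!mulrA (mulrA (s a) (e a.+1)) (bp_see H an) mulrN.
Qed.

Lemma eS_e' : e a.+1 * e a = - (e a.+1 * s a * s a.+1).
Proof.
by rewrite -[LHS]mulr1 -(bp_ss H an) [in LHS]mulrA (bp_ees' H an) mulNr.
Qed.

Lemma e_eS : e a * e a.+1 = e a * s a.+1 * s a.
Proof. by rewrite -[LHS]mulr1 -(bp_ss H an0) [in LHS]mulrA (bp_ees H an). Qed.

Lemma e_eS' : e a * e a.+1 = s a.+1 * s a * e a.+1.
Proof.
by rewrite -[LHS]mul1r -(bp_ss H an) -!mulrA [in LHS](mulrA (s a.+1) (e a)) (bp_see' H an).
Qed.

(** Thus $\varepsilon_{a+1}$ is a conjugate of $\varepsilon_a$ under permutations, which makes the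
    family [eps], indexed by all pairs of strands, possible. *)
Lemma ss_e : s a * s a.+1 * e a = e a.+1 * s a * s a.+1.
Proof. by apply: oppr_inj; rewrite -eS_e eS_e'. Qed.

Lemma e_ss : e a * s a.+1 * s a = s a.+1 * s a * e a.+1.
Proof. by rewrite -e_eS e_eS'. Qed.

End BrauerConsequences.

Section JucysMurphy.
Variables (A : pzRingType) (s e : nat -> A).
Hypothesis H : forall n, brauer_pair n s e.

(** The recursion is forced by (P.7): multiplying $s_ay_a-y_{a+1}s_a=\varepsilon_a-1$ on the right
    by $s_a$ and using $\varepsilon_as_a=-\varepsilon_a$ gives
    $y_{a+1}=s_ay_as_a+s_a+\varepsilon_a$. The start is 0. *)
Fixpoint jucys_murphy (k : nat) : A :=
  if k is k'.+1 then s k' * jucys_murphy k' * s k' + s k' + e k' else 0.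

Let ss a : s a * s a = 1. Proof. exact: (bp_ss (H a.+1)). Qed.
Let ssK a x : x * s a * s a = x. Proof. by rewrite -mulrA ss mulr1. Qed.
Let es a : e a * s a = - e a. Proof. exact: (bp_es (H a.+1)). Qed.
Let se a : s a * e a = e a. Proof. exact: (bp_se (H a.+1)). Qed.
Let ee a : e a * e a = 0. Proof. exact: (bp_ee (H a.+1)). Qed.
Let braid a : s a * s a.+1 * s a = s a.+1 * s a * s a.+1.
Proof. exact: (bp_braid (H a.+2)). Qed.
Let sC a b : (a.+1 < b)%N -> s a * s b = s b * s a.
Proof. by move=> ab; apply: (bp_sC (H b.+1)); rewrite ab /=. Qed.
Let eC a b : (a.+1 < b)%N -> e a * e b = e b * e a.
Proof. by move=> ab; apply: (bp_eC (H b.+1)); rewrite ab /=. Qed.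
Let seC a b : (a.+1 < b)%N -> s a * e b = e b * s a.
Proof. by move=> ab; apply: (bp_seC (H b.+1)); rewrite ab /=. Qed.
Let esC a b : (a.+1 < b)%N -> e a * s b = s b * e a.
Proof. by move=> ab; apply: (bp_esC (H b.+1)); rewrite ab /=. Qed.

Let commMM (u v w : A) : u * v = v * u -> u * w = w * u -> u * (v * w) = (v * w) * u.
Proof. by move=> uv uw; rewrite mulrA uv -mulrA uw mulrA. Qed.
Let commDD (u v w : A) : u * v = v * u -> u * w = w * u -> u * (v + w) = (v + w) * u.
Proof. by move=> uv uw; rewrite mulrDl mulrDr uv uw. Qed.

Local Ltac comm_split :=
  repeat lazymatch goal with
  | |- _ * (_ + _) = _ => apply: commDD
  | |- _ * (_ * _) = _ => apply: commMM
  end.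

Lemma jm_far k b : (k < b)%N -> s b * jucys_murphy k = jucys_murphy k * s b /\ e b * jucys_murphy k = jucys_murphy k * e b.
Proof.
elim: k => [|k IH] kb /=; first by rewrite !mulr0 !mul0r.
have [IHs IHe] := IH (ltnW kb).
split; rewrite /=; comm_split; [exact: esym (sC kb)|exact: IHs|exact: esym (sC kb)
  |exact: esym (sC kb)|exact: esym (esC kb)|exact: esym (seC kb)|exact: IHe
  |exact: esym (seC kb)|exact: esym (seC kb)|exact: esym (eC kb)].
Qed.

(** Induction reduces to $k=b+2$. Unfolding the recursion twice leaves a conjugated term, handled by
    the braid relation, and four linear terms, which match in pairs with those on the other side. *)
Lemma jm_near_s k b : (b.+1 < k)%N -> s b * jucys_murphy k = jucys_murphy k * s b.
Proof.
elim: k => // k IH; rewrite ltnS leq_eqVlt => /orP [/eqP <-|bk].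
  have [Js Je] := jm_far (ltnSn b).
  rewrite /=.
  rewrite !(mulrDr, mulrDl) !mulrA.
  have -> : s b * s b.+1 * s b * jucys_murphy b * s b * s b.+1
    = s b.+1 * s b * jucys_murphy b * s b * s b.+1 * s b.
    rewrite braid -(mulrA _ (s b.+1) (jucys_murphy b)) Js !mulrA.
    by rewrite -!mulrA; do 3!congr (_ * _); rewrite !mulrA braid.
  have -> : s b * s b.+1 * s b * s b.+1 = s b.+1 * s b.
    by rewrite braid ssK.
  have -> : s b.+1 * s b * s b.+1 * s b = s b * s b.+1.
    by rewrite -braid ssK.
  have -> : s b * s b.+1 * e b * s b.+1 = e b.+1 * s b.
    by rewrite (ss_e (H b.+2)) // ssK.
  have -> : s b.+1 * e b * s b.+1 * s b = s b * e b.+1.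
    by rewrite -!mulrA (mulrA (e b)) (e_ss (H b.+2)) // !mulrA ss mul1r.
  by abel.
have [Js Je] := jm_far (ltnW bk).
by rewrite /=; comm_split; rewrite ?(sC bk) ?(seC bk) ?IH.
Qed.

(** As for [jm_near_s], except that in the case $k=b+2$ the four linear terms cancel among
    themselves on each side, because of the minus signs in (P.6). *)
Lemma jm_near_e k b : (b.+1 < k)%N -> e b * jucys_murphy k = jucys_murphy k * e b.
Proof.
elim: k => // k IH; rewrite ltnS leq_eqVlt => /orP [/eqP <-|bk].
  have [Js Je] := jm_far (ltnSn b).
  rewrite /= !(mulrDr, mulrDl) !mulrA.
  have -> : e b * s b.+1 * s b * jucys_murphy b * s b * s b.+1
    = s b.+1 * s b * jucys_murphy b * s b * s b.+1 * e b.
    rewrite (e_ss (H b.+2)) // -(mulrA _ _ (jucys_murphy b)) Je -!mulrA.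
    by do 3!congr (_ * _); rewrite !mulrA -(ss_e (H b.+2)).
  rewrite -!addrA; congr (_ + _).
  have -> : e b * s b.+1 * s b * s b.+1 = - (e b * e b.+1).
    by rewrite -(e_eS (H b.+2)) // -mulrA es mulrN.
  have -> : e b * s b.+1 * e b * s b.+1 = - (e b * s b.+1).
    have -> : e b * s b.+1 * e b = - e b.
      by rewrite -{2}(se b) mulrA -(e_eS (H b.+2)) // (bp_eee (H b.+2)).
    by rewrite mulNr.
  have -> : s b.+1 * s b * s b.+1 * e b = - (e b.+1 * e b).
    rewrite -mulrA -(mulrA (s b.+1)) (mulrA (s b)).
    by rewrite -[s b * _ * _]opprK -(eS_e (H b.+2)) // mulrN mulrA se.
  have -> : s b.+1 * e b * s b.+1 * e b = - (s b.+1 * e b).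
    rewrite -!mulrA (mulrA (e b)).
    have -> : e b * s b.+1 * e b = - e b.
      by rewrite -{2}(se b) mulrA -(e_eS (H b.+2)) // (bp_eee (H b.+2)).
    by rewrite mulrN.
  by abel.
have [Js Je] := jm_far (ltnW bk).
by rewrite /=; comm_split; rewrite ?(eC bk) ?(esC bk) ?IH.
Qed.

Lemma jm_comm i j : jucys_murphy i * jucys_murphy j = jucys_murphy j * jucys_murphy i.
Proof.
wlog ij : i j / (i <= j)%N.
  by move=> W; case: (leqP i j) => [/W //|/ltnW/W ->].
elim: i ij => [|i IH] ij /=; first by rewrite mulr0 mul0r.
rewrite leq_eqVlt in ij; case/orP: ij => [/eqP <- //|ij].
by apply/esym; comm_split; rewrite ?IH ?jm_near_s ?jm_near_e // ltnW // ltnW.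
Qed.

Lemma jm_sx a : s a * jucys_murphy a - jucys_murphy a.+1 * s a = e a - 1.
Proof.
by rewrite /= !mulrDl ssK ss es; abel.
Qed.
Lemma jm_xs a : jucys_murphy a * s a - s a * jucys_murphy a.+1 = - e a - 1.
Proof.
by rewrite /= !mulrDr !mulrA ss mul1r se; abel.
Qed.

(** This is what $\varepsilon_a(y_a-y_{a+1})=\varepsilon_a$ reduces to, since
    $\varepsilon_ay_{a+1}=-\varepsilon_ay_as_a-\varepsilon_a$. In the induction
    $\varepsilon_{a+1}s_ay_a$ is rewritten as $s_as_{a+1}(\varepsilon_ay_a)s_{a+1}$, where the
    hypothesis for $a$ applies. *)
Lemma e_jm_1s a : e a * jucys_murphy a * s a = - (e a * jucys_murphy a).
Proof.
elim: a => [|a IH]; first by rewrite /= mulr0 mul0r oppr0.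
have [Js Je] := jm_far (ltnSn a).
apply/eqP; rewrite -addr_eq0; apply/eqP.
rewrite /= !mulrDr !mulrDl !mulrA.
have -> : e a.+1 * s a * jucys_murphy a * s a * s a.+1 = - (e a.+1 * s a * jucys_murphy a * s a).
  have Q : e a.+1 * s a * jucys_murphy a = s a * s a.+1 * (e a * jucys_murphy a) * s a.+1.
    rewrite -[e a.+1 * s a]mulr1 -(ss a.+1) [in LHS]mulrA -(ss_e (H a.+2)) //.
    by rewrite -!mulrA Js !mulrA.
  have -> : e a.+1 * s a * jucys_murphy a * s a * s a.+1 =
     s a * s a.+1 * (e a * jucys_murphy a * s a) * s a.+1 * s a.
    rewrite Q -!mulrA; do 4!congr (_ * _); by rewrite mulrA -braid !mulrA.
  by rewrite IH Q !(mulrN, mulNr) !mulrA.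
have -> : e a.+1 * s a * s a.+1 = - (e a.+1 * e a) by rewrite (eS_e' (H a.+2)) // opprK.
rewrite (bp_ees' (H a.+2)) //.
by abel.
Qed.

Lemma jm_e_1s a : s a * jucys_murphy a * e a = jucys_murphy a * e a.
Proof.
elim: a => [|a IH]; first by rewrite /= mulr0 mul0r.
have [Js Je] := jm_far (ltnSn a).
apply/eqP; rewrite -subr_eq0; apply/eqP.
rewrite /= !mulrDr !mulrDl !mulrA.
have Q : s a * jucys_murphy a * s a * e a.+1 = s a * s a.+1 * (jucys_murphy a * e a) * s a.+1 * s a.
  have -> : s a * jucys_murphy a * s a * e a.+1 = s a * jucys_murphy a * s a.+1 * (s a.+1 * s a * e a.+1).
    by rewrite !mulrA ssK.
  by rewrite -(e_ss (H a.+2)) // -(mulrA (s a) (jucys_murphy a)) -Js !mulrA.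
have -> : s a.+1 * s a * jucys_murphy a * s a * e a.+1 = s a * jucys_murphy a * s a * e a.+1.
  have -> : s a.+1 * s a * jucys_murphy a * s a * e a.+1 = s a.+1 * (s a * jucys_murphy a * s a * e a.+1).
    by rewrite !mulrA.
  have IHx x : s a * (jucys_murphy a * (e a * x)) = jucys_murphy a * (e a * x) by rewrite !mulrA IH.
  by rewrite Q !mulrA -braid -!mulrA IHx.
by rewrite (bp_see' (H a.+2)) // (e_eS' (H a.+2)) //; abel.
Qed.

Lemma e_jm_xx a : e a * (jucys_murphy a - jucys_murphy a.+1) = e a.
Proof.
by rewrite mulrBr /= !mulrDr !mulrA es ee !mulNr e_jm_1s; abel.
Qed.

Lemma jm_xx_e a : (jucys_murphy a - jucys_murphy a.+1) * e a = - e a.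
Proof. by rewrite mulrBl /= !mulrDl -!mulrA se ee !mulrA jm_e_1s; abel. Qed.

End JucysMurphy.

(* Moving y to y' + 1 and y' + 1 to y + 2 across the two factors e gives
   e y^k e = e (y + 2)^k e; in exponent k + 1, induction leaves 2 (k + 1) e y^k e = 0. *)
Lemma e_pow_e_eq0 (A : pzRingType) (e y y' : A) :
  (forall k (x : A), x *+ k.+1 = 0 -> x = 0) ->
  e * e = 0 -> y * y' = y' * y -> e * (y - y') = e -> (y - y') * e = - e ->
  forall k, e * y ^+ k * e = 0.
Proof.
move=> torsion ee yy' ey ye.
have ey1 : e * y = e * (y' + 1).
  by rewrite mulrDr mulr1 -[X in _ = _ + X]ey mulrBr; abel.
have ye1 : (y' + 1) * e = (y + 2) * e.
  have -> : y' = y - (y - y') by abel.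
  by rewrite mulrDl mulrBl ye !mulrDl !mul1r; abel.
have cy1 : (y' + 1) * y = y * (y' + 1) by rewrite mulrDl mulrDr mul1r mulr1 yy'.
have cy2 : (y' + 1) * (y + 2) = (y + 2) * (y' + 1).
  by rewrite [LHS]mulrDr [RHS]mulrDl cy1 (commr_nat (y' + 1) 2).
have pow k : e * y ^+ k = e * (y' + 1) ^+ k.
  elim: k => [|k IH]; first by rewrite !expr0.
  rewrite exprSr mulrA IH -mulrA (_ : (y' + 1) ^+ k * y = y * (y' + 1) ^+ k); last first.
    by apply: commr_sym; apply: commrX; apply/esym.
  by rewrite mulrA ey1 -mulrA -exprS.
have pow' k : (y' + 1) ^+ k * e = (y + 2) ^+ k * e.
  elim: k => [|k IH]; first by rewrite !expr0.
  rewrite exprS -mulrA IH mulrA (_ : (y' + 1) * (y + 2) ^+ k = (y + 2) ^+ k * (y' + 1)); last first.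
    by apply: commrX.
  by rewrite -mulrA ye1 mulrA -exprSr.
have shift k : e * (y + 2) ^+ k * e = e * y ^+ k * e by rewrite pow -!mulrA pow'.
elim/ltn_ind => k IH; apply: (torsion (k.+1 * 2).-1); rewrite prednK ?muln_gt0 //.
have := shift k.+1; rewrite exprDn_comm; last exact: commr_nat.
rewrite big_ord_recl big_ord_recl /= subn0 expr0 mulr1 bin0 mulr1n subn1 /= expr1 bin1.
rewrite !mulrDr !mulrDl => /eqP; rewrite -subr_eq0 addrAC subrr add0r mulr_sumr mulr_suml.
rewrite big1 ?addr0 => [/eqP|i _].
  move=> E; rewrite -[RHS]E.
  by rewrite mulr1 -mulr2n !mulrnAr !mulrnAl -!mulrnA mulnC.
have ki : (k.+1 - bump 0 (bump 0 i) < k)%N by rewrite /bump /=; have := ltn_ord i; lia.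
by rewrite -natrX mulr_natr !mulrnAr !mulrnAl IH // !mul0rn.
Qed.

(** * Operators on tensor powers *)

Section TensorOperators.
Variables (K : comNzRingType) (X : finType).

(* Basis of the vector superspace on which pe(n) acts: the boolean is the
   parity, and the adjunction of None only makes the alphabet nonempty. *)
Definition label := (option X * bool)%type.
Definition dual (l : label) : label := (l.1, ~~ l.2).
(** Words are infinite so that the number of tensor factors need not be fixed: an operator of index
    [a] touches only positions [a] and [a + 1]. Tensors are arbitrary functions on words, and
    operators act through the argument. *)
Definition tword := nat -> label.
Definition tensor := tword -> K.

Record tensor_op := TensorOp {
  tensor_op_fun :> tensor -> tensor;
  tensor_op_linear : forall c (f g : tensor) w,
    tensor_op_fun (fun v => c * f v + g v) w = c * tensor_op_fun f w + tensor_op_fun g w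
}.

Lemma tensor_op_ext (F G : tensor_op) : (forall f w, F f w = G f w) -> F = G.
Proof.
case: F G => [F hF] [G hG] /= FG.
have E : F = G by apply/funext => f; apply/funext => w; apply: FG.
by case: G / E hG {FG} => hG; congr TensorOp; apply: Prop_irrelevance.
Qed.

HB.instance Definition _ := gen_eqMixin tensor_op.
HB.instance Definition _ := gen_choiceMixin tensor_op.

Program Definition tensor_op_zero := @TensorOp (fun _ _ => 0) _.
Next Obligation. by rewrite mulr0 addr0. Qed.
Program Definition tensor_op_opp (F : tensor_op) := @TensorOp (fun f w => - F f w) _.
Next Obligation. by rewrite tensor_op_linear opprD mulrN. Qed.
Program Definition tensor_op_add (F G : tensor_op) := @TensorOp (fun f w => F f w + G f w) _.
Next Obligation. by rewrite !tensor_op_linear mulrDr addrACA. Qed.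
Program Definition tensor_op_one := @TensorOp (fun f w => f w) _.
Program Definition tensor_op_mul (F G : tensor_op) := @TensorOp (fun f => F (G f)) _.
Next Obligation.
rewrite -tensor_op_linear; congr (F _ w); apply/funext => v; exact: tensor_op_linear.
Qed.
Program Definition tensor_op_scale (c : K) (F : tensor_op) := @TensorOp (fun f w => c * F f w) _.
Next Obligation. by rewrite !tensor_op_linear mulrDr !mulrA (mulrC c c0). Qed.

Fact tensor_op_addA : associative tensor_op_add.
Proof. by move=> F G H; apply: tensor_op_ext => f w /=; rewrite addrA. Qed.
Fact tensor_op_addC : commutative tensor_op_add.
Proof. by move=> F G; apply: tensor_op_ext => f w /=; rewrite addrC. Qed.
Fact tensor_op_add0 : left_id tensor_op_zero tensor_op_add.
Proof. by move=> F; apply: tensor_op_ext => f w /=; rewrite add0r. Qed.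
Fact tensor_op_addN : left_inverse tensor_op_zero tensor_op_opp tensor_op_add.
Proof. by move=> F; apply: tensor_op_ext => f w /=; rewrite addNr. Qed.
HB.instance Definition _ := GRing.isZmodule.Build tensor_op tensor_op_addA tensor_op_addC tensor_op_add0 tensor_op_addN.

Fact tensor_op_mulA : associative tensor_op_mul.
Proof. by move=> F G H; apply: tensor_op_ext. Qed.
Fact tensor_op_mul1 : left_id tensor_op_one tensor_op_mul.
Proof. by move=> F; apply: tensor_op_ext. Qed.
Fact tensor_op_mulr1 : right_id tensor_op_one tensor_op_mul.
Proof. by move=> F; apply: tensor_op_ext. Qed.
Fact tensor_op_mulDl : left_distributive tensor_op_mul +%R.
Proof. by move=> F G H; apply: tensor_op_ext. Qed.
Lemma tensor_opD (F : tensor_op) f g w : F (fun v => f v + g v) w = F f w + F g w.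
Proof.
by rewrite -[F f w]mul1r -tensor_op_linear; congr (F _ w); apply/funext => v; rewrite mul1r.
Qed.
Lemma tensor_op0 (F : tensor_op) w : F (fun _ => 0) w = 0.
Proof.
have := tensor_opD F (fun _ => 0) (fun _ => 0) w.
rewrite (_ : (fun _ => 0 + 0) = (fun _ => 0)); last by apply/funext => v; rewrite addr0.
by move/eqP; rewrite -subr_eq0 opprD addrA subrr add0r oppr_eq0 => /eqP.
Qed.
Lemma tensor_opZ (F : tensor_op) c f w : F (fun v => c * f v) w = c * F f w.
Proof.
rewrite -[RHS]addr0 -(tensor_op0 F w) -tensor_op_linear; congr (F _ w).
by apply/funext => v; rewrite addr0.
Qed.
Fact tensor_op_mulDr : right_distributive tensor_op_mul +%R.
Proof. by move=> F G H; apply: tensor_op_ext => f w; apply: tensor_opD. Qed.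
Fact tensor_op_one_neq0 : tensor_op_one != 0 :> tensor_op.
Proof.
apply/eqP => /(congr1 (fun F : tensor_op => F (fun=> 1) (fun=> (None, true)))) /= /eqP.
by rewrite oner_eq0.
Qed.
HB.instance Definition _ := GRing.Zmodule_isNzRing.Build tensor_op
  tensor_op_mulA tensor_op_mul1 tensor_op_mulr1 tensor_op_mulDl tensor_op_mulDr tensor_op_one_neq0.

Fact tensor_op_scaleA a b F : tensor_op_scale a (tensor_op_scale b F) = tensor_op_scale (a * b) F.
Proof. by apply: tensor_op_ext => f w /=; rewrite mulrA. Qed.
Fact tensor_op_scale1 : left_id 1 tensor_op_scale.
Proof. by move=> F; apply: tensor_op_ext => f w /=; rewrite mul1r. Qed.
Fact tensor_op_scaleDr : right_distributive tensor_op_scale +%R.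
Proof. by move=> c F G; apply: tensor_op_ext => f w /=; rewrite mulrDr. Qed.
Fact tensor_op_scaleDl F : {morph tensor_op_scale^~ F : a b / a + b}.
Proof. by move=> a b; apply: tensor_op_ext => f w /=; rewrite mulrDl. Qed.
HB.instance Definition _ := GRing.Zmodule_isLmodule.Build K tensor_op
  tensor_op_scaleA tensor_op_scale1 tensor_op_scaleDr tensor_op_scaleDl.
Fact tensor_op_scalerAl (c : K) (F G : tensor_op) : c *: (F * G) = (c *: F) * G.
Proof. by apply: tensor_op_ext. Qed.
HB.instance Definition _ := GRing.Lmodule_isLalgebra.Build K tensor_op tensor_op_scalerAl.
Fact tensor_op_scalerAr (c : K) (F G : tensor_op) : c *: (F * G) = F * (c *: G).
Proof. by apply: tensor_op_ext => f w; rewrite /= [RHS]tensor_opZ. Qed.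
HB.instance Definition _ := GRing.Lalgebra_isAlgebra.Build K tensor_op tensor_op_scalerAr.

Lemma tensor_op_sumE (I : Type) (r : seq I) (P : pred I) (F : I -> tensor_op) f w :
  (\sum_(i <- r | P i) F i) f w = \sum_(i <- r | P i) F i f w.
Proof. by elim/big_rec2: _ => [|i x F' _ <-]. Qed.

Definition upd (w : tword) (a : nat) (l : label) : tword :=
  fun i => if i == a then l else w i.

Definition tswap (a b : nat) (w : tword) : tword := upd (upd w a (w b)) b (w a).

Definition sgn (b : bool) : K := (-1) ^+ b.

Program Definition swap_op (a : nat) : tensor_op :=
  @TensorOp (fun f w => sgn ((w a).2 && (w a.+1).2) * f (tswap a a.+1 w)) _.
Next Obligation. by rewrite mulrDr mulrCA. Qed.

(** The odd form pairs a label with its [dual], of opposite parity. A sign occurs in the sum but not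
    in the condition on [w]; hence $s_a\varepsilon_a=\varepsilon_a$ but
    $\varepsilon_as_a=-\varepsilon_a$, and $\varepsilon_a^2=0$ because the signs of all labels add
    up to 0. *)
Program Definition cup_op (a : nat) : tensor_op :=
  @TensorOp (fun f w => if w a.+1 == dual (w a) then
     \sum_(l : label) sgn l.2 * f (upd (upd w a l) a.+1 (dual l)) else 0) _.
Next Obligation.
case: ifP => _; last by rewrite mulr0 addr0.
by rewrite mulr_sumr -big_split; apply: eq_bigr => l _; rewrite /= mulrDr mulrCA.
Qed.

Lemma cup_opE a f w : cup_op a f w = if w a.+1 == dual (w a) then
     \sum_(l : label) sgn l.2 * f (upd (upd w a l) a.+1 (dual l)) else 0.
Proof. by []. Qed.

Lemma dualK : involutive dual. Proof. by case=> x b; rewrite /dual /= negbK. Qed.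
Lemma dual_eq l m : (l == dual m) = (m == dual l).
Proof. by apply/eqP/eqP => ->; rewrite dualK. Qed.

Lemma updE w a l i : upd w a l i = if i == a then l else w i. Proof. by []. Qed.
Lemma tswapE w a b i :
  tswap a b w i = if i == b then w a else if i == a then w b else w i.
Proof. by []. Qed.

Lemma sum_delta (P : pred label) l0 (F G : label -> K) : (forall l, P l = (l == l0)) ->
  \sum_l G l * (if P l then F l else 0) = G l0 * F l0.
Proof.
move=> P1; rewrite (bigD1 l0) //= P1 eqxx big1 ?addr0 // => l ll0.
by rewrite P1 (negPf ll0) mulr0.
Qed.

Lemma sum_dual (F : label -> K) : \sum_l F (dual l) = \sum_l F l.
Proof. by rewrite [RHS](reindex_inj (can_inj dualK)). Qed.

Lemma sgnM b : sgn b * sgn b = 1. Proof. by rewrite -expr2 sqrr_sign. Qed.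
Lemma sgnN b : sgn (~~ b) = - sgn b.
Proof. by case: b; rewrite /sgn /= expr1 ?opprK. Qed.

Local Ltac wordeq := apply/funext => ?; rewrite !(updE, tswapE);
  repeat (case: eqP => ? //=; subst); try lia; rewrite ?dualK; try by [].

Lemma sum_sgn : \sum_(l : label) sgn l.2 = 0.
Proof.
rewrite (eq_bigr (fun l : label => sgn l.2)) //.
rewrite -(pair_bigA _ (fun (x : option X) b => sgn b)) /=.
apply: big1 => x _; by rewrite big_bool /= (_ : true = ~~ false) // sgnN addNr.
Qed.

Lemma upd_neq w a i l : i != a -> upd w a l i = w i.
Proof. by rewrite updE => /negPf ->. Qed.

Let aS a : (a == a.+1) = false. Proof. by apply/negbTE; lia. Qed.
Let Sa a : (a.+1 == a) = false. Proof. by apply/negbTE; lia. Qed.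
Let aSS a : (a == a.+2) = false. Proof. by apply/negbTE; lia. Qed.
Let SSa a : (a.+2 == a) = false. Proof. by apply/negbTE; lia. Qed.
Let simw := (updE, tswapE, aS, Sa, aSS, SSa, eqSS, eqxx).

Let far a b : (a.+1 < b)%N ->
  [/\ (b == a) = false, (a == b) = false, (b == a.+1) = false & (a.+1 == b) = false].
Proof. by move=> ?; split; apply/negbTE; lia. Qed.
Let far' a b : (a.+1 < b)%N ->
  [/\ (b.+1 == a) = false, (a == b.+1) = false, (b.+1 == a.+1) = false & (a.+1 == b.+1) = false].
Proof. by move=> ?; split; apply/negbTE; lia. Qed.

(** In a product of cups sharing one strand, the condition of the inner cup determines the label
    summed over by the outer one, so [sum_delta] collapses all sums but one. What remains is a check
    of signs over finitely many parities. *)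
Lemma tensor_brauer_pair n : brauer_pair n swap_op cup_op.
Proof.
split.
- move=> a _; apply: tensor_op_ext => f w /=.
  rewrite !simw andbC mulrA sgnM mul1r; congr f; wordeq.
- move=> a b /andP[ab _]; apply: tensor_op_ext => f w; rewrite /= mulrCA.
  have [F1 F2 F3 F4] := far ab; have [F5 F6 F7 F8] := far' ab.
  rewrite !simw !(F1, F2, F3, F4, F5, F6, F7, F8); do 2!congr (_ * _).
  congr f; wordeq.
- move=> a _; apply: tensor_op_ext => f w; rewrite /= !simw !mulrA; congr (_ * f _); last by wordeq.
  ring.
- move=> a _; apply: tensor_op_ext => f w; rewrite /=; case: ifP => // _.
  rewrite (eq_bigr (fun l : label => sgn l.2 * (\sum_(m : label) sgn m.2 *
       f (upd (upd w a m) a.+1 (dual m))))) => [|l _].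
    by rewrite -mulr_suml sum_sgn mul0r.
  rewrite !simw; congr (_ * _); apply: eq_bigr => m _; congr (_ * f _); wordeq.
- move=> a b /andP[ab _]; apply: tensor_op_ext => f w; rewrite /=.
  have [F1 F2 F3 F4] := far ab; have [F5 F6 F7 F8] := far' ab.
  under eq_bigr => l _ do rewrite !simw !(F1, F2, F3, F4, F5, F6, F7, F8).
  under [in RHS]eq_bigr => l _ do rewrite !simw !(F1, F2, F3, F4, F5, F6, F7, F8).
  case: ifP => _; case: ifP => _ //; rewrite ?(big1 _ _ _ (fun _ _ => mulr0 _)) //.
  under eq_bigr => l _ do rewrite mulr_sumr.
  rewrite exchange_big; apply: eq_bigr => l _; rewrite mulr_sumr; apply: eq_bigr => m _.
  by rewrite mulrCA; congr (_ * (_ * f _)); wordeq.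
- move=> a b /andP[ab _]; apply: tensor_op_ext => f w; rewrite /= !simw.
  have [F1 F2 F3 F4] := far ab; have [F5 F6 F7 F8] := far' ab.
  rewrite !(F1, F2, F3, F4, F5, F6, F7, F8).
  case: ifP => _; last by rewrite mulr0.
  rewrite mulr_sumr; apply: eq_bigr => l _; rewrite !simw !(F1, F2, F3, F4, F5, F6, F7, F8).
  by rewrite mulrCA; congr (_ * (_ * f _)); wordeq.
- move=> a b /andP[ab _]; apply: tensor_op_ext => f w; rewrite /= !simw.
  have [F1 F2 F3 F4] := far ab; have [F5 F6 F7 F8] := far' ab.
  rewrite !(F1, F2, F3, F4, F5, F6, F7, F8).
  case: ifP => _; last by rewrite mulr0.
  rewrite mulr_sumr; apply: eq_bigr => l _; rewrite !simw !(F1, F2, F3, F4, F5, F6, F7, F8).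
  by rewrite mulrCA; congr (_ * (_ * f _)); wordeq.
- move=> a _; apply: tensor_op_ext => f w /=; case: ifP => _; last by rewrite oppr0.
  rewrite -sumrN -[RHS]sum_dual; apply: eq_bigr => l _; rewrite !simw /= andbN mul1r sgnN.
  by rewrite mulNr opprK; congr (_ * f _); wordeq.
- move=> a _; apply: tensor_op_ext => f w /=; rewrite !simw [w a == _]dual_eq.
  case: ifP => [/eqP ->|_]; last by rewrite mulr0.
  rewrite /= ?andbN ?andNb mul1r; apply: eq_bigr => l _; congr (_ * f _); wordeq.
- move=> a _; apply: tensor_op_ext => f w /=; rewrite !simw.
  case: ifP => [/eqP E|_]; last by rewrite !mulr0 oppr0.
  rewrite (sum_delta _ _ (l0 := dual (w a.+1))) => [|l]; last by rewrite !simw.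
  rewrite E !mulr_sumr -sumrN; apply: eq_bigr => l _.
  rewrite (_ : upd (upd _ a l) _ _ = upd (upd (tswap a.+1 a.+2 w) a l) a.+1 (dual l)); last by wordeq.
  by case: (w a) (w a.+1) => x [] [y []]; rewrite /sgn /=; ring.
- move=> a _; apply: tensor_op_ext => f w /=.
  case: ifP => [/eqP E|_] //.
  rewrite (sum_delta _ _ (l0 := w a.+2)) => [|l]; last by rewrite !simw ?dualK // eq_sym.
  rewrite !mulr_sumr; apply: eq_bigr => l _; rewrite !simw /=.
  rewrite (_ : tswap _ _ _ = tswap a.+1 a.+2 (upd (upd w a l) a.+1 (dual l))); last by wordeq.
  by case: (w a.+2) l => x [] [y []]; rewrite /sgn /=; ring.
- move=> a _; apply: tensor_op_ext => f w /=.
  case: ifP => [/eqP E|_]; last by rewrite oppr0.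
  rewrite (sum_delta _ _ (l0 := dual (w a))) => [|l]; last by rewrite !simw.
  rewrite !mulr_sumr -sumrN; apply: eq_bigr => l _; rewrite !simw /=.
  rewrite (_ : tswap _ _ _ = tswap a a.+1 (upd (upd w a.+1 l) a.+2 (dual l))); last by wordeq.
  by case: (w a) l => x [] [y []]; rewrite /sgn /=; ring.
- move=> a _; apply: tensor_op_ext => f w /=; rewrite !simw.
  case: ifP => [/eqP E|_]; last by rewrite !mulr0.
  rewrite (sum_delta _ _ (l0 := w a.+1)) => [|l]; last by rewrite !simw ?dualK // eq_sym.
  rewrite E !mulr_sumr; apply: eq_bigr => l _.
  rewrite (_ : upd (upd _ a.+1 l) _ _ = upd (upd (tswap a a.+1 w) a.+1 l) a.+2 (dual l)); last by wordeq.
  by case: (w a) (w a.+1) => x [] [y []]; rewrite /sgn /=; ring.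
- move=> a _; apply: tensor_op_ext => f w /=.
  case: ifP => [/eqP E|_]; last by rewrite oppr0.
  rewrite (sum_delta _ _ (l0 := dual (w a))) => [|l]; last by rewrite !simw.
  rewrite (sum_delta _ _ (l0 := w a)) => [|l]; last by rewrite !simw ?dualK // eq_sym.
  rewrite !mulr_sumr -sumrN; apply: eq_bigr => l _.
  rewrite (_ : upd (upd _ a.+1 l) _ _ = upd (upd w a.+1 l) a.+2 (dual l)); last by wordeq.
  by case: (w a) => x []; rewrite /sgn /=; ring.
- move=> a _; apply: tensor_op_ext => f w /=.
  case: ifP => [/eqP E|_]; last by rewrite oppr0.
  rewrite (sum_delta _ _ (l0 := w a.+2)) => [|l]; last by rewrite !simw ?dualK // eq_sym.
  rewrite (sum_delta _ _ (l0 := dual (w a.+2))) => [|l]; last by rewrite !simw.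
  rewrite !mulr_sumr -sumrN; apply: eq_bigr => l _.
  rewrite (_ : upd (upd _ a l) _ _ = upd (upd w a l) a.+1 (dual l)); last by wordeq.
  by case: (w a.+2) => x []; rewrite /sgn /=; ring.
Qed.
End TensorOperators.

(** * Representations of the affine algebra *)

Section Evaluation.
Variables (K : comNzRingType) (d : nat) (B : algType K).
Variables (s e : 'I_d.-1 -> B) (y : 'I_d -> B).
Hypothesis rel_eq : forall p q, periplectic_rel s e y p q -> p = q.

Definition eval_gen (x : periplectic_gen d) : B :=
  match x with inl (inl a) => s a | inl (inr a) => e a | inr j => y j end.

Definition eval_word (m : {fmonom periplectic_gen d}) : B :=
  \prod_(x <- (m : seq _)) eval_gen x.

Fact eval_wordM : mmorphism eval_word.
Proof.
split=> [m n|]; rewrite /eval_word; first by rewrite fmM big_cat.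
by rewrite fm1 big_nil.
Qed.

HB.instance Definition _ := isMultiplicative.Build _ _ eval_word eval_wordM.

Definition eval_free (p : free_algebra K (periplectic_gen d)) : B :=
  mmap (in_alg B) eval_word p.

HB.instance Definition _ :=
  GRing.Additive.copy eval_free (mmap (in_alg B) eval_word).

Fact eval_free_multiplicative : multiplicative eval_free.
Proof.
apply: commr_mmap_is_multiplicative => p m m'.
by rewrite /GRing.comm /= mulr_algl mulr_algr.
Qed.

HB.instance Definition _ :=
  GRing.isMultiplicative.Build _ _ eval_free eval_free_multiplicative.

Lemma eval_free_gen x : eval_free (free_gen K x) = eval_gen x.
Proof.
by rewrite /eval_free mmapU /= scale1r mul1r /eval_word fmU big_seq1.
Qed.

Lemma eval_freeZ c p : eval_free (c *: p) = c *: eval_free p.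
Proof. by rewrite /eval_free mmapZ /= mulr_algl. Qed.

Let rel := periplectic_rel (@free_s K d) (@free_eps K d) (@free_y K d).

Lemma eval_free_rel p q : rel p q -> eval_free p = eval_free q.
Proof.
move=> pq; apply: rel_eq.
by apply: (periplectic_rel_morph (f := eval_free) _ _ _ pq) => x; rewrite [LHS]eval_free_gen.
Qed.

Lemma eval_free_ideal p : relation_ideal rel p -> eval_free p = 0.
Proof.
elim=> [q r /eval_free_rel qr||q r _ q0 _ r0|a q _ q0|a q _ q0].
- by rewrite (rmorphB eval_free q r) /= qr subrr.
- exact: rmorph0.
- by rewrite (rmorphD eval_free q r) /= q0 r0 addr0.
- by rewrite (rmorphM eval_free a q) /= q0 mulr0.
- by rewrite (rmorphM eval_free q a) /= q0 mul0r.
Qed.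

Definition eval_aff (u : affine_periplectic K d) : B := eval_free (generic_quotient.repr u).

Lemma eval_aff_class p : eval_aff (presented_class rel p) = eval_free p.
Proof.
apply/eqP; rewrite -subr_eq0 -(rmorphB eval_free); apply/eqP.
exact/eval_free_ideal/repr_presented_class.
Qed.

Fact eval_affB : {morph eval_aff : u v / u - v}.
Proof.
move=> u v; case: (presented_class_surj u) (presented_class_surj v) => p -> [q ->].
have -> : presented_class rel p - presented_class rel q = presented_class rel (p - q).
  by rewrite [RHS](raddfB \pi_(presented_algebra rel)%qT).
by rewrite !eval_aff_class (rmorphB eval_free).
Qed.

Fact eval_affM : multiplicative eval_aff.
Proof.
split=> [u v|]; last by rewrite [1]/(presented_class rel 1) eval_aff_class (rmorph1 eval_free).
case: (presented_class_surj u) (presented_class_surj v) => p -> [q ->].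
have -> : (presented_class rel p : affine_periplectic K d) * presented_class rel q
   = presented_class rel (p * q).
  by rewrite [RHS]presented_classM.
by rewrite !eval_aff_class (rmorphM eval_free).
Qed.

Fact eval_affZ : scalable eval_aff.
Proof.
move=> c u; case: (presented_class_surj u) => p ->.
have -> : c *: (presented_class rel p : affine_periplectic K d) = presented_class rel (c *: p).
  by rewrite [RHS]presented_classZ.
by rewrite !eval_aff_class eval_freeZ.
Qed.

HB.instance Definition _ := GRing.isAdditive.Build _ _ eval_aff eval_affB.
HB.instance Definition _ := GRing.isMultiplicative.Build _ _ eval_aff eval_affM.
HB.instance Definition _ := GRing.isScalable.Build K _ _ _ eval_aff eval_affZ.

Lemma eval_aff_gen x : eval_aff (periplectic_class K x) = eval_gen x.
Proof. by rewrite /periplectic_class eval_aff_class eval_free_gen. Qed.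

End Evaluation.

Section TensorRepresentation.
Variables (K : numFieldType) (X : finType) (d N : nat).

Local Notation tJ := (jucys_murphy (@swap_op K X) (@cup_op K X)).

Lemma tensor_op_torsion k (F : tensor_op K X) : F *+ k.+1 = 0 -> F = 0.
Proof.
move=> kF; have : k.+1%:R^-1 *: (F *+ k.+1) = 0 by rewrite kF scaler0.
by rewrite -scaler_nat scalerA mulVf ?pnatr_eq0 // scale1r.
Qed.

Lemma tensor_rel (p q : tensor_op K X) :
  periplectic_rel (fun a : 'I_d.-1 => swap_op K X (N + a)) (fun a => cup_op K X (N + a))
     (fun j : 'I_d => tJ (N + j)) p q -> p = q.
Proof.
have H n := tensor_brauer_pair K X n.
have ne (i : 'I_d) (a : 'I_d.-1) : i != pos_left a -> i != pos_right a -> (i < a)%N || (a.+1 < i)%N.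
  by rewrite -!val_eqE /=; lia.
have far (a b : 'I_d.-1) (P : nat -> nat -> Prop) : (forall i j, P i j -> P j i) ->
   (forall i j, (i.+1 < j)%N -> P i j) -> far_apart a b -> P (N + a)%N (N + b)%N.
  move=> sP hP /orP [ab|ab]; [|apply: sP]; apply: hP; lia.
have near i (a : 'I_d.-1) : (i < a)%N || (a.+1 < i)%N ->
   swap_op K X (N + a) * tJ (N + i) = tJ (N + i) * swap_op K X (N + a) /\
   cup_op K X (N + a) * tJ (N + i) = tJ (N + i) * cup_op K X (N + a).
  case/orP => ia; first by apply: jm_far => //; lia.
  by split; [apply: jm_near_s|apply: jm_near_e] => //; lia.
have lt1 i : (i < i.+1)%N := ltnSn i.
have lt2 i : (i.+1 < i.+2)%N := ltnSn i.+1.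
case.
- by move=> a; apply: (bp_ss (H _)).
- move=> a b; apply: (far _ _ (fun i j => swap_op K X i * swap_op K X j = swap_op K X j * swap_op K X i)) => // i j ij.
  by apply: (bp_sC (H j.+1)); rewrite ij /=.
- by move=> c c' ->; rewrite addnS; apply: (bp_braid (H _)).
- by move=> a i h1 h2; have [] := near i a (ne _ _ h1 h2).
- by move=> a; apply: (bp_ee (H _)).
(* (P.4) does not come from the Brauer relations. It follows, for all exponents together, from
   (P.8), the commutation of consecutive Jucys-Murphy elements and the absence of torsion. *)
- move=> a k _ _; apply: e_pow_e_eq0 (tJ (N + a).+1) _ _ _ _ _ _.
  + exact: tensor_op_torsion.
  + exact: (bp_ee (H _)).
  + exact: jm_comm.
  + exact: e_jm_xx.
  + exact: jm_xx_e.
- move=> a b /orP [] ab.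
    by apply: (bp_seC (H (N + b).+1)); lia.
  by apply/esym; apply: (bp_esC (H (N + a).+1)); lia.
- move=> a b; apply: (far _ _ (fun i j => cup_op K X i * cup_op K X j = cup_op K X j * cup_op K X i)) => // i j ij.
  by apply: (bp_eC (H j.+1)); rewrite ij /=.
- by move=> a i h1 h2; have [] := near i a (ne _ _ h1 h2).
- by move=> i j; apply: jm_comm.
- by move=> a; apply: (bp_es (H _)).
- by move=> a; rewrite (bp_se (H (N + a).+1)).

- by move=> c c' ->; rewrite addnS; apply: (bp_see (H _)).
- by move=> c c' ->; rewrite addnS; apply: (bp_ees (H _)).
- by move=> c c' ->; rewrite addnS; apply: (bp_ees' (H _)).
- by move=> c c' ->; rewrite addnS; apply: (bp_see' (H _)).
- by move=> c c' ->; rewrite addnS; apply: (bp_eee' (H _)).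
- by move=> c c' ->; rewrite addnS; apply: (bp_eee (H _)).
- by move=> a; rewrite /= addnS; apply: jm_sx.
- by move=> a; rewrite /= addnS; apply: jm_xs.
- by move=> a; rewrite /= addnS; apply: e_jm_xx.
- by move=> a; rewrite /= addnS; apply: jm_xx_e.
Qed.

Definition tensor_rep : affine_periplectic K d -> tensor_op K X := eval_aff (d := d) (B := tensor_op K X)
  (fun a => swap_op K X (N + a)) (fun a => cup_op K X (N + a)) (fun j => tJ (N + j)).

Fact tensor_repB : {morph tensor_rep : u v / u - v}.
Proof. exact: (eval_affB tensor_rel). Qed.
Fact tensor_repM : multiplicative tensor_rep.
Proof. exact: (eval_affM tensor_rel). Qed.
Fact tensor_repZ : scalable tensor_rep.
Proof. exact: (eval_affZ tensor_rel). Qed.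
HB.instance Definition _ := GRing.isAdditive.Build _ _ tensor_rep tensor_repB.
HB.instance Definition _ := GRing.isMultiplicative.Build _ _ tensor_rep tensor_repM.
HB.instance Definition _ := GRing.isScalable.Build K _ _ _ tensor_rep tensor_repZ.

Lemma tensor_rep_gen x : tensor_rep (periplectic_class K x) =
  match x with
  | inl (inl a) => swap_op K X (N + a) | inl (inr a) => cup_op K X (N + a) | inr j => tJ (N + j)
  end.
Proof. by rewrite [LHS](eval_aff_gen tensor_rel); case: x => [[]|]. Qed.

End TensorRepresentation.

(** * Diagrams as elements of the algebra *)

Section Coxeter.
Variable n : nat.

Definition adj_tperm (a : nat) : 'S_n.+1 := tperm (inord a) (inord a.+1).

(* Letters compose from right to left, as functions on strands do. *)
Fixpoint word_perm (w : seq nat) : 'S_n.+1 :=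
  if w is a :: w' then (word_perm w' * adj_tperm a)%g else 1%g.

Inductive braid_eq : seq nat -> seq nat -> Prop :=
| braid_eq_refl w : braid_eq w w
| braid_eq_sym u v : braid_eq u v -> braid_eq v u
| braid_eq_trans u v w : braid_eq u v -> braid_eq v w -> braid_eq u w
| braid_eq_ctx l r u v : braid_eq u v -> braid_eq (l ++ u ++ r) (l ++ v ++ r)
| braid_eq_ss a : (a < n)%N -> braid_eq [:: a; a] [::]
| braid_eq_sC a b : (a.+1 < b < n)%N -> braid_eq [:: a; b] [:: b; a]
| braid_eq_braid a : (a.+1 < n)%N -> braid_eq [:: a; a.+1; a] [:: a.+1; a; a.+1].

Lemma word_perm_cat u v : word_perm (u ++ v) = (word_perm v * word_perm u)%g.
Proof. by elim: u => [|a u IH] /=; rewrite ?mulg1 // IH mulgA. Qed.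

Let inord_neq a b : (a <= n)%N -> (b <= n)%N -> a != b -> (inord a : 'I_n.+1) != inord b.
Proof. by move=> an bn; rewrite -val_eqE /= !inordK. Qed.

Lemma adj_tperm_comm a b : (a.+1 < b < n)%N -> (adj_tperm a * adj_tperm b = adj_tperm b * adj_tperm a)%g.
Proof.
move=> ab; rewrite [RHS]conjgC tpermJ.
by rewrite !tpermD //; apply: inord_neq; lia.
Qed.

Lemma adj_tperm_braid a : (a.+1 < n)%N -> (adj_tperm a * adj_tperm a.+1 * adj_tperm a = adj_tperm a.+1 * adj_tperm a * adj_tperm a.+1)%g.
Proof.
move=> an.
have -> : (adj_tperm a * adj_tperm a.+1 * adj_tperm a = adj_tperm a.+1 ^ adj_tperm a)%g by rewrite /conjg tpermV mulgA.
have -> : (adj_tperm a.+1 * adj_tperm a * adj_tperm a.+1 = adj_tperm a ^ adj_tperm a.+1)%g by rewrite /conjg tpermV mulgA.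
rewrite !tpermJ tpermR tpermL.
rewrite (tpermD (z := inord a.+2)); do ?[by apply: inord_neq; lia].
by rewrite (tpermD (z := inord a)); do ?[by apply: inord_neq; lia].
Qed.

Lemma braid_eq_word_perm u v : braid_eq u v -> word_perm u = word_perm v.
Proof.
elim=> {u v} //.
- by move=> u v w _ -> _ ->.
- by move=> l r u v _ E; rewrite !word_perm_cat E.
- by move=> a an /=; rewrite mul1g tperm2.
- by move=> a b ab /=; rewrite !mul1g (adj_tperm_comm ab).
- by move=> a an /=; rewrite !mul1g adj_tperm_braid.
Qed.

Lemma braid_eq_cons a u v : braid_eq u v -> braid_eq (a :: u) (a :: v).
Proof. by move=> uv; have := braid_eq_ctx [:: a] [::] uv; rewrite /= !cats0. Qed.
Lemma braid_eq_catl l u v : braid_eq u v -> braid_eq (l ++ u) (l ++ v).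
Proof. by move=> uv; have := braid_eq_ctx l [::] uv; rewrite !cats0. Qed.
Lemma braid_eq_catr r u v : braid_eq u v -> braid_eq (u ++ r) (v ++ r).
Proof. by move=> uv; have := braid_eq_ctx [::] r uv. Qed.

Lemma braid_eq_sC' a b : (b < n)%N -> (a < n)%N -> (a.+1 < b)%N || (b.+1 < a)%N -> braid_eq [:: a; b] [:: b; a].
Proof.
move=> bn an /orP [ab|ab]; first by apply: braid_eq_sC; rewrite ab.
by apply: braid_eq_sym; apply: braid_eq_sC; rewrite ab.
Qed.

Lemma braid_eq_far b l : (b < n)%N ->
  all (fun a => (a < n)%N && ((a.+1 < b)%N || (b.+1 < a)%N)) l -> braid_eq (b :: l) (rcons l b).
Proof.
move=> bn; elim: l => [|a l IH] /=; first by move=> _; apply: braid_eq_refl.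
case/andP=> /andP[an ab] /IH l_b.
apply: braid_eq_trans (braid_eq_cons a l_b).
apply: (braid_eq_catr l (u := [:: b; a]) (v := [:: a; b])).
by apply: braid_eq_sC' => //; rewrite orbC.
Qed.

(** The runs $a,a+1,\dots,m$ represent the cosets of the subgroup generated by the letters below
    $m$. A letter [b] put in front of a run commutes with it if $b+1<a$, extends it if $b+1=a$,
    cancels its first letter if $b=a$, and otherwise comes out at the right end as $b-1$. *)
Lemma braid_eq_push m a b : (m < n)%N -> (b <= m)%N -> (a <= m.+1)%N ->
  exists a' w', [/\ (a' <= m.+1)%N, all (fun x => (x < m)%N) w' &
    braid_eq (b :: iota a (m.+1 - a)) (iota a' (m.+1 - a') ++ w')].
Proof.
move=> mn bm am; case: (ltngtP b.+1 a) => [ba|ab|ba].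
- exists a, [:: b]; split=> //; first by rewrite /= andbT; lia.
  rewrite cats1; apply: braid_eq_far; first by lia.
  by apply/allP => x; rewrite mem_iota; lia.
- rewrite ltnS leq_eqVlt in ab; case/orP: ab => [/eqP ab|ab].
    rewrite -ab; exists a.+1, [::]; rewrite cats0; split=> //; first by lia.
    rewrite subSn; last by lia.
    have aa : braid_eq [:: a; a] [::] by apply: braid_eq_ss; lia.
    by rewrite subSS /=; apply: (braid_eq_catr (iota a.+1 (m - a)) aa).
  exists a, [:: b.-1]; split=> //; first by rewrite /= andbT; lia.
  have -> : iota a (m.+1 - a) = iota a (b.-1 - a) ++ [:: b.-1; b] ++ iota b.+1 (m - b).
    have -> : (m.+1 - a = (b.-1 - a) + (2 + (m - b)))%N by lia.
    by rewrite iotaD; congr (_ ++ _); rewrite /= subnKC; [do 2!congr (_ :: _); [lia|congr iota; lia]|lia].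
  rewrite -cat_cons -!catA.
  have h1 : braid_eq (b :: iota a (b.-1 - a)) (rcons (iota a (b.-1 - a)) b).
    by apply: braid_eq_far; [lia|apply/allP => x; rewrite mem_iota; lia].
  apply: braid_eq_trans (braid_eq_catr _ h1) _; rewrite -cats1 -!catA; apply: braid_eq_catl.
  have h2 : braid_eq [:: b; b.-1; b] [:: b.-1; b; b.-1].
    by apply: braid_eq_sym; have := braid_eq_braid (a := b.-1); rewrite prednK; [apply; lia|lia].
  apply: braid_eq_trans (braid_eq_catr (iota b.+1 (m - b)) h2) _ => /=.
  apply: braid_eq_cons; apply: braid_eq_cons; rewrite cats1; apply: braid_eq_far; first by lia.
  by apply/allP => x; rewrite mem_iota; lia.
- exists b, [::]; split=> //; first by lia.
  rewrite cats0 -ba -[in X in braid_eq _ X]subSS [in X in braid_eq _ X]subSn; last by lia.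
  by apply: braid_eq_refl.
Qed.

Lemma braid_eq_norm m w : (m < n)%N -> all (fun x => (x <= m)%N) w ->
  exists a w', [/\ (a <= m.+1)%N, all (fun x => (x < m)%N) w' &
    braid_eq w (iota a (m.+1 - a) ++ w')].
Proof.
move=> mn; elim: w => [_|b w IH /= /andP[bm /IH [a [w' [am w'm ww']]]]].
  by exists m.+1, [::]; split=> //; rewrite subnn; apply: braid_eq_refl.
have [a' [w'' [a'm w''m E]]] := braid_eq_push mn bm am.
exists a', (w'' ++ w'); split=> //; first by rewrite all_cat w''m.
by rewrite catA; apply: braid_eq_trans (braid_eq_cons b ww') _; apply: (braid_eq_catr w' E).
Qed.

Lemma word_perm_fix w m : all (fun x => (x < m)%N) w -> (m < n)%N -> word_perm w (inord m.+1) = inord m.+1.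
Proof.
move=> wm mn; elim: w wm => [|a w IH] /=; first by rewrite perm1.
by case/andP=> am /IH; rewrite permM => ->; rewrite tpermD //; apply: inord_neq; lia.
Qed.

Lemma word_perm_iota k a : (a + k <= n)%N -> word_perm (iota a k) (inord (a + k)) = inord a.
Proof.
elim: k a => [|k IH] a ak /=; first by rewrite perm1 addn0.
by rewrite permM -addSnnS IH ?tpermR //; lia.
Qed.

(** In the normal form of a word only the leading run moves the last strand, so for the identity
    permutation this run is empty and the remaining word has smaller letters. *)
Lemma braid_eq_word_perm1 w : all (fun x => (x < n)%N) w -> word_perm w = 1%g -> braid_eq w [::].
Proof.
suff W m : (m <= n)%N -> forall v, all (fun x => (x < m)%N) v -> word_perm v = 1%g -> braid_eq v [::].
  exact: W.
elim: m => [|m IH] mn v.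
  by case: v => // _ _; apply: braid_eq_refl.
move=> vm v1; have [a [w' [am w'm vw']]] := braid_eq_norm mn vm.
have := braid_eq_word_perm vw'; rewrite v1 word_perm_cat => /(congr1 (fun p : 'S_n.+1 => p (inord m.+1))).
rewrite permM perm1 word_perm_fix // -{3}(subnKC am) word_perm_iota; last by lia.
move/(congr1 (@nat_of_ord _)); rewrite !inordK; [move=> ma|lia|lia].
move: vw'; rewrite -ma subnn /= => vw'; apply: (braid_eq_trans vw').
by apply: IH w'm _; [lia|rewrite -(braid_eq_word_perm vw')].
Qed.

Lemma word_perm_rev w : word_perm (rev w) = (word_perm w)^-1%g.
Proof.
elim: w => [|a w IH] /=; first by rewrite invg1.
by rewrite rev_cons -cats1 word_perm_cat IH /= mul1g invMg tpermV.
Qed.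

Lemma braid_eq_rev w : all (fun x => (x < n)%N) w -> braid_eq (rev w ++ w) [::].
Proof.
elim: w => [|a w IH] /=; first by move=> _; apply: braid_eq_refl.
case/andP=> an /IH w1; rewrite rev_cons -cats1 -catA /=.
by apply: braid_eq_trans w1; apply: (braid_eq_ctx (rev w) w (braid_eq_ss an)).
Qed.

(** Both words are compared through $u\cdot v^{-1}\cdot v$, the reversed word serving as inverse. *)
Lemma word_perm_inj u v : all (fun x => (x < n)%N) u -> all (fun x => (x < n)%N) v ->
  word_perm u = word_perm v -> braid_eq u v.
Proof.
move=> un vn uv.
have h : braid_eq (u ++ rev v) [::].
  by apply: braid_eq_word_perm1; rewrite ?all_cat ?all_rev ?un // word_perm_cat word_perm_rev uv mulVg.
have h1 := braid_eq_catl u (braid_eq_rev vn); rewrite cats0 in h1.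
by apply: braid_eq_trans (braid_eq_sym h1) _; rewrite catA; apply: (braid_eq_catr v h).
Qed.

Lemma tperm_word (i j : 'I_n.+1) : (i < j)%N ->
  exists w, all (fun x => (i <= x < n)%N) w /\ word_perm w = tperm i j.
Proof.
case: j => j; elim: j => // j IH jn /=; rewrite ltnS leq_eqVlt => /orP [/eqP ij|ij].
  exists [:: j]; split; first by rewrite /= ij; lia.
  rewrite /= mul1g /adj_tperm; congr tperm; apply: val_inj; rewrite /= inordK //; lia.
have [w [wn Ew]] := IH (ltnW jn) ij.
exists (j :: w ++ [:: j]); split; first by rewrite /= all_cat wn /=; lia.
rewrite /= word_perm_cat /= mul1g -mulgA Ew.
have -> : (adj_tperm j * (tperm i (Ordinal (ltnW jn)) * adj_tperm j))%g = (tperm i (Ordinal (ltnW jn)) ^ adj_tperm j)%g.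
  by rewrite /conjg tpermV.
rewrite tpermJ tpermD; last 2 first.
- by rewrite -val_eqE /= inordK; lia.
- by rewrite -val_eqE /= inordK; lia.
congr tperm; rewrite (_ : Ordinal _ = inord j) ?tpermL; apply: val_inj; rewrite /= inordK //; lia.
Qed.

Lemma word_perm_surj (p : 'S_n.+1) : exists w, all (fun x => (x < n)%N) w /\ word_perm w = p.
Proof.
have [r Ep _] := prod_tpermP p; subst p.
elim: r => [|[i j] r [w [wn Ew]]]; first by exists [::]; rewrite big_nil.
wlog ij : i j / (i <= j)%N.
  by move=> W; case: (leqP i j) => [/W //|/ltnW/W]; rewrite !big_cons /= tpermC.
move: ij; rewrite leq_eqVlt => /orP [/eqP/val_inj ->|ij].
  by exists w; split=> //; rewrite big_cons /= tperm1 mul1g.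
have [v [vn Ev]] := tperm_word ij.
exists (w ++ v); rewrite all_cat wn word_perm_cat Ev Ew big_cons /=; split=> //.
by apply: sub_all vn => x /andP[].
Qed.

Definition perm_word (p : 'S_n.+1) : seq nat := projT1 (cid (word_perm_surj p)).

End Coxeter.

Section UpToSign.
Variable A : pzRingType.
Implicit Types x y z : A.

Definition pm x y := x = y \/ x = - y.

Lemma pm_refl x : pm x x. Proof. by left. Qed.
Lemma pm_sym x y : pm x y -> pm y x.
Proof. by case=> ->; [left|right; rewrite opprK]. Qed.
Lemma pm_trans y x z : pm x y -> pm y z -> pm x z.
Proof. by case=> ->; case=> ->; rewrite ?opprK; [left|right|right|left]. Qed.
Lemma pmMl z x y : pm x y -> pm (z * x) (z * y).
Proof. by case=> ->; rewrite ?mulrN; [left|right]. Qed.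
Lemma pmMr z x y : pm x y -> pm (x * z) (y * z).
Proof. by case=> ->; rewrite ?mulNr; [left|right]. Qed.
Lemma pmN x : pm (- x) x. Proof. by right. Qed.

End UpToSign.

(** The pointwise stabiliser of [F] is generated by transpositions outside [F]: multiplying by the
    transposition of [x] and [p x] lowers the number of moved points. *)
Lemma perm_fix_ind (I : finType) (P : {perm I} -> Prop) (F : pred I) :
  P 1%g ->
  (forall x y p, ~~ F x -> ~~ F y -> x != y -> P p -> P (p * tperm x y)%g) ->
  forall p : {perm I}, (forall x, F x -> p x = x) -> P p.
Proof.
move=> P1 PM p; have [m] := ubnP #|[pred x | p x != x]|.
elim: m p => // m IH p /ltnSE pm pF.
case: (pickP [pred x | p x != x]) => [x /= px|p1]; last first.
  suff -> : p = 1%g by [].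
  by apply/permP => x; rewrite perm1; apply/eqP; have := p1 x => /= /negbFE.
have -> : p = (p * tperm x (p x) * tperm x (p x))%g by rewrite -mulgA tperm2 mulg1.
have Fx : ~~ F x by apply: contra px => /pF ->.
have Fpx : ~~ F (p x).
  by apply: contra px => /pF /perm_inj ->.
apply: PM; rewrite // 1?eq_sym //; apply: IH => [|y Fy]; last first.
  rewrite permM (pF y Fy) tpermD //; first by apply: contraNneq Fx => ->.
  by apply: contraNneq Fpx => ->.
apply: leq_trans pm; apply: proper_card; apply/properP; split.
  apply/fintype.subsetP => y; rewrite !inE permM; apply: contra => /eqP py.
  rewrite py tpermD //; first by apply: contraNneq px => ->; rewrite py.
  by apply: contraNneq px => pxy; rewrite -pxy in py; apply/eqP/(perm_inj py).
by exists x; rewrite !inE // permM tpermR eqxx.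
Qed.

Lemma perm_extend (I : finType) (xs ys : seq I) :
  uniq xs -> uniq ys -> size xs = size ys ->
  exists p : {perm I}, [seq p x | x <- xs] = ys.
Proof.
elim: xs ys => [|x xs IH] [|y ys] //=; first by exists 1%g.
case/andP=> xxs uxs /andP[yys uys] [/(IH _ uxs uys) [p Ep]].
exists (p * tperm (p x) y)%g; rewrite permM tpermL; congr cons.
rewrite -[RHS]Ep.
apply/eq_in_map => z zxs /=; rewrite permM tpermD //.
  by apply: contraNneq xxs => /perm_inj ->.
by apply: contraNneq yys => ->; rewrite -Ep map_f.
Qed.

(** * Permutations and single pairs inside an algebra with the Brauer relations *)

Section PermutationElements.
Variables (A : pzRingType) (n : nat) (s e : nat -> A).
Hypothesis H : brauer_pair n s e.

(** By the Coxeter presentation the choice of the word is immaterial. The product of permutations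
    composes from left to right, hence the reversed factors in [spermM]. *)
Definition sperm (p : 'S_n.+1) : A := \prod_(a <- perm_word p) s a.
Local Notation T := sperm.

Lemma braid_eq_prod u v : braid_eq n u v -> \prod_(a <- u) s a = \prod_(a <- v) s a.
Proof.
elim=> {u v} //.
- by move=> u v w _ -> _ ->.
- by move=> l r u v _ E; rewrite !big_cat /= E.
- by move=> a an; rewrite big_cons big_seq1 big_nil (bp_ss H an).
- by move=> a b ab; rewrite !big_cons big_nil !mulr1 (bp_sC H ab).
- by move=> a an; rewrite !big_cons big_nil !mulr1 !mulrA (bp_braid H an).
Qed.

Lemma sperm_word w : all (fun x => (x < n)%N) w -> T (word_perm n w) = \prod_(a <- w) s a.
Proof.
move=> wn; rewrite /sperm /perm_word; case: (cid _) => v [vn Ev] /=.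
by apply: braid_eq_prod; apply: word_perm_inj.
Qed.

Lemma sperm1 : T 1%g = 1.
Proof. by rewrite (@sperm_word [::]) // big_nil. Qed.

Lemma spermM p q : T (p * q)%g = T q * T p.
Proof.
have [u [un <-]] := word_perm_surj p; have [v [vn <-]] := word_perm_surj q.
by rewrite -word_perm_cat !sperm_word ?all_cat ?un ?vn // big_cat.
Qed.

Lemma sperm_adj_tperm a : (a < n)%N -> T (adj_tperm n a) = s a.
Proof.
by move=> an; rewrite -[adj_tperm n a]mul1g (@sperm_word [:: a]) ?big_seq1 //= an.
Qed.

Lemma spermK p : T p * T p^-1%g = 1.
Proof. by rewrite -spermM mulVg sperm1. Qed.
Lemma spermVK p : T p^-1%g * T p = 1.
Proof. by rewrite -spermM mulgV sperm1. Qed.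

Definition cj p x := T p * x * T p^-1%g.
Lemma cjM p x y : cj p (x * y) = cj p x * cj p y.
Proof. by rewrite /cj !mulrA -[X in _ = X * _ * _]mulrA spermVK mulr1. Qed.
Lemma cjN p x : cj p (- x) = - cj p x.
Proof. by rewrite /cj mulrN mulNr. Qed.
Lemma cj0 p : cj p 0 = 0.
Proof. by rewrite /cj mulr0 mul0r. Qed.
Lemma cj_comp p q x : cj (p * q)%g x = cj q (cj p x).
Proof. by rewrite /cj invMg !spermM !mulrA. Qed.
Lemma cj_sperm p q : cj p (T q) = T (q ^ p)%g.
Proof. by rewrite /cj /conjg !spermM. Qed.
Lemma cj_move p x : T p * x = cj p x * T p.
Proof. by rewrite /cj -!mulrA spermVK mulr1. Qed.

Let o (i : nat) : 'I_n.+1 := inord i.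
Let o_eq i j : (i <= n)%N -> (j <= n)%N -> (o i == o j) = (i == j).
Proof. by move=> ii jj; rewrite -val_eqE /= !inordK. Qed.

(** A permutation fixing strands 0 and 1 is a product of transpositions of later strands, whose
    words use only letters at least 2, and these commute with [e 0]. *)
Lemma sperm_e0 (p : 'S_n.+1) : (0 < n)%N -> p (o 0) = o 0 -> p (o 1) = o 1 -> T p * e 0 = e 0 * T p.
Proof.
move=> n0 p0 p1; pose F := [pred x : 'I_n.+1 | (x < 2)%N].
suff : forall x, F x -> p x = x.
  apply: (@perm_fix_ind _ (fun p => T p * e 0 = e 0 * T p)) => [|x y q Fx Fy xy E].
    by rewrite sperm1 mul1r mulr1.
  rewrite spermM -mulrA E !mulrA; congr (_ * _).
  wlog xy' : x y {xy} Fx Fy / (x < y)%N.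
    move=> W; case: (ltngtP x y) => xy'; [exact: W| |by rewrite (val_inj xy') eqxx in xy].
    by rewrite tpermC; apply: W.
  have [w [wn <-]] := tperm_word xy'.
  rewrite sperm_word; last by apply: sub_all wn => a /andP[].
  elim: w wn => [|a w IH] /=; first by rewrite big_nil mul1r mulr1.
  case/andP=> /andP[xa an] /IH {}IH; rewrite big_cons -mulrA IH !mulrA; congr (_ * _).
  by rewrite (bp_esC H) // an andbT; move: Fx; rewrite inE; lia.
move=> x; rewrite inE => x2.
have [->|->] // : x = o 0 \/ x = o 1.
by case: x x2 => -[|[|//]] i _; [left|right]; apply: val_inj; rewrite /= inordK.
Qed.

(** The conjugate of [e 0] that joins strands [p] and [q]; by [sperm_e0] any permutation sending 0,
    1 to [p], [q] gives the same element. The value 0 at [p = q] keeps the rules for conjugation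
    valid without exception. *)
Definition eps (p q : 'I_n.+1) : A :=
  if [pick g : 'S_n.+1 | (g (o 0) == p) && (g (o 1) == q) && (p != q)] is Some g
  then cj g (e 0) else 0.

Lemma eps_diag p : eps p p = 0.
Proof. by rewrite /eps; case: pickP => // g; rewrite eqxx andbF. Qed.

Lemma epsE (g : 'S_n.+1) : (0 < n)%N -> eps (g (o 0)) (g (o 1)) = cj g (e 0).
Proof.
move=> n0; rewrite /eps; case: pickP => [h /andP[/andP[/eqP h0 /eqP h1] _]|]; last first.
  by move/(_ g); rewrite !eqxx /= (inj_eq perm_inj) o_eq.
have -> : h = (h * g^-1 * g)%g by rewrite mulgKV.
rewrite cj_comp; congr (cj g _); rewrite /cj sperm_e0 ?permM ?h0 ?h1 ?permK //.
by rewrite -mulrA spermK mulr1.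
Qed.

Lemma neq_n0 (p q : 'I_n.+1) : p != q -> (0 < n)%N.
Proof. by move: (ltn_ord p) (ltn_ord q); rewrite -val_eqE /=; lia. Qed.

Lemma eps_frame (p q : 'I_n.+1) : p != q -> exists g : 'S_n.+1, g (o 0) = p /\ g (o 1) = q.
Proof.
move=> pq; have n0 := neq_n0 pq.
have [||g [<- <-]] := @perm_extend _ [:: o 0; o 1] [:: p; q] _ _ erefl.
- by rewrite /= inE o_eq.
- by rewrite /= inE pq.
- by exists g.
Qed.

Lemma cj_eps (g : 'S_n.+1) p q : cj g (eps p q) = eps (g p) (g q).
Proof.
have [->|pq] := eqVneq p q; first by rewrite !eps_diag cj0.
have [h [<- <-]] := eps_frame pq.
by rewrite -!permM !epsE ?cj_comp // (neq_n0 pq).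
Qed.

Lemma sperm_eps (g : 'S_n.+1) p q : T g * eps p q = eps (g p) (g q) * T g.
Proof. by rewrite cj_move cj_eps. Qed.

Lemma e_eps a : (a < n)%N -> e a = eps (o a) (o a.+1).
Proof.
elim: a => [|a IH] an.
  by rewrite -[o 0](perm1 (o 0)) -[o 1](perm1 (o 1)) epsE // /cj invg1 sperm1 mul1r mulr1.
have E : e a.+1 = cj (adj_tperm n a.+1 * adj_tperm n a)%g (e a).
  rewrite /cj invMg !spermM !sperm_adj_tperm ?tpermV ?sperm_adj_tperm //; try lia.
  rewrite (ss_e H) // -!mulrA (mulrA (s a.+1) (s a.+1)) (bp_ss H) // mul1r (bp_ss H) ?mulr1 //; lia.
rewrite E IH ?cj_eps ?permM; last by lia.
congr eps; last first.
  by rewrite tpermL (tpermD (z := o a.+2)) // o_eq; lia.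
by rewrite (tpermD (z := o a)) ?tpermL // o_eq; lia.
Qed.

Lemma eps_sym p q : eps q p = - eps p q.
Proof.
have [->|pq] := eqVneq p q; first by rewrite !eps_diag oppr0.
have n0 := neq_n0 pq; have [h [<- <-]] := eps_frame pq.
have := epsE (adj_tperm n 0 * h) n0; rewrite !permM tpermL tpermR => ->.
by rewrite cj_comp epsE // -cjN /cj tpermV sperm_adj_tperm // (bp_se H) // (bp_es H).
Qed.

Lemma eps_sperm p q : eps p q * T (tperm p q) = - eps p q.
Proof.
have [->|pq] := eqVneq p q; first by rewrite !eps_diag mul0r oppr0.
have n0 := neq_n0 pq; have [h [<- <-]] := eps_frame pq.
by rewrite -tpermJ -cj_sperm epsE // -cjM sperm_adj_tperm // (bp_es H) // cjN.
Qed.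

(** Some permutation sends strands 0, 1, 2, 3 to [p], [q], [r], [t], and conjugation by it carries
    the defining relation to the general one. [eps_eps] follows the same pattern. *)
Lemma eps_comm p q r t : uniq [:: p; q; r; t] -> eps p q * eps r t = eps r t * eps p q.
Proof.
move=> u; have /card_uniqP := u => /= c4.
have n3 : (3 <= n)%N by have := max_card (mem [:: p; q; r; t]); rewrite c4 card_ord.
have [||g [<- <- <- <-]] := @perm_extend _ [:: o 0; o 1; o 2; o 3] [:: p; q; r; t] _ _ erefl.
- by rewrite /= !inE !o_eq //; lia.
- by [].
have e0 := e_eps (leq_trans (isT : (0 < 3)%N) n3).
have e2 := e_eps (leq_trans (isT : (2 < 3)%N) n3).
by rewrite -!cj_eps -e0 -e2 -!cjM (bp_eC H).
Qed.

(** On strands 0, 1, 2 the transposition is $s_0s_1s_0$. Its factor next to $\varepsilon_0$ is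
    absorbed with a sign, and $\varepsilon_0s_1s_0=\varepsilon_0\varepsilon_1$ is left. *)
Lemma eps_eps p q r : uniq [:: p; q; r] -> eps p q * eps q r = - (eps p q * T (tperm p r)).
Proof.
move=> u; have /card_uniqP := u => /= c3.
have n2 : (2 <= n)%N by have := max_card (mem [:: p; q; r]); rewrite c3 card_ord.
have [||g [<- <- <-]] := @perm_extend _ [:: o 0; o 1; o 2] [:: p; q; r] _ _ erefl.
- by rewrite /= !inE !o_eq //; lia.
- by [].
have e0 := e_eps (leq_trans (isT : (0 < 2)%N) n2).
have e1 := e_eps (leq_trans (isT : (1 < 2)%N) n2).
rewrite -tpermJ -cj_sperm -!cj_eps -e0 -e1 -!cjM.
rewrite -cjN (e_eS H) //; congr (cj g _).
have -> : tperm (o 0) (o 2) = (adj_tperm n 0 * adj_tperm n 1 * adj_tperm n 0)%g.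
  have -> : (adj_tperm n 0 * adj_tperm n 1 * adj_tperm n 0 = adj_tperm n 1 ^ adj_tperm n 0)%g by rewrite /conjg tpermV mulgA.
  by rewrite tpermJ tpermR (tpermD (z := o 2)) // o_eq; lia.
rewrite !spermM !sperm_adj_tperm //; last by lia.
by rewrite !mulrA (bp_es H) ?mulNr ?opprK //; lia.
Qed.

End PermutationElements.

(** * Partial matchings and their involutions *)

Section MatchingCombinatorics.
Variable I : finType.
Implicit Types (M : seq (I * I)) (p q x : I).

Definition ends M : seq I := flatten [seq [:: z.1; z.2] | z <- M].
Definition matching M := uniq (ends M).
Definition relabel (g : I -> I) M := [seq (g z.1, g z.2) | z <- M].
(** For a matching the transpositions are disjoint, so this is the involution exchanging the ends of
    each pair, with the free points as fixed points. *)
Definition mate M : {perm I} := foldr (fun z g => tperm z.1 z.2 * g)%g 1%g M.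

Lemma ends_relabel g M : ends (relabel g M) = map g (ends M).
Proof. by elim: M => //= z M; rewrite /ends /= => ->. Qed.

Lemma matching_relabel (g : {perm I}) M : matching (relabel g M) = matching M.
Proof. by rewrite /matching ends_relabel map_inj_uniq //; apply: perm_inj. Qed.

Lemma mate_out M x : x \notin ends M -> mate M x = x.
Proof.
elim: M => [|[p q] M IH]; first by rewrite perm1.
rewrite /ends /= !inE !negb_or => /and3P[xp xq xM].
by rewrite permM tpermD 1?eq_sym // IH.
Qed.

Lemma mateL p q M : matching ((p, q) :: M) -> mate ((p, q) :: M) p = q.
Proof. by case/and3P => _ qM _; rewrite permM /= tpermL mate_out. Qed.

Lemma mateR p q M : matching ((p, q) :: M) -> mate ((p, q) :: M) q = p.
Proof.
case/and3P; rewrite inE negb_or => /andP[_ pM] _ _.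
by rewrite permM /= tpermR mate_out.
Qed.

Lemma mateD p q M x : x != p -> x != q -> mate ((p, q) :: M) x = mate M x.
Proof. by move=> xp xq; rewrite permM tpermD // eq_sym. Qed.

Lemma matching_cons p q M : matching ((p, q) :: M) = [&& p != q, p \notin ends M, q \notin ends M & matching M].
Proof. by rewrite /matching /ends /= inE negb_or -!andbA. Qed.

Lemma mateK M : matching M -> involutive (mate M).
Proof.
elim: M => [|[p q] M IH] ; first by move=> _ x; rewrite !perm1.
move=> wf x; have := wf; rewrite matching_cons => /and4P[pq pM qM /IH {}IH].
have [->|xp] := eqVneq x p; first by rewrite mateL // mateR.
have [->|xq] := eqVneq x q; first by rewrite mateR // mateL.
rewrite (mateD _ xp xq) mateD ?IH //.
  by apply: contraNneq xp => E; rewrite -[x]IH E mate_out.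
by apply: contraNneq xq => E; rewrite -[x]IH E mate_out.
Qed.

Lemma mate_neq M x : matching M -> (mate M x != x) = (x \in ends M).
Proof.
elim: M => [|[p q] M IH]; first by rewrite perm1 eqxx.
move=> wf; have := wf; rewrite matching_cons => /and4P[pq pM qM /IH {}IH].
rewrite /ends /= !inE.
have [->|xp] := eqVneq x p; first by rewrite mateL // eq_sym pq.
have [->|xq] := eqVneq x q; first by rewrite mateR.
by rewrite mateD.
Qed.

End MatchingCombinatorics.

(** * Products of disjoint pairs, up to sign *)

Section MatchingElements.
Variables (A : pzRingType) (n : nat) (s e : nat -> A).
Hypothesis H : brauer_pair n s e.
Local Notation T := (sperm s).
Local Notation eps := (eps s e).
Implicit Types (M : seq ('I_n.+1 * 'I_n.+1)) (p q : 'I_n.+1) (g : 'S_n.+1).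

(** A diagram has as many horizontal edges on top as at the bottom. It can thus be written
    [emat M * sperm g]: the pairs of [M] are its top edges, their preimages under [g] its bottom
    edges, and [g] restricted to preimages of free strands gives the vertical ones. *)
Definition emat M : A := \prod_(x <- M) eps x.1 x.2.

Lemma emat_nil : emat [::] = 1.
Proof. by rewrite /emat big_nil. Qed.

Lemma emat_cons p q M : emat ((p, q) :: M) = eps p q * emat M.
Proof. by rewrite /emat big_cons. Qed.

Lemma sperm_emat g M : T g * emat M = emat (relabel g M) * T g.
Proof.
elim: M => [|[p q] M IH]; first by rewrite /emat !big_nil mulr1 mul1r.
by rewrite /= !emat_cons mulrA (sperm_eps H) -mulrA IH mulrA.
Qed.

Lemma eps_emat_comm p q M : uniq (p :: q :: ends M) -> eps p q * emat M = emat M * eps p q.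
Proof.
elim: M => [|[r t] M IH]; first by rewrite /emat !big_nil mulr1 mul1r.
rewrite /ends -/(ends M) => u; rewrite emat_cons mulrA (eps_comm H).
  rewrite -!mulrA IH //; move: u; rewrite /= !inE !negb_or.
  by move=> /and3P[/and4P[-> _ _ ->] /and3P[_ _ ->] /and3P[_ _]].
move: u; rewrite /= !inE !negb_or.
by move=> /and3P[/and4P[-> -> -> _] /and3P[-> -> _] /and3P[/andP[-> _] _ _]].
Qed.

Lemma extract_pair M p : matching M -> p \in ends M -> exists q M',
  [/\ matching ((p, q) :: M'), pm (emat M) (emat ((p, q) :: M')),
      mate M = mate ((p, q) :: M'), perm_eq (ends M) (ends ((p, q) :: M'))
    & size M = (size M').+1].
Proof.
elim: M => // [[a b] M IH] wf; rewrite {1}/ends /= -/(ends M) !inE => /or3P[/eqP ->|/eqP ->|pM].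
- by exists b, M; split=> //; apply: pm_refl.
- exists a, M; split=> //.
  + move: wf; rewrite !matching_cons => /and4P[ab aM bM ->].
    by rewrite eq_sym ab bM aM.
  + by rewrite !emat_cons (eps_sym H b) mulNr; right.
  + by rewrite /= tpermC.
  + by rewrite /ends /= (perm_catCA [:: a] [:: b]).
- have := wf; rewrite matching_cons => /and4P[ab aM bM wM].
  have [q [M' [wf' EE mE pE sE]]] := IH wM pM.
  have Pe : perm_eq (ends ((a, b) :: M)) (ends [:: (p, q), (a, b) & M']).
    apply: (@perm_trans _ (a :: b :: p :: q :: ends M')); first by rewrite /ends /= !perm_cons.
    by rewrite /ends /= (perm_catCA [:: a; b] [:: p; q]).
  have U : uniq (ends [:: (p, q), (a, b) & M']) by rewrite -(perm_uniq Pe).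
  exists q, ((a, b) :: M'); split=> //.
  + rewrite !emat_cons; apply: pm_trans (pmMl _ EE) _; rewrite emat_cons !mulrA.
    rewrite (eps_comm H); first by left.
    have := U; rewrite -[ends _]/([:: p; q; a; b] ++ ends M') cat_uniq => /andP[u _].
    by rewrite (uniq_catC [:: a; b] [:: p; q]).
  + rewrite /= mE /= !mulgA; congr (_ * _)%g.
    move: U; rewrite /ends /= !inE !negb_or.
    move=> /and5P[/and4P[pq pa pb _] /and3P[qa qb _] _ _ _].
    by rewrite [LHS]conjgC tpermJ !tpermD.
  + by rewrite /= sE.
Qed.

Lemma eps_eps_pm p q r : uniq [:: p; q; r] -> pm (eps p q * eps q r) (eps p q * T (tperm p r)).
Proof. by move=> u; rewrite (eps_eps H) //; right. Qed.

(* eps p q meets the pair (p, p') : reconnect q with p'. *)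
Lemma eps_emat_meet p q p' M : matching ((p, p') :: M) -> p != q -> p' != q ->
  matching ((q, p) :: relabel (tperm q p') M) /\
  pm (eps p q * emat ((p, p') :: M))
     (emat ((q, p) :: relabel (tperm q p') M) * T (tperm q p')).
Proof.
rewrite matching_cons => /and4P[pp' pM p'M wM] pq p'q; split.
  rewrite matching_cons matching_relabel wM andbT eq_sym pq /= ends_relabel.
  apply/andP; split; apply/mapP => -[z zM E].
    have zp' : z = p' by apply: (@perm_inj _ (tperm q p')); rewrite tpermR -E.
    by rewrite -zp' zM in p'M.
  have zp : z = p by apply: (@perm_inj _ (tperm q p')); rewrite -E tpermD // eq_sym.
  by rewrite -zp zM in pM.
rewrite !emat_cons -mulrA -sperm_emat !mulrA; apply: pmMr.
rewrite (eps_sym H q) mulNr; apply: pm_trans (pmN _) _; apply: eps_eps_pm.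
by rewrite /= !inE negb_or eq_sym pq /= eq_sym p'q pp'.
Qed.

Lemma emat_pm M M' : matching M -> matching M' -> mate M = mate M' -> pm (emat M) (emat M').
Proof.
have [m] := ubnP (size M); elim: m M M' => // m IH M M' /ltnSE sM wM wM' MM'.
have Ee x : (x \in ends M) = (x \in ends M') by rewrite -!mate_neq // MM'.
case EM0 : (ends M) => [|p r].
  case: M M' {IH sM wM wM' MM'} EM0 Ee => // -[_ _|x M' _ /(_ x.1)]; first exact: pm_refl.
  by rewrite /ends /= !inE eqxx.
have pM : p \in ends M by rewrite EM0 inE eqxx.
have [q [N [wN EN mN pN sN]]] := extract_pair wM pM.
have [q' [N' [wN' EN' mN' pN' sN']]] := extract_pair wM' (etrans (esym (Ee p)) pM).
have qq' : q = q' by rewrite -(mateL wN) -(mateL wN') -mN -mN' MM'.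
subst q'; apply: pm_trans EN _; apply: pm_trans (pm_sym EN').
rewrite !emat_cons; apply: pmMl.
have := wN; have := wN'; rewrite !matching_cons => /and4P[_ _ _ wN1'] /and4P[_ _ _ wN1].
apply: IH => //; first by rewrite -sN in sM *.
by apply: (mulgI (tperm p q)); have := MM'; rewrite mN mN'.
Qed.

Lemma emat_sperm_tperm M x : matching M -> pm (emat M * T (tperm x (mate M x))) (emat M).
Proof.
move=> wM; case xM : (x \in ends M); last first.
  by rewrite mate_out ?xM // tperm1 (sperm1 H) mulr1; apply: pm_refl.
have [q [N [wN EN mN pN sN]]] := extract_pair wM xM.
rewrite mN mateL //; apply: pm_trans (pmMr _ EN) _; apply: pm_trans (pm_sym EN).
have := wN; rewrite matching_cons => /and4P[xq xN qN wN1].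
rewrite emat_cons (@eps_emat_comm x q); last first.
  by rewrite /= inE negb_or xq xN qN.
by rewrite -mulrA (eps_sperm H) mulrN; right.
Qed.

(** By [eps_eps], next to the pair $pp'$ the transposition $(p\,q)$ can be traded for a third pair
    $p'q$. Read next to $qq'$ instead, this third pair becomes the transposition $(p'\,q')$, which
    cancels the other factor. *)
Lemma eps_double p p' q q' : uniq [:: p; p'; q; q'] ->
  pm (eps p p' * eps q q' * T (tperm p' q' * tperm p q)%g) (eps p p' * eps q q').
Proof.
move=> u; have := u; rewrite /= !inE !negb_or => /and4P[/and3P[pp' pq pq'] /andP[p'q p'q'] qq' _].
have sy (x y : 'I_n.+1) : pm (eps x y) (eps y x) by rewrite (eps_sym H y); right.
have C := eps_comm H u.
rewrite (spermM H) C mulrA.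
apply: (@pm_trans _ (eps q q' * (eps p p' * eps p' q) * T (tperm p' q'))).
  apply: pmMr; rewrite -mulrA; apply: pmMl; apply: pm_sym; apply: eps_eps_pm.
  by rewrite /= !inE negb_or pp' pq p'q.
rewrite mulrA -C -!mulrA; apply: pmMl.
apply: (@pm_trans _ (eps q' q * eps q p' * T (tperm p' q'))).
  by rewrite mulrA; apply: pmMr; apply: pm_trans (pmMr _ (sy _ _)) _; apply: pmMl.
apply: (@pm_trans _ (eps q' q * T (tperm q' p') * T (tperm p' q'))).
  by apply: pmMr; apply: eps_eps_pm; rewrite /= !inE negb_or eq_sym qq' eq_sym p'q' eq_sym p'q.
by rewrite tpermC -mulrA -(spermM H) tperm2 (sperm1 H) mulr1; apply: sy.
Qed.

Lemma emat_sperm_double M x y : matching M -> x \in ends M -> y \in ends M -> y != x -> y != mate M x ->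
  pm (emat M * T (tperm (mate M x) (mate M y) * tperm x y)%g) (emat M).
Proof.
move=> wM xM yM yx ymx.
have [x' [N [wN EN mN pN sN]]] := extract_pair wM xM.
have x'E : mate M x = x' by rewrite mN mateL.
have := wN; rewrite matching_cons => /and4P[xx' xN x'N wN1].
have yN : y \in ends N.
  by move: yM; rewrite (perm_mem pN) /ends /= !inE (negPf yx) -x'E (negPf ymx).
have [y' [L [wL EL mL pL sL]]] := extract_pair wN1 yN.
have y'E : mate M y = y' by rewrite mN mateD // -?x'E // mL mateL.
rewrite x'E y'E.
have := wL; rewrite matching_cons => /and4P[yy' yL y'L wL1].
have U : uniq [:: x, x', y, y' & ends L].
  rewrite -(@perm_uniq _ (x :: x' :: ends N)); first exact: wN.
  by rewrite !perm_cons.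
have EE : pm (emat M) (eps x x' * eps y y' * emat L).
  apply: pm_trans EN _; rewrite emat_cons -mulrA; apply: pmMl.
  by apply: pm_trans EL _; rewrite emat_cons; apply: pm_refl.
apply: pm_trans (pmMr _ EE) _; apply: pm_trans (pm_sym EE).
have TL : T (tperm x' y' * tperm x y)%g * emat L = emat L * T (tperm x' y' * tperm x y)%g.
  rewrite sperm_emat; congr (_ * _); congr emat; rewrite /relabel -[RHS]map_id.
  apply/eq_in_map => -[a b] abL /=.
  have [aL bL] : a \in ends L /\ b \in ends L.
    by split; apply/flatten_mapP; exists (a, b); rewrite // !inE eqxx ?orbT.
  have fixL z : z \in ends L -> (tperm x' y' * tperm x y)%g z = z.
    move=> zL; move: U; rewrite /= !inE !negb_or => /and5P[/and4P[_ _ _ xL] /and3P[_ _ x'L] _ _ _].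
    by rewrite permM !tpermD //; apply: contraTneq zL => <-.
  by rewrite !fixL.
rewrite -mulrA -TL mulrA; apply: pmMr; apply: eps_double.
move: U; rewrite /= !inE !negb_or => /and5P[/and4P[-> -> -> _] /and3P[-> -> _] /andP[-> _] _ _].
by [].
Qed.

(* The stabiliser of a matching, a hyperoctahedral group, only changes signs. *)
Lemma emat_sperm_stab M g : matching M -> (forall x, g (mate M x) = mate M (g x)) ->
  (forall x, x \notin ends M -> g x = x) -> pm (emat M * T g) (emat M).
Proof.
move=> wM; have [m] := ubnP #|[pred x | g x != x]|; elim: m g => // m IH g /ltnSE gm gc gf.
case: (pickP [pred x | g x != x]) => [x /= gx|g1]; last first.
  have -> : g = 1%g.
    by apply/permP => x; rewrite perm1; apply/eqP; have := g1 x => /= /negbFE.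
  by rewrite (sperm1 H) mulr1; apply: pm_refl.
have xM : x \in ends M by apply: contraNT gx => /gf ->.
(* It suffices to find an involution [t] in the stabiliser that is harmless on [emat M] and brings
   [g x] back to [x], for then [g * t] moves fewer points. It flips the pair of [x] if [g x] is the
   mate of [x], and otherwise exchanges the pairs of [x] and [g x]. *)
suff [t [tc tt1 tx tfix tM]] : exists t : 'S_n.+1,
   [/\ forall y, t (mate M y) = mate M (t y), (t * t = 1)%g, t (g x) = x,
    forall y, g y = y -> t y = y & pm (emat M * T t) (emat M)].
  have -> : g = (g * t * t)%g by rewrite -mulgA tt1 mulg1.
  rewrite (spermM H) mulrA; apply: pm_trans (pmMr _ tM) _; apply: IH.
  - apply: leq_trans gm; apply: proper_card; apply/properP; split; last first.
      by exists x; rewrite !inE // permM tx eqxx.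
    apply/fintype.subsetP => y; rewrite !inE permM; apply: contra => /eqP gy.
    by rewrite gy tfix.
  - by move=> y; rewrite !permM gc tc.
  - by move=> y yM; rewrite permM gf // tfix // gf.
have mK := mateK wM.
have mx : mate M x != x by rewrite mate_neq.
have [gE|gE] := eqVneq (g x) (mate M x).
  exists (tperm x (mate M x)); split.
  - move=> y; case: (tpermP x (mate M x) y) => [->|->|/eqP yx /eqP ymx]; rewrite ?tpermL ?mK ?tpermR ?tpermL //.
    rewrite tpermD //.
      by apply: contraNneq ymx => ->; rewrite mK.
    by rewrite (inj_eq perm_inj) eq_sym.
  - by rewrite tperm2.
  - by rewrite gE tpermR.
  - move=> y gy; rewrite tpermD //; first by apply: contraNneq gx => ->; rewrite gy.
    apply: contraNneq gx => E.
    have xy : x = y by apply: (@perm_inj _ g); rewrite gy gE.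
    by rewrite xy gy.
  - exact: emat_sperm_tperm.
have gxM : g x \in ends M.
  by apply: contraNT gx => /gf /perm_inj ->.
exists (tperm (mate M x) (mate M (g x)) * tperm x (g x))%g.
set b := g x in gE gxM *; set a' := mate M x in gE mx *; set b' := mate M b.
set t := (_ * _)%g.
have a'b' : a' != b' by rewrite (inj_eq perm_inj) eq_sym.
have bb' : b' != b by rewrite mate_neq.
have ab' : x != b' by apply: contraNneq gE => E; rewrite /a' E mK.
have tx : t x = b by rewrite permM tpermD ?tpermL // eq_sym.
have tb : t b = x by rewrite permM tpermD ?tpermR // eq_sym.
have ta' : t a' = b' by rewrite permM tpermL tpermD // eq_sym.
have tb' : t b' = a' by rewrite permM tpermR tpermD // eq_sym.
have tfix y : y != x -> y != b -> y != a' -> y != b' -> t y = y.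
  by move=> *; rewrite permM !tpermD // eq_sym.
have cases y : [\/ y = x, y = b, y = a' | y = b'] \/ [/\ y != x, y != b, y != a' & y != b'].
  have [->|h1] := eqVneq y x; first by left; constructor 1.
  have [->|h2] := eqVneq y b; first by left; constructor 2.
  have [->|h3] := eqVneq y a'; first by left; constructor 3.
  have [->|h4] := eqVneq y b'; first by left; constructor 4.
  by right.
split => //.
- move=> y; case: (cases y) => [[]-> |[h1 h2 h3 h4]].
  + by rewrite -/a' ta' tx.
  + by rewrite -/b' tb' tb.
  + by rewrite mK tx ta' mK.
  + by rewrite mK tb tb' mK.
  + rewrite [t y]tfix // tfix //.
    * by apply: contraNneq h3 => E; rewrite /a' -E mK.
    * by apply: contraNneq h4 => E; rewrite /b' -E mK.
    * by rewrite (inj_eq perm_inj).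
    * by rewrite (inj_eq perm_inj).
- apply/permP => y; rewrite permM perm1; case: (cases y) => [[]-> |[h1 h2 h3 h4]].
  + by rewrite tx tb.
  + by rewrite tb tx.
  + by rewrite ta' tb'.
  + by rewrite tb' ta'.
  + by rewrite !tfix.
- move=> y gy; case: (cases y) => [[] E|[h1 h2 h3 h4]]; last by rewrite tfix.
  + by move: gx; rewrite -E gy eqxx.
  + have E' : g b = g x by rewrite -E gy E.
    by case/eqP: gx; exact: (perm_inj E').
  + by move: a'b'; rewrite -E -gy E /a' gc eqxx.
  + have E' : g b = g x by apply: (@perm_inj _ (mate M)); rewrite -gc -/b' -E gy E.
    by case/eqP: gx; exact: (perm_inj E').
- apply: emat_sperm_double => //.
Qed.

End MatchingElements.

Section DiagramInvolution.
Variables (n : nat).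
Implicit Types (M : seq ('I_n.+1 * 'I_n.+1)) (g : 'S_n.+1).

(* The other end of the edge at a vertex of the diagram of emat M * sperm g. *)
Definition partner M g (x : vertex n.+1) : vertex n.+1 :=
  match x with
  | inl a => if mate M a == a then inr (g^-1%g a) else inl (mate M a)
  | inr b => if mate M (g b) == g b then inl (g b) else inr (g^-1%g (mate M (g b)))
  end.

Lemma partnerK M g : matching M -> involutive (partner M g).
Proof.
move=> wM [a|b] /=; case: eqVneq => E /=; rewrite ?permKV ?permK ?mateK //=.
- by rewrite E eqxx.
- by rewrite eq_sym (negPf E).
- by rewrite E eqxx ?permK.
- by rewrite eq_sym (negPf E) ?permK.
Qed.

Lemma partner_neq M g x : partner M g x != x.
Proof.
case: x => [a|b] /=; [case: (eqVneq (mate M a) a)|case: (eqVneq (mate M (g b)) (g b))] => E; apply/eqP => //.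
  by case=> /eqP; rewrite (negPf E).
by case=> E'; move/eqP: E; apply; rewrite -[in RHS]E' permKV.
Qed.

(** Equal edges mean equal involutions on top, and then $g^{-1}g'$ commutes with the involution and
    fixes the free strands, so that it lies in the stabiliser treated in [emat_sperm_stab]. *)
Lemma partner_pm (A : pzRingType) (s e : nat -> A) (H : brauer_pair n s e) M g M' g' :
  matching M -> matching M' -> partner M g =1 partner M' g' ->
  pm (emat s e M * sperm s g) (emat s e M' * sperm s g').
Proof.
move=> wM wM' E.
have Em : mate M = mate M'.
  apply/permP => a; have := E (inl a) => /=.
  by case: eqVneq => [->|_]; case: eqVneq => [->|_] // [].
pose h := (g^-1 * g')%g.
have -> : g' = (g * h)%g by rewrite /h mulKVg.
rewrite (spermM H) mulrA; apply: pmMr; apply: pm_trans (emat_pm H wM wM' Em) _.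
apply: pm_sym; apply: emat_sperm_stab => //.
  move=> x; rewrite /h !permM -Em.
  have [b ->] : exists b, x = g b by exists (g^-1%g x); rewrite permKV.
  rewrite permK; have := E (inr b); rewrite /= -Em.
  case: eqVneq => [Eb|_]; case: eqVneq => [Eb'|_] //.
    by rewrite Eb permK Eb'.
  by case=> ->; rewrite permKV.
move=> x xM; rewrite /h permM; have := E (inl x); rewrite /= -Em.
by rewrite Em mate_out // eqxx => -[->]; rewrite permKV.
Qed.

End DiagramInvolution.

(** * The filtration by the number of dots *)

Record affine_triple (A : pzRingType) (n : nat) (s e : nat -> A) (y : 'I_n.+1 -> A) : Prop := {
  at_brauer : brauer_pair n s e;
  at_yy : forall i j, y i * y j = y j * y i;
  at_sy : forall a i, (a < n)%N -> i != inord a -> i != inord a.+1 -> s a * y i = y i * s a;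
  at_ey : forall a i, (a < n)%N -> i != inord a -> i != inord a.+1 -> e a * y i = y i * e a;
  at_sy_ys : forall a, (a < n)%N ->
    s a * y (inord a) - y (inord a.+1) * s a = e a - 1;
  at_ys_sy : forall a, (a < n)%N ->
    y (inord a) * s a - s a * y (inord a.+1) = - e a - 1;
  at_eyy : forall a, (a < n)%N -> e a * (y (inord a) - y (inord a.+1)) = e a;
  at_yye : forall a, (a < n)%N -> (y (inord a) - y (inord a.+1)) * e a = - e a;
  at_eye : forall k, (0 < n)%N -> e 0 * y (inord 0) ^+ k * e 0 = 0
}.

Section Filtration.
Variables (A : pzRingType) (n : nat).
Variables (s e : nat -> A) (y : 'I_n.+1 -> A).
Hypothesis HA : affine_triple s e y.
Let H := at_brauer HA.
Local Notation T := (sperm s).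
Local Notation eps := (eps s e).
Local Notation emat := (emat s e).

(** Elements are built by left multiplication with one generator at a time, so a spanning statement
    need only be stable under left multiplication. The span is additive, without scalars. *)
Inductive yfilt : nat -> A -> Prop :=
| yfilt0 k : yfilt k 0
| yfilt1 : yfilt 0 1
| yfilts k a x : (a < n)%N -> yfilt k x -> yfilt k (s a * x)
| yfilte k a x : (a < n)%N -> yfilt k x -> yfilt k (e a * x)
| yfilty k i x : yfilt k x -> yfilt k.+1 (y i * x)
| yfiltD k x x' : yfilt k x -> yfilt k x' -> yfilt k (x + x')
| yfiltN k x : yfilt k x -> yfilt k (- x)
| yfiltS k x : yfilt k x -> yfilt k.+1 x.

(** Degree less than [k], where degree $-1$ means 0; congruence in degree 0 is therefore
    equality. *)
Definition ylow (k : nat) (x : A) := if k is k'.+1 then yfilt k' x else x = 0.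

Lemma yfiltM i j x x' : yfilt i x -> yfilt j x' -> yfilt (i + j) (x * x').
Proof.
move=> ix jx'; elim: ix => {i x} [k||k a x an _ IH|k a x an _ IH|k b x _ IH|k x z _ IH _ IH'|k x _ IH|k x _ IH].
- by rewrite mul0r; apply: yfilt0.
- by rewrite mul1r.
- by rewrite -mulrA; apply: yfilts.
- by rewrite -mulrA; apply: yfilte.
- by rewrite -mulrA addSn; apply: yfilty.
- by rewrite mulrDl; apply: yfiltD.
- by rewrite mulNr; apply: yfiltN.
- by rewrite addSn; apply: yfiltS.
Qed.

Lemma ylow0 k : ylow k 0. Proof. by case: k => //= k; apply: yfilt0. Qed.
Lemma ylowD k x x' : ylow k x -> ylow k x' -> ylow k (x + x').
Proof. by case: k => [-> ->|k]; [rewrite /= addr0|apply: yfiltD]. Qed.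
Lemma ylowN k x : ylow k x -> ylow k (- x).
Proof. by case: k => [->|k]; [rewrite /= oppr0|apply: yfiltN]. Qed.
Lemma ylowMl i k x z : yfilt i z -> ylow k x -> ylow (i + k) (z * x).
Proof.
case: k => [_ ->|k iz kx]; first by rewrite mulr0; apply: ylow0.
by rewrite addnS; apply: yfiltM.
Qed.
Lemma ylowMr i k x z : yfilt i z -> ylow k x -> ylow (k + i) (x * z).
Proof.
case: k => [_ ->|k iz kx]; first by rewrite mul0r; apply: ylow0.
by rewrite addSn; apply: yfiltM.
Qed.

(* Equality in degree k of the graded algebra of the filtration. *)
Definition yeq k x x' := ylow k (x - x').

Arguments ylow : simpl never.
Arguments yeq : simpl never.

Lemma yeq_refl k x : yeq k x x. Proof. by rewrite /yeq subrr; apply: ylow0. Qed.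
Lemma yeq_sym k x x' : yeq k x x' -> yeq k x' x.
Proof. by rewrite /yeq => /ylowN; rewrite opprB. Qed.
Lemma yeq_trans k x' x x'' : yeq k x x' -> yeq k x' x'' -> yeq k x x''.
Proof. by rewrite /yeq => h1 h2; rewrite (_ : _ - _ = (x - x') + (x' - x'')); [apply: ylowD|abel]. Qed.
Lemma yeqN k x x' : yeq k x x' -> yeq k (- x) (- x').
Proof. by rewrite /yeq -opprD; apply: ylowN. Qed.
Lemma yeqMl i j k z x x' : yfilt i z -> yeq j x x' -> k = (i + j)%N -> yeq k (z * x) (z * x').
Proof. by rewrite /yeq => iz jx ->; rewrite -mulrBr; apply: ylowMl. Qed.
Lemma yeqMr i j k z x x' : yfilt i z -> yeq j x x' -> k = (j + i)%N -> yeq k (x * z) (x' * z).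
Proof. by rewrite /yeq => iz jx ->; rewrite -mulrBl; apply: ylowMr. Qed.

Lemma yfilt_s a : (a < n)%N -> yfilt 0 (s a).
Proof. by move=> an; rewrite -[s a]mulr1; apply: yfilts => //; apply: yfilt1. Qed.
Lemma yfilt_e a : (a < n)%N -> yfilt 0 (e a).
Proof. by move=> an; rewrite -[e a]mulr1; apply: yfilte => //; apply: yfilt1. Qed.
Lemma yfilt_y i : yfilt 1 (y i).
Proof. by rewrite -[y i]mulr1; apply: yfilty; apply: yfilt1. Qed.

Lemma yfilt_sperm (g : 'S_n.+1) : yfilt 0 (T g).
Proof.
have [w [wn <-]] := word_perm_surj g; rewrite (sperm_word H) //.
elim: w wn => [|a w IH] /=; first by rewrite big_nil => _; apply: yfilt1.
by case/andP=> an /IH wf; rewrite big_cons; apply: yfilts.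
Qed.

Lemma yfilt_eps (p q : 'I_n.+1) : yfilt 0 (eps p q).
Proof.
have [->|pq] := eqVneq p q; first by rewrite eps_diag; apply: yfilt0.
have n0 := neq_n0 pq; have [h [<- <-]] := eps_frame pq.
rewrite (epsE H) // /cj -[0%N]/(0 + 0 + 0)%N; apply: yfiltM; last exact: yfilt_sperm.
by apply: yfiltM; [apply: yfilt_sperm|apply: yfilt_e].
Qed.

Lemma yfilt_emat (M : seq ('I_n.+1 * 'I_n.+1)) : yfilt 0 (emat M).
Proof.
elim: M => [|[p q] M IH]; first by rewrite /emat big_nil; apply: yfilt1.
by rewrite emat_cons -[0%N]/(0 + 0)%N; apply: yfiltM => //; apply: yfilt_eps.
Qed.

Definition ylist (l : seq 'I_n.+1) : A := \prod_(r <- l) y r.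

Lemma ylist_cons r l : ylist (r :: l) = y r * ylist l.
Proof. by rewrite /ylist big_cons. Qed.
Lemma ylist_cat l l' : ylist (l ++ l') = ylist l * ylist l'.
Proof. by rewrite /ylist big_cat. Qed.
Lemma ylist_nil : ylist [::] = 1. Proof. by rewrite /ylist big_nil. Qed.

Lemma ylist_yC r l : y r * ylist l = ylist l * y r.
Proof.
elim: l => [|t l IH]; first by rewrite ylist_nil mulr1 mul1r.
by rewrite ylist_cons mulrA (at_yy HA r t) -mulrA IH mulrA.
Qed.

Lemma ylist_perm l l' : perm_eq l l' -> ylist l = ylist l'.
Proof.
elim: l l' => [|r l IH] l' pl; first by move: pl; rewrite perm_sym => /perm_nilP ->.
have rl' : r \in l' by rewrite -(perm_mem pl) inE eqxx.
case/splitPr: rl' pl => l1 l2; rewrite perm_sym perm_catC /= perm_cons perm_catC perm_sym => /IH E.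
by rewrite ylist_cons E !ylist_cat ylist_cons mulrA ylist_yC -mulrA.
Qed.

Lemma yfilt_ylist l : yfilt (size l) (ylist l).
Proof.
elim: l => [|r l IH]; first by rewrite ylist_nil; apply: yfilt1.
by rewrite ylist_cons; apply: yfilty.
Qed.

Lemma yeq_sperm_y (g : 'S_n.+1) i : yeq 1 (T g * y i) (y (g i) * T g).
Proof.
have [w [wn <-]] := word_perm_surj g; rewrite (sperm_word H) //.
elim: w wn => [|a w IH] /=; first by rewrite big_nil mul1r mulr1 perm1 => _; apply: yeq_refl.
case/andP=> an wn; rewrite big_cons -mulrA permM.
apply: yeq_trans (yeqMl (yfilt_s an) (IH wn) _) _; first by [].
rewrite !mulrA; set z := \prod_(_ <- w) _.
have zf : yfilt 0 z by rewrite /z -(sperm_word H) //; apply: yfilt_sperm.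
apply: (yeqMr zf (j := 1)) => //; move: (word_perm n w i) => j.
rewrite /yeq /ylow /adj_tperm; case: tpermP => [->|->|/eqP ja /eqP ja1].
- rewrite (at_sy_ys HA) //; apply: yfiltD; [exact: yfilt_e|exact/yfiltN/yfilt1].
- rewrite -opprB (at_ys_sy HA) // opprD opprK opprK.
  by apply: yfiltD; [exact: yfilt_e|exact: yfilt1].
- by rewrite (at_sy HA) // subrr; apply: yfilt0.
Qed.

Lemma yeq_sperm_ylist (g : 'S_n.+1) l :
  yeq (size l) (T g * ylist l) (ylist (map g l) * T g).
Proof.
elim: l => [|r l IH]; first by rewrite ylist_nil mulr1 mul1r; apply: yeq_refl.
rewrite /= !ylist_cons mulrA.
apply: yeq_trans (yeqMr (yfilt_ylist l) (yeq_sperm_y g r) _) _; first by [].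
by rewrite -!mulrA; apply: (yeqMl (yfilt_y _) IH).
Qed.

Lemma yeq_cj (g : 'S_n.+1) x x' (h : yeq 1 x x') : yeq 1 (cj s g x) (cj s g x').
Proof.
apply: (yeqMr (yfilt_sperm _) (j := 1)) => //.
exact: (yeqMl (yfilt_sperm _) h).
Qed.

Lemma yeq_cj_yl (g : 'S_n.+1) x i : yfilt 0 x -> yeq 1 (cj s g (x * y i)) (cj s g x * y (g i)).
Proof.
move=> x0; rewrite /cj -!mulrA; apply: (yeqMl (yfilt_sperm _) (j := 1)) => //.
apply: (yeqMl x0 (j := 1)) => //; apply: yeq_sym.
by have := yeq_sperm_y g^-1%g (g i); rewrite permK.
Qed.

Lemma yeq_cj_yr (g : 'S_n.+1) x i : yfilt 0 x -> yeq 1 (cj s g (y i * x)) (y (g i) * cj s g x).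
Proof.
move=> x0; rewrite /cj !mulrA; apply: (yeqMr (yfilt_sperm _) (j := 1)) => //.
apply: (yeqMr x0 (j := 1)) => //; exact: yeq_sperm_y.
Qed.

Lemma yeq_eps_comm (p q r : 'I_n.+1) : r != p -> r != q -> yeq 1 (eps p q * y r) (y r * eps p q).
Proof.
have [->|pq] := eqVneq p q; first by rewrite eps_diag mul0r mulr0 => *; apply: yeq_refl.
have n0 := neq_n0 pq; have [h [<- <-]] := eps_frame pq => rp rq.
have e00 := yfilt_e n0.
have Er : r = h (h^-1%g r) by rewrite permKV.
rewrite (epsE H) //; apply: yeq_trans (yeq_sym (yeq_trans (yeq_cj_yl h (h^-1%g r) e00) _)) _.
  by rewrite -Er; apply: yeq_refl.
rewrite (at_ey HA) //.
- by rewrite {2}Er; apply: yeq_cj_yr.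
- by apply: contraNneq rp => <-; rewrite permKV.
- by apply: contraNneq rq => <-; rewrite permKV.
Qed.

Lemma yeq_eps_yl (p q : 'I_n.+1) : yeq 1 (eps p q * y q) (eps p q * y p).
Proof.
have [->|pq] := eqVneq p q; first by apply: yeq_refl.
have n0 := neq_n0 pq; have [h [<- <-]] := eps_frame pq.
have e00 := yfilt_e n0; rewrite (epsE H) //.
apply: yeq_trans (yeq_sym (yeq_cj_yl _ _ e00)) _; apply: yeq_trans (yeq_cj_yl _ _ e00).
apply: yeq_cj; apply: yeq_sym; rewrite /yeq -mulrBr (at_eyy HA) //.
Qed.

Lemma yeq_y_epsr (p q : 'I_n.+1) : yeq 1 (y q * eps p q) (y p * eps p q).
Proof.
have [->|pq] := eqVneq p q; first by apply: yeq_refl.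
have n0 := neq_n0 pq; have [h [<- <-]] := eps_frame pq.
have e00 := yfilt_e n0; rewrite (epsE H) //.
apply: yeq_trans (yeq_sym (yeq_cj_yr _ _ e00)) _; apply: yeq_trans (yeq_cj_yr _ _ e00).
by apply: yeq_cj; apply: yeq_sym; rewrite /yeq -mulrBl (at_yye HA) //; apply: yfiltN.
Qed.

(** A conjugate of (P.4): after conjugation the product is exactly 0, and moving the dots through
    the permutation costs only terms of lower degree. *)
Lemma yeq_eps_loop (p q : 'I_n.+1) k : yeq k (eps p q * ylist (nseq k p) * eps p q) 0.
Proof.
have [->|pq] := eqVneq p q; first by rewrite eps_diag mulr0; apply: yeq_refl.
have n0 := neq_n0 pq; have [h [<- <-]] := eps_frame pq.
rewrite (epsE H) //.
have e00 := yfilt_e n0; have cf : yfilt 0 (cj s h (e 0)).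
  by rewrite -(epsE H) //; apply: yfilt_eps.
have yX l i : ylist (nseq l i) = y i ^+ l.
  by elim: l => [|l IH]; rewrite ?ylist_nil //= ylist_cons IH exprS.
have Z : cj s h (e 0) * (T h * ylist (nseq k (inord 0)) * T h^-1%g) * cj s h (e 0) = 0.
  rewrite -/(cj s h (ylist _)) -!(cjM H) yX (at_eye HA) //; exact: cj0.
rewrite -Z; apply: (yeqMr cf (j := k)); rewrite ?addn0 //.
apply: (yeqMl cf (j := k)) => //; apply: yeq_sym.
have := yeqMr (yfilt_sperm h^-1%g) (yeq_sperm_ylist h (nseq k (inord 0))) (k := k).
by rewrite map_nseq size_nseq -!mulrA (spermK H) mulr1; apply; rewrite addn0.
Qed.

End Filtration.

Arguments ylow : simpl never.
Arguments yeq : simpl never.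

(** * Dotted diagrams span the graded algebra *)

Section Spanning.
Variables (A : pzRingType) (n : nat).
Variables (s e : nat -> A) (y : 'I_n.+1 -> A).
Hypothesis HA : affine_triple s e y.
Let H := at_brauer HA.
Local Notation T := (sperm s).
Local Notation eps := (eps s e).
Local Notation emat := (emat s e).
Local Notation yfilt := (yfilt s e y).
Local Notation ylow := (ylow s e y).
Local Notation yeq := (yeq s e y).
Local Notation ylist := (ylist y).
Implicit Types (M : seq ('I_n.+1 * 'I_n.+1)) (p q r : 'I_n.+1) (g : 'S_n.+1) (l : seq 'I_n.+1).

Lemma yeq_diff_pm k x x' u v : pm x x' -> yeq k (x' * u) (x' * v) -> yeq k (x * u) (x * v).
Proof. by case=> -> // h; rewrite !mulNr; apply: yeqN. Qed.

Lemma yeq_diff_pmr k x x' u v : pm x x' -> yeq k (u * x') (v * x') -> yeq k (u * x) (v * x).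
Proof. by case=> -> // h; rewrite !mulrN; apply: yeqN. Qed.

Lemma yeq_emat_y M r : matching M -> yeq 1 (emat M * y r) (emat M * y (mate M r)).
Proof.
move=> wM; case rM : (r \in ends M); last by rewrite mate_out ?rM //; apply: yeq_refl.
have [q [N [wN EN mN pN sN]]] := extract_pair H wM rM.
rewrite mN mateL //; apply: yeq_diff_pm EN _.
have := wN; rewrite matching_cons => /and4P[rq rN qN wN1].
rewrite emat_cons (eps_emat_comm H); last by rewrite /= inE negb_or rq rN qN.
rewrite -!mulrA; apply: (yeqMl (yfilt_emat HA N) (j := 1)) => //.
by apply: yeq_sym; apply: yeq_eps_yl.
Qed.

Lemma yeq_y_emat M r : matching M -> yeq 1 (y r * emat M) (y (mate M r) * emat M).
Proof.
move=> wM; case rM : (r \in ends M); last by rewrite mate_out ?rM //; apply: yeq_refl.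
have [q [N [wN EN mN pN sN]]] := extract_pair H wM rM.
rewrite mN mateL //; apply: yeq_diff_pmr EN _.
rewrite emat_cons !mulrA; apply: (yeqMr (yfilt_emat HA N) (j := 1)) => //.
by apply: yeq_sym; apply: yeq_y_epsr.
Qed.

Lemma yeq_relist_l x (f : 'I_n.+1 -> 'I_n.+1) l : yfilt 0 x ->
  (forall r, yeq 1 (x * y r) (x * y (f r))) ->
  yeq (size l) (x * ylist l) (x * ylist (map f l)).
Proof.
move=> x0 xf; elim: l => [|r l IH]; first by apply: yeq_refl.
rewrite /= !ylist_cons; apply: (@yeq_trans _ _ _ _ _ _ (x * (y (f r) * ylist l))).
  by rewrite !mulrA; apply: (yeqMr (yfilt_ylist s e y l) (xf r)).
by rewrite !(ylist_yC HA) !mulrA; apply: (yeqMr (yfilt_y s e y _) IH); rewrite addn1.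
Qed.

Lemma yeq_relist_r x (f : 'I_n.+1 -> 'I_n.+1) l : yfilt 0 x ->
  (forall r, yeq 1 (y r * x) (y (f r) * x)) ->
  yeq (size l) (ylist l * x) (ylist (map f l) * x).
Proof.
move=> x0 xf; elim: l => [|r l IH]; first by apply: yeq_refl.
rewrite /= !ylist_cons; apply: (@yeq_trans _ _ _ _ _ _ (y (f r) * ylist l * x)).
  rewrite !(ylist_yC HA) -!mulrA.
  by apply: (yeqMl (yfilt_ylist s e y l) (xf r)); rewrite addn1.
by rewrite -!mulrA; apply: (yeqMl (yfilt_y s e y _) IH).
Qed.

Lemma yeq_list_comm x l : yfilt 0 x ->
  (forall r, r \in l -> yeq 1 (x * y r) (y r * x)) ->
  yeq (size l) (x * ylist l) (ylist l * x).
Proof.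
move=> x0; elim: l => [|r l IH] xl; first by rewrite ylist_nil mul1r mulr1; apply: yeq_refl.
rewrite /= !ylist_cons; apply: (@yeq_trans _ _ _ _ _ _ (y r * x * ylist l)).
  by rewrite !mulrA; apply: (yeqMr (yfilt_ylist s e y l) (xl r _)); rewrite ?inE ?eqxx.
rewrite -!mulrA; apply: (yeqMl (yfilt_y s e y _) (IH _)) => // t tl.
by apply: xl; rewrite inE tl orbT.
Qed.

Lemma yeq_emat_comm M r : r \notin ends M -> yeq 1 (emat M * y r) (y r * emat M).
Proof.
elim: M => [|[p q] M IH]; first by rewrite /emat big_nil mul1r mulr1 => _; apply: yeq_refl.
rewrite /ends /= !inE !negb_or => /and3P[rp rq /IH {}IH].
rewrite emat_cons; apply: (@yeq_trans _ _ _ _ _ _ (eps p q * (y r * emat M))).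
  by rewrite -!mulrA; apply: (yeqMl (yfilt_eps HA p q) IH).
by rewrite !mulrA; apply: (yeqMr (yfilt_emat HA M) (yeq_eps_comm HA rp rq)).
Qed.

(** Two lists of dots are needed since a pair of [M] stands for two edges, one in each row. The
    lower list stays between the matching and the permutation, so its indices are strands of [M]. *)
Inductive dspan (k : nat) : A -> Prop :=
| dspan_low x : ylow k x -> dspan k x
| dspan_mon l M l' g : matching M -> (size l + size l' = k)%N ->
    dspan k (ylist l * emat M * ylist l' * T g)
| dspanD x x' : dspan k x -> dspan k x' -> dspan k (x + x')
| dspanN x : dspan k x -> dspan k (- x).

Lemma dspan_yeq k x x' : yeq k x x' -> dspan k x' -> dspan k x.
Proof.
move=> xx' Sx; rewrite -(subrK x' x); apply: dspanD => //; exact: dspan_low.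
Qed.

Lemma dspan_pm k x x' : pm x x' -> dspan k x' -> dspan k x.
Proof. by case=> -> //; apply: dspanN. Qed.

Lemma size_filter_split (P : pred 'I_n.+1) l :
  perm_eq l (filter P l ++ filter (predC P) l).
Proof. by rewrite perm_sym perm_filterC. Qed.

Lemma dspan_y k i x : dspan k x -> dspan k.+1 (y i * x).
Proof.
elim=> {x} [x kx|l M l' g wM sl|x x' _ IH _ IH'|x _ IH].
- by apply: dspan_low; rewrite -[k.+1]/(1 + k)%N; apply: ylowMl => //; apply: yfilt_y.
- by rewrite !mulrA -ylist_cons; apply: dspan_mon => //=; rewrite addSn sl.
- by rewrite mulrDr; apply: dspanD.
- by rewrite mulrN; apply: dspanN.
Qed.

Lemma dspan_sperm k (h : 'S_n.+1) x : dspan k x -> dspan k (T h * x).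
Proof.
elim=> {x} [x kx|l M l' g wM sl|x x' _ IH _ IH'|x _ IH].
- by apply: dspan_low; rewrite -[k]/(0 + k)%N; apply: ylowMl => //; apply: yfilt_sperm.
- have h1 : yeq (size l) (T h * ylist l) (ylist (map h l) * T h) := yeq_sperm_ylist HA h l.
  have h2 : yeq (size l') (T h * ylist l') (ylist (map h l') * T h) := yeq_sperm_ylist HA h l'.
  have Tg := yfilt_sperm HA g.
  apply: (dspan_yeq (x' := ylist (map h l) * emat (relabel h M) * ylist (map h l') * T (g * h)%g)).
    apply: (yeq_trans (x' := ylist (map h l) * T h * emat M * ylist l' * T g)).
      rewrite !mulrA; apply: (yeqMr Tg (j := k)); rewrite ?addn0 //.
      apply: (yeqMr (yfilt_ylist s e y l') (j := size l)); rewrite ?sl //.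
      by apply: (yeqMr (yfilt_emat HA M) h1); rewrite addn0.
    rewrite (spermM H) [X in yeq _ _ X]mulrA; apply: (yeqMr Tg (j := k)); rewrite ?addn0 //.
    rewrite -(mulrA (ylist _) (T h)) (sperm_emat H) -!mulrA -sl.
    apply: (yeqMl (i := size l) (j := size l')) => //.
      by rewrite -(size_map h); apply: yfilt_ylist.
    by apply: (yeqMl (yfilt_emat HA _) h2).
  by apply: dspan_mon; rewrite ?matching_relabel ?size_map.
- by rewrite mulrDr; apply: dspanD.
- by rewrite mulrN; apply: dspanN.
Qed.

Lemma dspan_ylist l k x : dspan k x -> dspan (size l + k) (ylist l * x).
Proof.
move=> kx; elim: l => [|r l IH]; first by rewrite ylist_nil mul1r.
by rewrite ylist_cons -mulrA; apply: dspan_y.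
Qed.

(* eps p q meets M at p, whose mate is not q: all dots at p and q slide to the
   mate of p, past both eps p q and the matching. *)
Lemma dspan_eps_meet k (p q : 'I_n.+1) l M l' g : matching M -> p != q -> p \in ends M -> mate M p != q ->
  (size l + size l' = k)%N -> dspan k (eps p q * (ylist l * emat M * ylist l' * T g)).
Proof.
move=> wM pq pM pMq sl.
have [p' [N [wN EN mN pN sN]]] := extract_pair H wM pM.
have p'E : mate M p = p' by rewrite mN mateL.
have p'q : p' != q by rewrite -p'E.
have pp' : p != p' by rewrite -p'E eq_sym mate_neq.
have [wM' EM'] := eps_emat_meet H wN pq p'q.
pose f r := if r == q then p else r.
pose f' r := if r == p then p' else r.
pose l1 := map f' (map f l).
have El1 : yeq (size l) (eps p q * (ylist l * emat M)) (ylist l1 * (eps p q * emat M)).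
  apply: (yeq_trans (x' := eps p q * ylist (map f l) * emat M)).
    rewrite mulrA; apply: (yeqMr (yfilt_emat HA M) (j := size l)); rewrite ?addn0 //.
    apply: yeq_relist_l => [|r]; first exact: yfilt_eps.
    by rewrite /f; case: eqP => [->|_]; [apply: yeq_eps_yl|apply: yeq_refl].
  apply: (yeq_trans (x' := eps p q * (ylist l1 * emat M))).
    rewrite -!mulrA; apply: (yeqMl (yfilt_eps HA _ _) (j := size l)) => //.
    have := @yeq_relist_r (emat M) f' (map f l) (yfilt_emat HA M); rewrite size_map; apply => r.
    rewrite /f'; case: eqP => [->|_]; last exact: yeq_refl.
    by rewrite -p'E; apply: yeq_y_emat.
  rewrite !mulrA; apply: (yeqMr (yfilt_emat HA M) (j := size l)); rewrite ?addn0 //.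
  have := @yeq_list_comm (eps p q) l1 (yfilt_eps HA _ _); rewrite !size_map; apply => r.
  case/mapP => r1 /mapP[r2 _ ->] ->; apply: (yeq_eps_comm HA).
    by rewrite /f'; case: (eqVneq (f r2) p) => // _; rewrite eq_sym.
  rewrite /f'; case: (eqVneq (f r2) p) => // _.
  by rewrite /f; case: (eqVneq r2 q).
apply: (dspan_yeq (x' := ylist l1 * (eps p q * emat M) * (ylist l' * T g))).
  rewrite -(mulrA _ (ylist l')) mulrA; apply: (yeqMr (i := size l') _ El1) => //.
  by rewrite -[size l']addn0; apply: (yfiltM (yfilt_ylist s e y l')); apply: yfilt_sperm.
apply: (dspan_pm (x' := ylist l1 * (emat ((q, p) :: relabel (tperm q p') N)
    * (T (tperm q p') * (ylist l' * T g))))).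
  rewrite -!mulrA; apply: pmMl; rewrite !mulrA; do 2!apply: pmMr.
  by apply: pm_trans EM'; apply: pmMl.
have -> : k = (size l1 + size l')%N by rewrite !size_map.
apply: dspan_ylist; set M' := (_ :: _) in wM' *.
have h2 : yeq (size l') (T (tperm q p') * ylist l') _ := yeq_sperm_ylist HA _ l'.
apply: (dspan_yeq (x' := ylist [::] * emat M' * ylist (map (tperm q p') l') * T (g * tperm q p')%g)).
  rewrite ylist_nil mul1r (spermM H) -!mulrA; apply: (yeqMl (yfilt_emat HA M')) => //.
  by rewrite !mulrA; apply: (yeqMr (yfilt_sperm HA g) h2); rewrite addn0.
by apply: dspan_mon => //; rewrite size_map.
Qed.

(** There are three cases: [p] or [q] is matched to a third strand ([dspan_eps_meet]), both are free
    and form a new pair, or they are mates and close a loop, so that the degree drops. *)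
Lemma dspan_eps k (p q : 'I_n.+1) x : p != q -> dspan k x -> dspan k (eps p q * x).
Proof.
move=> pq; elim=> {x} [x kx|l M l' g wM sl|x x' _ IH _ IH'|x _ IH].
- by apply: dspan_low; rewrite -[k]/(0 + k)%N; apply: ylowMl => //; apply: yfilt_eps.
- have [pM|pM] := boolP (p \in ends M); last first.
    have [qM|qM] := boolP (q \in ends M).
      apply: (dspan_pm (x' := eps q p * (ylist l * emat M * ylist l' * T g))).
        by rewrite (eps_sym H p) mulNr; right; rewrite opprK.
      apply: dspan_eps_meet => //; first by rewrite eq_sym.
      by apply: contraNneq pM => <-; rewrite -mate_neq // mateK // eq_sym mate_neq.
    (* both strands are free: the dots on them stay below the new cup *)
    pose P := [pred r | (r != p) && (r != q)].
    have El : ylist l = ylist (filter P l) * ylist (filter (predC P) l).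
      by rewrite -ylist_cat; apply: (ylist_perm HA); apply: size_filter_split.
    have sP : (size l = size (filter P l) + size (filter (predC P) l))%N.
      by rewrite -size_cat; apply: perm_size; apply: size_filter_split.
    rewrite El.
    apply: (dspan_yeq (x' := ylist (filter P l) * emat ((p, q) :: M)
        * ylist (filter (predC P) l ++ l') * T g)).
      rewrite ylist_cat !mulrA; apply: (yeqMr (yfilt_sperm HA g) (j := k)); rewrite ?addn0 //.
      apply: (yeqMr (yfilt_ylist s e y l') (j := size l)); rewrite ?sl //.
      apply: (yeq_trans (x' := ylist (filter P l) * eps p q * ylist (filter (predC P) l) * emat M)).
        apply: (yeqMr (yfilt_emat HA M) (j := size l)); rewrite ?addn0 //.
        apply: (yeqMr (yfilt_ylist s e y _) (j := size (filter P l))) => //.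
        apply: yeq_list_comm; first exact: yfilt_eps.
        by move=> r; rewrite mem_filter => /andP[/andP[rp rq] _]; apply: (yeq_eps_comm HA).
      rewrite emat_cons -!mulrA; apply: (yeqMl (yfilt_ylist s e y _) (j := size (filter (predC P) l))) => //.
      apply: (yeqMl (yfilt_eps HA _ _) (j := size (filter (predC P) l))) => //.
      apply: yeq_sym; apply: yeq_list_comm; first exact: yfilt_emat.
      move=> r; rewrite mem_filter /= negb_and !negbK => /andP[/orP[]/eqP-> _];
        exact: yeq_emat_comm.
    apply: dspan_mon; first by rewrite matching_cons pq pM qM.
    by rewrite size_cat addnA -sP.
  have [pMq|pMq] := eqVneq (mate M p) q; last exact: dspan_eps_meet.
  have [p' [N [wN EN mN pN sN]]] := extract_pair H wM pM.
  have p'E : q = p' by rewrite -pMq mN mateL.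
  subst p'.
  (* Now [p] and [q] are mates. Dots at [q] are collected at [p], dots on other strands are moved
     out to the left, and a loop carrying only dots at [p] remains. *)
  apply: dspan_low.
  have z0 : yfilt (size l') (ylist l' * T g).
    by rewrite -[size l']addn0; apply: (yfiltM (yfilt_ylist s e y l')); apply: yfilt_sperm.
  rewrite -(mulrA _ (ylist l')) mulrA -sl; apply: ylowMr z0 _.
  rewrite -[_ * _]subr0; change (yeq (size l) (eps p q * (ylist l * emat M)) 0).
  pose f r := if r == q then p else r.
  pose P := [pred r | r != p].
  apply: (yeq_trans (x' := eps p q * ylist (map f l) * emat M)).
    rewrite mulrA; apply: (yeqMr (yfilt_emat HA M) (j := size l)); rewrite ?addn0 //.
    apply: yeq_relist_l => [|r]; first exact: yfilt_eps.
    by rewrite /f; case: eqP => [->|_]; [apply: yeq_eps_yl|apply: yeq_refl].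
  rewrite -(size_map f); set l1 := map f l.
  have l1q : q \notin l1.
    by apply/mapP => -[r _]; rewrite /f; case: eqP => [_|/eqP rq] E; [rewrite E eqxx in pq|rewrite -E eqxx in rq].
  have sP : (size l1 = size (filter P l1) + size (filter (predC P) l1))%N.
    by rewrite -size_cat; apply: perm_size; apply: size_filter_split.
  have -> : ylist l1 = ylist (filter P l1) * ylist (filter (predC P) l1).
    by rewrite -ylist_cat; apply: (ylist_perm HA); apply: size_filter_split.
  have -> : filter (predC P) l1 = nseq (size (filter (predC P) l1)) p.
    by apply/all_pred1P; apply/allP => r; rewrite mem_filter /= negbK => /andP[].
  set c := size (filter (predC P) l1) in sP *.
  apply: (yeq_trans (x' := ylist (filter P l1) * (eps p q * ylist (nseq c p) * emat M))).
    rewrite !mulrA; apply: (yeqMr (yfilt_emat HA M) (j := size l1)); rewrite ?addn0 //.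
    apply: (yeqMr (yfilt_ylist s e y _) (j := size (filter P l1))); rewrite ?size_nseq //.
    apply: yeq_list_comm; first exact: yfilt_eps.
    move=> r; rewrite mem_filter => /andP[rp rl]; apply: (yeq_eps_comm HA) => //.
    by apply: contraNneq l1q => <-.
  rewrite -[X in yeq _ _ X](mulr0 (ylist (filter P l1))) sP.
  apply: (yeqMl (yfilt_ylist s e y _) (j := c)) => //.
  rewrite -(mul0r (emat M)); apply: yeq_diff_pmr EN _.
  rewrite emat_cons !mulrA mul0r; apply: (yeqMr (yfilt_emat HA N) (j := c)); rewrite ?addn0 //.
  exact: yeq_eps_loop.
- by rewrite mulrDr; apply: dspanD.
- by rewrite mulrN; apply: dspanN.
Qed.

Lemma yfilt_dspan k x : yfilt k x -> dspan k x.
Proof.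
elim=> {k x} [k||k a x an _ IH|k a x an _ IH|k i x _ IH|k x x' _ IH _ IH'|k x _ IH|k x kx _].
- by apply: dspan_low; apply: ylow0.
- have := @dspan_mon 0 [::] [::] [::] 1%g isT erefl.
  by rewrite !ylist_nil (sperm1 H) /emat big_nil !mulr1.
- by rewrite -(sperm_adj_tperm H an); apply: dspan_sperm.
- rewrite (e_eps H an); apply: dspan_eps => //.
  by rewrite -val_eqE /= !inordK ?ltnS // 1?ltnW // neq_ltn ltnSn.
- exact: dspan_y.
- exact: dspanD.
- exact: dspanN.
- exact: dspan_low.
Qed.

End Spanning.

(** * Sliding dots to the ends allowed in a regular monomial *)

Section Regularisation.
Variables (A : pzRingType) (n : nat).
Variables (s e : nat -> A) (y : 'I_n.+1 -> A).
Hypothesis HA : affine_triple s e y.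
Let H := at_brauer HA.
Local Notation T := (sperm s).
Local Notation emat := (emat s e).
Local Notation yfilt := (yfilt s e y).
Local Notation ylow := (ylow s e y).
Local Notation yeq := (yeq s e y).
Local Notation ylist := (ylist y).
Implicit Types (M : seq ('I_n.+1 * 'I_n.+1)) (g : 'S_n.+1) (l : seq 'I_n.+1).

Lemma yeq_regular M g l l' : matching M -> exists l1 l1',
  [/\ forall r, r \in l1 -> ~~ (mate M r < r)%N,
      forall r, r \in l1' -> exists2 t, t = g^-1%g (mate M (g r)) & (t < r)%N &
      yeq (size l + size l') (ylist l * emat M * ylist l' * T g)
        (ylist l1 * (emat M * T g) * ylist l1')].
Proof.
move=> wM; have mK := mateK wM.
(* Dots of the lower list on free strands ([P]) rise through the matching and join the upper list.
   [f] then moves an upper dot to the left end of its edge, and [h] moves a lower dot to the right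
   end; the bottom vertex of strand [r] is [g^-1 r], so [h] compares after [g^-1]. *)
pose P := [pred r | r \notin ends M].
pose f r := if (mate M r < r)%N then mate M r else r.
pose h r := if (g^-1%g r < g^-1%g (mate M r))%N then mate M r else r.
pose l2 := l ++ filter P l'; pose l2' := filter (predC P) l'.
pose l3' := map h l2'.
exists (map f l2), (map (g^-1)%g l3'); split.
- move=> r /mapP[t _ ->]; rewrite /f; case: ifP => [tt|/negbT //].
  by rewrite mK -leqNgt ltnW.
- move=> r /mapP[t /mapP[t1]]; rewrite mem_filter /= negbK => /andP[t1M _] -> ->.
  exists (g^-1%g (mate M (h t1))); first by rewrite permKV.
  rewrite /h; case: ifP => [|/negbT]; first by rewrite mK.
  rewrite -leqNgt leq_eqVlt => /orP[/eqP/val_inj/perm_inj E|//].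
  by move: t1M; rewrite -mate_neq // E eqxx.
have Ef : yfilt 0 (emat M) := yfilt_emat HA M.
have sl : (size l + size l' = size l2 + size l2')%N.
  rewrite size_cat -addnA; congr (_ + _)%N; rewrite -size_cat.
  by apply: perm_size; apply: size_filter_split.
apply: (yeq_trans (x' := ylist l2 * emat M * ylist l2' * T g)).
  apply: (yeqMr (yfilt_sperm HA g) (j := size l + size l')); rewrite ?addn0 //.
  have -> : ylist l' = ylist (filter P l') * ylist l2'.
    by rewrite -ylist_cat; apply: (ylist_perm HA); apply: size_filter_split.
  rewrite ylist_cat !mulrA sl; apply: (yeqMr (yfilt_ylist s e y l2') (j := size l2)) => //.
  rewrite /l2 size_cat -!mulrA; apply: (yeqMl (yfilt_ylist s e y l)) => //.
  by apply: yeq_list_comm => // r; rewrite mem_filter => /andP[rM _]; apply: yeq_emat_comm.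
rewrite sl; apply: (yeq_trans (x' := ylist (map f l2) * emat M * ylist l2' * T g)).
  rewrite -!(mulrA _ (ylist l2')).
  have z0 : yfilt (size l2') (ylist l2' * T g).
    by rewrite -[size l2']addn0; apply: (yfiltM (yfilt_ylist s e y _)); apply: yfilt_sperm.
  apply: (yeqMr z0 (j := size l2)) => //; apply: yeq_relist_r => // r.
  by rewrite /f; case: ifP => _; [apply: yeq_y_emat|apply: yeq_refl].
rewrite -!mulrA; apply: (yeqMl (i := size l2) (j := size l2')) => //.
  by rewrite -(size_map f); apply: yfilt_ylist.
apply: (yeq_trans (x' := emat M * (ylist l3' * T g))).
  rewrite !mulrA; apply: (yeqMr (yfilt_sperm HA g) (j := size l2')); rewrite ?addn0 //.
  apply: yeq_relist_l => // r.
  by rewrite /h; case: ifP => _; [apply: yeq_emat_y|apply: yeq_refl].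
apply: (yeqMl Ef (j := size l2')) => //; apply: yeq_sym.
have := yeq_sperm_ylist HA g (map g^-1%g l3'); by rewrite (mapK (permKV g)) 2!size_map.
Qed.

(** Strong induction on the degree absorbs the terms of lower degree produced by sliding. *)
Lemma yfilt_regular (B : A -> Prop) :
  B 0 -> (forall x x', B x -> B x' -> B (x + x')) -> (forall x, B x -> B (- x)) ->
  (forall M g l l', matching M ->
     (forall r, r \in l -> ~~ (mate M r < r)%N) ->
     (forall r, r \in l' -> exists2 t, t = g^-1%g (mate M (g r)) & (t < r)%N) ->
     B (ylist l * (emat M * T g) * ylist l')) ->
  forall k x, yfilt k x -> B x.
Proof.
move=> B0 BD BN Breg k; elim/ltn_ind: k => k IH.
have Blow x : ylow k x -> B x by case: k IH => [_ ->//|k IH]; apply: IH.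
move=> x /(yfilt_dspan HA); elim=> {x} [x /Blow //|l M l' g wM sl|x x' _ Bx _|x _].
- have [l1 [l1' [h1 h2]]] := yeq_regular g l l' wM; rewrite sl => h3.
  rewrite -(subrK (ylist l1 * (emat M * T g) * ylist l1') (_ * T g)).
  by apply: BD; [apply: Blow|apply: Breg].
- exact: BD.
- exact: BN.
Qed.

End Regularisation.

(** * Transporting the defining relations to families indexed by natural numbers *)

Section RelationsUnderMorphism.
Variables (F B : nzRingType) (f : {rmorphism F -> B}) (n : nat).
Variables (fs fe : 'I_n.+1.-1 -> F) (fy : 'I_n.+1 -> F).
Variables (s e : nat -> B) (y : 'I_n.+1 -> B).
Hypothesis gs : forall i, f (fs i) = s i.
Hypothesis ge : forall i, f (fe i) = e i.
Hypothesis gy : forall i, f (fy i) = y i.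
Hypothesis frel : forall p q, periplectic_rel fs fe fy p q -> f p = f q.

Let mor := (rmorphM f, rmorphB f, rmorphN f, rmorph1 f, rmorph0 f, rmorphXn f).
Let O a (an : (a < n)%N) : 'I_n.+1.-1 := Ordinal an.

Lemma rel_brauer_pair : brauer_pair n s e.
Proof.
split.
- by move=> a an; have := frel (rel_ss _ _ _ (O an)); rewrite !mor /= !(gs, ge, gy).
- move=> a b /andP[ab bn]; have an : (a < n)%N by lia.
  have := frel (@rel_s_comm _ _ _ _ _ (O an) (O bn) _); rewrite /far_apart /= ab => /(_ isT).
  by rewrite !mor /= !(gs, ge, gy).
- move=> a an; have := frel (@rel_braid _ _ _ _ _ (O (ltnW an)) (O an) erefl).
  by rewrite !mor /= !(gs, ge, gy).
- by move=> a an; have := frel (rel_ee _ _ _ (O an)); rewrite !mor /= !(gs, ge, gy).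
- move=> a b /andP[ab bn]; have an : (a < n)%N by lia.
  have := frel (@rel_ee_comm _ _ _ _ _ (O an) (O bn) _); rewrite /far_apart /= ab => /(_ isT).
  by rewrite !mor /= !(gs, ge, gy).
- move=> a b /andP[ab bn]; have an : (a < n)%N by lia.
  have := frel (@rel_se_comm _ _ _ _ _ (O an) (O bn) _); rewrite /far_apart /= ab => /(_ isT).
  by rewrite !mor /= !(gs, ge, gy).
- move=> a b /andP[ab bn]; have an : (a < n)%N by lia.
  have := frel (@rel_se_comm _ _ _ _ _ (O bn) (O an) _); rewrite /far_apart /= ab orbT => /(_ isT).
  by rewrite !mor /= !(gs, ge, gy).
- by move=> a an; have := frel (rel_es _ _ _ (O an)); rewrite !mor /= !(gs, ge, gy).
- by move=> a an; have := frel (rel_se _ _ _ (O an)); rewrite !mor /= !(gs, ge, gy) => /oppr_inj.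
- move=> a an; have := frel (@rel_see _ _ _ _ _ (O (ltnW an)) (O an) erefl).
  by rewrite !mor /= !(gs, ge, gy).
- move=> a an; have := frel (@rel_ees _ _ _ _ _ (O (ltnW an)) (O an) erefl).
  by rewrite !mor /= !(gs, ge, gy).
- move=> a an; have := frel (@rel_ees' _ _ _ _ _ (O (ltnW an)) (O an) erefl).
  by rewrite !mor /= !(gs, ge, gy).
- move=> a an; have := frel (@rel_see' _ _ _ _ _ (O (ltnW an)) (O an) erefl).
  by rewrite !mor /= !(gs, ge, gy).
- move=> a an; have := frel (@rel_eee' _ _ _ _ _ (O (ltnW an)) (O an) erefl).
  by rewrite !mor /= !(gs, ge, gy).
- move=> a an; have := frel (@rel_eee _ _ _ _ _ (O (ltnW an)) (O an) erefl).
  by rewrite !mor /= !(gs, ge, gy).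
Qed.

Let pl a (an : (a < n)%N) : pos_left (O an) = inord a.
Proof. by apply: val_inj; rewrite /= inordK // ltnW. Qed.
Let pr a (an : (a < n)%N) : pos_right (O an) = inord a.+1.
Proof. by apply: val_inj; rewrite /= inordK. Qed.

Lemma rel_affine_triple : affine_triple s e y.
Proof.
split.
- exact: rel_brauer_pair.
- by move=> i j; have := frel (rel_yy _ _ _ i j); rewrite !mor /= !(gs, ge, gy).
- move=> a i an; rewrite -(pl an) -(pr an) => h1 h2.
  by have := frel (rel_sy _ _ _ h1 h2); rewrite !mor /= !(gs, ge, gy).
- move=> a i an; rewrite -(pl an) -(pr an) => h1 h2.
  by have := frel (rel_ey _ _ _ h1 h2); rewrite !mor /= !(gs, ge, gy).
- by move=> a an; have := frel (rel_sy_ys _ _ _ (O an)); rewrite !mor /= !(gs, ge, gy) pl pr.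
- by move=> a an; have := frel (rel_ys_sy _ _ _ (O an)); rewrite !mor /= !(gs, ge, gy) pl pr.
- by move=> a an; have := frel (rel_eyy _ _ _ (O an)); rewrite !mor /= !(gs, ge, gy) pl pr.
- by move=> a an; have := frel (rel_yye _ _ _ (O an)); rewrite !mor /= !(gs, ge, gy) pl pr.
- move=> [|k] n0; first by rewrite expr0 mulr1 (bp_ee rel_brauer_pair).
  have := frel (@rel_eye _ _ _ _ _ (O n0) k.+1 erefl isT).
  by rewrite !mor /= !(gs, ge, gy) pl.
Qed.

End RelationsUnderMorphism.

Section AffineGenerators.
Variables (K : comNzRingType) (n : nat).
Local Notation aff := (affine_periplectic K n.+1).
Local Notation cls := (@periplectic_class K n.+1).

Definition aff_s (a : nat) : aff := oapp (fun i : 'I_n => cls (inl (inl i))) 1 (insub a).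
Definition aff_e (a : nat) : aff := oapp (fun i : 'I_n => cls (inl (inr i))) 0 (insub a).
Definition aff_y (i : 'I_n.+1) : aff := cls (inr i).

Lemma aff_sE (i : 'I_n) : aff_s i = cls (inl (inl i)).
Proof. by rewrite /aff_s valK. Qed.
Lemma aff_eE (i : 'I_n) : aff_e i = cls (inl (inr i)).
Proof. by rewrite /aff_e valK. Qed.

Let rel := periplectic_rel (@free_s K n.+1) (@free_eps K n.+1) (@free_y K n.+1).

Definition aff_class (p : free_algebra K (periplectic_gen n.+1)) : aff := presented_class rel p.

Fact aff_classB : {morph aff_class : p q / p - q}.
Proof. by move=> p q; rewrite [LHS](raddfB \pi_(presented_algebra rel)%qT). Qed.
Fact aff_classM : multiplicative aff_class.
Proof. split; [exact: presented_classM | reflexivity]. Qed.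
Fact aff_classZ : scalable aff_class.
Proof. by move=> c p; rewrite [LHS]presented_classZ. Qed.
HB.instance Definition _ := GRing.isAdditive.Build _ _ aff_class aff_classB.
HB.instance Definition _ := GRing.isMultiplicative.Build _ _ aff_class aff_classM.
HB.instance Definition _ := GRing.isScalable.Build K _ _ _ aff_class aff_classZ.

Lemma aff_class_rel p q : rel p q -> aff_class p = aff_class q.
Proof. by move=> pq; apply/presented_classP; apply: relation_ideal_base. Qed.

Lemma aff_affine_triple : affine_triple aff_s aff_e aff_y.
Proof.
apply: (@rel_affine_triple _ _ aff_class n (@free_s K n.+1) (@free_eps K n.+1) (@free_y K n.+1)).
- by move=> i; rewrite aff_sE.
- by move=> i; rewrite aff_eE.
- by [].
- exact: aff_class_rel.
Qed.

(* Only additive spans occur in yfilt, so scalars enter here. *)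
Lemma aff_ind (B : aff -> Prop) :
  B 0 -> (forall x x', B x -> B x' -> B (x + x')) -> (forall c x, B x -> B (c *: x)) ->
  (forall k x, yfilt aff_s aff_e aff_y k x -> B x) -> forall x, B x.
Proof.
move=> B0 BD BZ Bf x; case: (presented_class_surj x) => p ->.
rewrite -[presented_class _ p]/(aff_class p) [p]monalgE raddf_sum.
apply: big_ind => // m _.
have -> : << p@_m *g m >> = p@_m *: << m >> :> free_algebra K (periplectic_gen n.+1).
  by apply/malgP => k; rewrite mcoeffZ !mcoeffU mulrnAr mulr1.
rewrite [X in B X](aff_classZ p@_m << m >>); apply: BZ.
suff [k] : exists k, yfilt aff_s aff_e aff_y k (aff_class << m >>) by exact: Bf.
case: m => w; elim: w => [|z w [k IH]].
  exists 0%N; rewrite -fmoneE [X in yfilt _ _ _ _ X](rmorph1 aff_class).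
  exact: yfilt1.
have -> : << FMonom (z :: w) >> = free_gen K z * << FMonom w >>
    :> free_algebra K (periplectic_gen n.+1).
  rewrite malgM_def fgmulUU mul1r; congr << _ >>.
  by apply: val_inj; rewrite /= fmM fmU.
rewrite rmorphM /=.
case: z => [[i|i]|i].
- by exists k; rewrite -[aff_class _]/(cls _) -aff_sE; apply: yfilts.
- by exists k; rewrite -[aff_class _]/(cls _) -aff_eE; apply: yfilte.
- by exists k.+1; rewrite -[aff_class (free_gen _ _)]/(aff_y i); apply: yfilty.
Qed.

End AffineGenerators.

(** * Diagrams acting on tensor powers *)

Section SignedRelations.
Variables (K : comNzRingType) (X : finType) (n N : nat).
Local Notation word := (tword X).
Local Notation tensor_op := (tensor_op K X).
Implicit Types (w : word) (h : tensor K X) (C : word -> word -> Prop) (U : tensor_op).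

Definition strand (i : nat) := (N <= i < N + n.+1)%N.
Definition st (a : 'I_n.+1) := (N + a)%N.

(* The nonzero matrix entries of U are signs, located on the relation C. *)
Definition signed C U := forall h w,
  ((forall w', C w w' -> h w' = 0) -> U h w = 0) /\
  (forall w'', C w w'' -> (forall w', C w w' -> h w' <> 0 -> w' = w'') ->
     exists b, U h w = sgn K b * h w'').

Lemma signed_ext C C' U : (forall w w', C w w' <-> C' w w') -> signed C U -> signed C' U.
Proof.
move=> CC' SU h w; have [S1 S2] := SU h w; split=> [h0|w'' /CC' Cw h0].
  by apply: S1 => w' /CC'; apply: h0.
by apply: S2 => // w' /CC'; apply: h0.
Qed.

(** The last hypothesis says that two related words determine the intermediate one. Each entry of
    the product is then a single product of signs, and nothing cancels. *)
Lemma signed_comp C D U V : signed C U -> signed D V ->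
  (forall w w1 w2 w'', C w w1 -> C w w2 -> D w1 w'' -> D w2 w'' -> w1 = w2) ->
  signed (fun w w'' => exists w', C w w' /\ D w' w'') (U * V).
Proof.
move=> SU SV amb h w.
have Z : (forall w', (exists w1, C w w1 /\ D w1 w') -> h w' = 0) -> (U * V) h w = 0.
  move=> h0; apply: (SU _ _).1 => w1 Cw1; apply: (SV _ _).1 => w' Dw'.
  by apply: h0; exists w1.
split=> // w'' [w1 [Cw1 Dw1]] huniq.
have [h0|h0] := pselect (h w'' = 0).
  exists false; rewrite h0 mulr0; apply: Z => w' Cw'.
  by apply: contrapT => hw'; move: (hw'); rewrite (huniq w' Cw' hw').
have [b Eb] : exists b, V h w1 = sgn K b * h w''.
  by apply: (SV _ _).2 => // w' Dw' hw'; apply: huniq => //; exists w1.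
have [b' Eb'] : exists b', U (V h) w = sgn K b' * V h w1.
  apply: (SU _ _).2 => // w2 Cw2 Vw2.
  have [w' [Dw' hw']] : exists w', D w2 w' /\ h w' <> 0.
    apply: contrapT => nex; apply: Vw2; apply: (SV _ _).1 => w' Dw'.
    by apply: contrapT => hw'; apply: nex; exists w'.
  have E : w' = w'' by apply: huniq => //; exists w2.
  by subst w'; apply: (amb w w2 w1 w'').
by exists (b' (+) b); rewrite [LHS]Eb' Eb mulrA /sgn signr_addb.
Qed.

Definition wperm (g : 'S_n.+1) w : word :=
  fun i => if strand i then w (st (g (inord (i - N)))) else w i.

Lemma stE a : st a = (N + a)%N. Proof. by []. Qed.

Lemma strand_st a : strand (st a).
Proof. by rewrite /strand /st leq_addr ltn_add2l ltn_ord. Qed.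

Lemma st_inord i : strand i -> st (inord (i - N)) = i.
Proof. by rewrite /strand /st => /andP[Ni iN]; rewrite inordK ?subnKC // ltn_subLR. Qed.

Lemma inord_st a : inord (st a - N) = a.
Proof. by rewrite /st addKn inord_val. Qed.

Lemma wperm_st g w a : wperm g w (st a) = w (st (g a)).
Proof. by rewrite /wperm strand_st inord_st. Qed.

Lemma wperm_out g w i : ~~ strand i -> wperm g w i = w i.
Proof. by rewrite /wperm => /negPf ->. Qed.

Lemma word_eq w w' : (forall a, w (st a) = w' (st a)) ->
  (forall i, ~~ strand i -> w i = w' i) -> w = w'.
Proof.
move=> E1 E2; apply/funext => i; case si : (strand i); last by apply: E2; rewrite si.
by rewrite -(st_inord si).
Qed.

Lemma wpermM g g' w : wperm g (wperm g' w) = wperm (g * g')%g w.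
Proof.
apply: word_eq => [a|i si]; first by rewrite !wperm_st permM.
by rewrite !wperm_out.
Qed.

Lemma wperm1 w : wperm 1%g w = w.
Proof.
apply: word_eq => [a|i si]; first by rewrite !wperm_st perm1.
by rewrite !wperm_out.
Qed.

Lemma wperm_adj_tperm a w : (a < n)%N -> wperm (adj_tperm n a) w = tswap (N + a) (N + a).+1 w.
Proof.
move=> an; have sa : st (inord a) = (N + a)%N by rewrite /st inordK // ltnW.
have sa1 : st (inord a.+1) = (N + a).+1 by rewrite /st inordK // addnS.
apply: word_eq => [b|i si].
  rewrite wperm_st tswapE -sa1 -sa /adj_tperm; case: tpermP => [->|->|/eqP h1 /eqP h2].
  - by rewrite eqxx sa sa1 (_ : _ == _ = false) //; apply/negbTE; lia.
  - by rewrite eqxx.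
  - have inj u v : (st u == st v) = (u == v) by rewrite eqn_add2l.
    by rewrite !inj (negPf h1) (negPf h2).
rewrite wperm_out // tswapE.
have h1 : (i == (N + a).+1) = false by apply: contraNF si => /eqP ->; rewrite /strand; lia.
have h2 : (i == (N + a)%N) = false by apply: contraNF si => /eqP ->; rewrite /strand; lia.
by rewrite h1 h2.
Qed.

Definition strand_swap (a : nat) : tensor_op := swap_op K X (N + a).
Definition strand_cup (a : nat) : tensor_op := cup_op K X (N + a).

Lemma strand_brauer_pair : brauer_pair n strand_swap strand_cup.
Proof. exact: (brauer_pair_shift (tensor_brauer_pair K X (N + n))). Qed.

Local Notation T := (sperm strand_swap).
Local Notation eps := (eps strand_swap strand_cup).
Local Notation emat := (emat strand_swap strand_cup).

Lemma signed_sperm g : signed (fun w w' => w' = wperm g w) (T g).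
Proof.
suff S h w : exists b, T g h w = sgn K b * h (wperm g w).
  move=> h w; have [b Eb] := S h w; split=> [h0|w'' -> _]; last by exists b.
  by rewrite Eb h0 ?mulr0.
have [v [vn <-]] := word_perm_surj g; rewrite (sperm_word strand_brauer_pair) //.
elim: v w vn => [|a v IH] w /=; first by rewrite big_nil wperm1 => _; exists false; rewrite mul1r.
case/andP=> an vn; rewrite big_cons -wpermM.
have [b Eb] := IH (wperm (adj_tperm n a) w) vn.
exists ((w (N + a)%N).2 && (w (N + a).+1).2 (+) b).
rewrite /sgn signr_addb -/(sgn K _) -/(sgn K b) -mulrA -Eb wperm_adj_tperm //.
Qed.

Lemma signed_cup_op a : signed (fun w w' => [/\ w a.+1 = dual (w a), w' a.+1 = dual (w' a) &
    forall i, i != a -> i != a.+1 -> w' i = w i]) (cup_op K X a).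
Proof.
move=> h w; split=> [h0|w'' [E1 E2 E3] huniq].
  rewrite cup_opE; case: eqP => // E; apply: big1 => l _; rewrite h0 ?mulr0 //; split=> //.
    by rewrite !updE eqxx (_ : (a == a.+1) = false) ?eqxx //; apply/negbTE; lia.
  by move=> i h1 h2; rewrite !updE (negPf h1) (negPf h2).
rewrite cup_opE E1 eqxx (bigD1 (w'' a)) //= big1 ?addr0 => [|l lw].
  exists (w'' a).2; congr (_ * h _); apply/funext => i; rewrite !updE.
  by case: eqP => [->|/eqP h2]; [|case: eqP => [->|/eqP h1 //]]; rewrite // E3.
have [->|hz] := pselect (h (upd (upd w a l) a.+1 (dual l)) = 0); first by rewrite mulr0.
case/eqP: lw.
have <- : upd (upd w a l) a.+1 (dual l) = w''.
  apply: huniq => //; split=> //.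
    by rewrite !updE eqxx (_ : (a == a.+1) = false) ?eqxx //; apply/negbTE; lia.
  by move=> i h1 h2; rewrite !updE (negPf h1) (negPf h2).
by rewrite !updE eqxx (_ : (a == a.+1) = false) //; apply/negbTE; lia.
Qed.

Definition eps_rel (p q : 'I_n.+1) w w' := [/\ w (st q) = dual (w (st p)),
  w' (st q) = dual (w' (st p)), forall a, a != p -> a != q -> w' (st a) = w (st a) &
  forall i, ~~ strand i -> w' i = w i].

Lemma signed_eps p q : p != q -> signed (eps_rel p q) (eps p q).
Proof.
move=> pq; have n0 := neq_n0 pq; have [g [gp gq]] := eps_frame pq.
rewrite -gp -gq (epsE strand_brauer_pair) // /cj.
have S1 := signed_comp (signed_sperm g) (@signed_cup_op (N + 0)) _.
have S2 := signed_comp (S1 _) (signed_sperm g^-1%g) _.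
apply: signed_ext (S2 _ _) => [w w'||].
- split.
    case=> w2 [[w1 [-> [E1 E2 E3]]] ->].
    have s0 : st (inord 0) = (N + 0)%N by rewrite /st inordK.
    have s1 : st (inord 1) = (N + 0).+1 by rewrite /st inordK // addn1 addn0.
    rewrite -s1 -s0 !wperm_st in E1 E2 E3 *.
    split; rewrite ?wperm_st ?permK //.
      move=> a h1 h2; rewrite wperm_st E3 ?wperm_st ?permKV //.
        by apply: contraNneq h1 => /addnI/val_inj <-; rewrite permKV.
      by apply: contraNneq h2 => /addnI/val_inj <-; rewrite permKV.
    move=> i si; rewrite wperm_out // E3 ?wperm_out //.
      by apply: contraNneq si => ->; apply: strand_st.
    by apply: contraNneq si => ->; apply: strand_st.
  case=> E1 E2 E3 E4; exists (wperm g w'); split; last by rewrite wpermM mulVg wperm1.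
  exists (wperm g w); split=> //.
  have s0 : st (inord 0) = (N + 0)%N by rewrite /st inordK.
  have s1 : st (inord 1) = (N + 0).+1 by rewrite /st inordK // addn1 addn0.
  rewrite -s1 -s0 !wperm_st; split=> // i h1 h2.
  case si : (strand i); last by rewrite !wperm_out ?si // E4 ?si.
  rewrite -(st_inord si) !wperm_st E3 //.
    by rewrite (inj_eq perm_inj); apply: contraNneq h1 => <-; rewrite st_inord.
  by rewrite (inj_eq perm_inj); apply: contraNneq h2 => <-; rewrite st_inord.
- by move=> w w1 w2 w'' -> ->.
- move=> w w1 w2 w'' _ _ -> /(congr1 (wperm g)).
  by rewrite !wpermM mulgV !wperm1.
Qed.

Definition emat_rel (M : seq ('I_n.+1 * 'I_n.+1)) w w' :=
  (forall a, if mate M a == a then w' (st a) = w (st a)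
     else w (st (mate M a)) = dual (w (st a)) /\ w' (st (mate M a)) = dual (w' (st a))) /\
  (forall i, ~~ strand i -> w' i = w i).

(** The intermediate word is determined: at [p] and [q], which the remaining matching fixes, by the
    final word, and elsewhere by the initial one. *)
Lemma signed_emat M : matching M -> signed (emat_rel M) (emat M).
Proof.
elim: M => [|[p q] M IH] wM.
  rewrite emat_nil; apply: signed_ext (_ : signed (fun w w' => w' = w) 1).
    move=> w w'; split=> [->|[E1 E2]]; first by split=> // a; rewrite perm1 eqxx.
    by apply: word_eq => // a; have := E1 a; rewrite perm1 eqxx.
  by move=> h w; split=> [h0|w'' -> _]; [apply: h0|exists false; rewrite mul1r].
rewrite emat_cons; have := wM; rewrite matching_cons => /and4P[pq pM qM wM1].
have pf : mate M p = p by apply: mate_out.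
have qf : mate M q = q by apply: mate_out.
apply: signed_ext (signed_comp (signed_eps pq) (IH wM1) _); last first.
  move=> w w1 w2 w'' [_ _ h1 h1'] [_ _ h2 h2'] [h3 _] [h4 _].
  apply: word_eq => [a|i si]; last by rewrite h1' // h2'.
  have [->|ap] := eqVneq a p; first by have := h3 p; have := h4 p; rewrite pf eqxx => <- <-.
  have [->|aq] := eqVneq a q; first by have := h3 q; have := h4 q; rewrite qf eqxx => <- <-.
  by rewrite h1 // h2.
move=> w w''; split.
  case=> w' [[E1 E2 E3 E4] [F1 F2]]; split=> [a|i si]; last by rewrite F2 // E4.
  have Fp : w'' (st p) = w' (st p) by have := F1 p; rewrite pf eqxx.
  have Fq : w'' (st q) = w' (st q) by have := F1 q; rewrite qf eqxx.
  have [->|ap] := eqVneq a p; first by rewrite mateL // eq_sym (negPf pq) Fp Fq.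
  have [->|aq] := eqVneq a q; first by rewrite mateR // (negPf pq) Fp Fq E1 E2 !dualK.
  rewrite mateD //; have := F1 a; case: eqP => [_ ->|Ma [G1 G2]]; first by rewrite E3.
  split=> //; rewrite -!E3 //.
    by apply: contraNneq ap => E; rewrite -pf -E mateK.
  by apply: contraNneq aq => E; rewrite -qf -E mateK.
case=> F1 F2; exists (upd (upd w (st p) (w'' (st p))) (st q) (w'' (st q))).
have inj u v : (st u == st v) = (u == v) by rewrite eqn_add2l.
have Fp := F1 p; rewrite mateL // eq_sym (negPf pq) in Fp.
split; split.
- by case: Fp.
- by rewrite !updE !inj eqxx (negPf pq) eqxx; case: Fp.
- by move=> a ap aq; rewrite !updE !inj (negPf ap) (negPf aq).
- by move=> i si; rewrite !updE; case: eqP si => [->|_]; rewrite ?strand_st //;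
   case: eqP => [->|//]; rewrite strand_st.
- move=> a; have [->|ap] := eqVneq a p.
    by rewrite pf eqxx !updE !inj eqxx (negPf pq).
  have [->|aq] := eqVneq a q; first by rewrite qf eqxx !updE eqxx.
  have := F1 a; rewrite mateD // !updE !inj (negPf ap) (negPf aq).
  have -> : (mate M a == p) = false by apply: contraNF ap => /eqP E; rewrite -pf -E mateK.
  by have -> : (mate M a == q) = false by apply: contraNF aq => /eqP E; rewrite -qf -E mateK.
- move=> i si; rewrite F2 // !updE; case: eqP si => [->|_]; rewrite ?strand_st //.
  by case: eqP => [->|//]; rewrite strand_st.
Qed.

Definition vlabel w w' (x : vertex n.+1) : label X :=
  match x with inl a => w (st a) | inr b => w' (st b) end.

Definition is_top (x : vertex n.+1) := if x is inl _ then true else false.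

Definition diagram_rel M (g : 'S_n.+1) w w' :=
  (forall x, vlabel w w' (partner M g x) =
     if is_top (partner M g x) == is_top x then dual (vlabel w w' x) else vlabel w w' x) /\
  (forall i, ~~ strand i -> w' i = w i).

Lemma signed_diagram M g : matching M -> signed (diagram_rel M g) (emat M * T g).
Proof.
move=> wM; apply: signed_ext (signed_comp (signed_emat wM) (signed_sperm g) _); last first.
  move=> w w1 w2 w'' _ _ -> /(congr1 (wperm g^-1%g)).
  by rewrite !wpermM mulVg !wperm1.
move=> w w'; split.
  case=> w1 [[E1 E2] ->]; split=> [x|i si]; last by rewrite wperm_out // E2.
  case: x => [a|b] /=.
    have := E1 a; by case: eqVneq => [E E'|ne [E' _]] /=; rewrite ?wperm_st ?permKV E'.
  have := E1 (g b); case: eqVneq => [E|ne [_ E]] /=; first by rewrite wperm_st => ->.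
  by rewrite !wperm_st permKV E.
case=> E1 E2; exists (wperm g^-1%g w'); split; last by rewrite wpermM mulgV wperm1.
split=> [a|i si]; last by rewrite wperm_out // E2.
have := E1 (inl a); have := E1 (inr (g^-1%g a)); rewrite /= permKV !wperm_st.
by case: eqVneq => [_|_] /= -> // ->; rewrite ?permKV.
Qed.

End SignedRelations.

Lemma set2_inj (I : finType) (x y p q : I) :
  [set x; y] = [set p; q] -> (x = p /\ y = q) \/ (x = q /\ y = p).
Proof.
move=> E.
have hx : x \in [set p; q] by rewrite -E set21.
have hy : y \in [set p; q] by rewrite -E set22.
have hp : p \in [set x; y] by rewrite E set21.
have hq : q \in [set x; y] by rewrite E set22.
case/set2P: hx => hx; case/set2P: hy => hy; case/set2P: hp => hp; case/set2P: hq => hq;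
  solve [left; split; congruence | right; split; congruence].
Qed.

(** * Colours along the diagram of a word *)

Section WordSupport.
Variables (K : comNzRingType) (X : finType) (n N : nat).
Local Notation word := (tword X).
Local Notation tensor_op := (tensor_op K X).
Local Notation st := (st (n := n) N).
Local Notation strand := (strand n N).
Local Notation vlabel := (vlabel (X := X) (n := n) N).

Definition colour_const (D : {set {set vertex n.+1}}) (u v : word) :=
  forall x y, [set x; y] \in D -> (vlabel u v x).1 = (vlabel u v y).1.

Definition letter_op (l : brauer_letter n.+1) : tensor_op :=
  match l with inl a => swap_op K X (N + a) | inr a => cup_op K X (N + a) end.

Definition word_op (w : seq (brauer_letter n.+1)) : tensor_op := \prod_(l <- w) letter_op l.

Lemma st_left (a : 'I_n) : st (pos_left (d := n.+1) a) = (N + a)%N. Proof. by []. Qed.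
Lemma st_right (a : 'I_n) : st (pos_right (d := n.+1) a) = (N + a).+1.
Proof. by rewrite stE addnS. Qed.

Lemma letter_support l h u : letter_op l h u <> 0 -> exists v, [/\ h v <> 0,
  colour_const (letter_diagram l) u v & forall i, ~~ strand i -> v i = u i].
Proof.
have pa1 (a : 'I_n) : (N + a).+1 = st (pos_right (d := n.+1) a) := esym (st_right a).
have inj (a b : 'I_n.+1) : (st a == st b) = (a == b) by rewrite eqn_add2l.
have out i (a : 'I_n) : ~~ strand i -> (i != N + a)%N /\ i != (N + a).+1.
  by move=> si; split; apply: contraNneq si => ->; [rewrite -(st_left a)|rewrite pa1]; apply: strand_st.
have vert (a : 'I_n) j : j \notin [:: pos_left (d := n.+1) a; pos_right (d := n.+1) a] ->
    st j != (N + a)%N /\ st j != (N + a).+1.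
  by rewrite !inE negb_or pa1 -(st_left a) !inj => /andP[].
have Sa (a : nat) : (a == a.+1) = false by apply/negbTE; lia.
case: l => a /= hu.
  exists (tswap (N + a) (N + a).+1 u); split.
  - by apply: contra_not hu => ->; rewrite mulr0.
  - move=> x y /setUP[/set2P[]/set2_inj[]|/imsetP[j]].
    + by case=> -> -> /=; rewrite tswapE -pa1 eqxx.
    + by case=> -> -> /=; rewrite tswapE -pa1 eqxx.
    + by case=> -> -> /=; rewrite tswapE -pa1 st_left Sa eqxx.
    + by case=> -> -> /=; rewrite tswapE -pa1 st_left Sa eqxx.
    + rewrite inE => /vert [h1 h2] /set2_inj[] [-> ->] /=;
        by rewrite tswapE (negPf h1) (negPf h2).
  - by move=> i /(out _ a) [/negPf h1 /negPf h2]; rewrite tswapE h1 h2.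
have [v [[E1 E2 E3] hv]] : exists v, [/\ u (N + a).+1 = dual (u (N + a)%N),
    v (N + a).+1 = dual (v (N + a)%N) &
    forall i, i != (N + a)%N -> i != (N + a).+1 -> v i = u i] /\ h v <> 0.
  have [S1 _] := signed_cup_op (N + a) h u; apply: contrapT => nex; apply: hu; apply: S1 => v Cv.
  by apply: contrapT => hv; apply: nex; exists v.
exists v; split=> //; last by move=> i /(out _ a) [h1 h2]; apply: E3.
move=> x y /setUP[/set2P[]/set2_inj[]|/imsetP[j]].
- by case=> -> -> /=; rewrite -pa1 E1.
- by case=> -> -> /=; rewrite -pa1 E1.
- by case=> -> -> /=; rewrite -pa1 E2.
- by case=> -> -> /=; rewrite -pa1 E2.
- by rewrite inE => /vert [h1 h2] /set2_inj[] [-> ->] /=; rewrite E3.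
Qed.

(** Colours, parities being forgotten, are constant on the edges of both stacked diagrams, hence on
    connected components, and these define [concat_diagram]. So the operator controls the diagram of
    a word without any concatenation being computed. *)
Lemma word_support w h u : word_op w h u <> 0 -> exists v, [/\ h v <> 0,
  colour_const (word_diagram w) u v & forall i, ~~ strand i -> v i = u i].
Proof.
elim: w h u => [|l w IH] h u.
  rewrite /word_op big_nil => hu; exists u; split=> // x y.
  case/imsetP => j _ /set2_inj [[-> ->]|[-> ->]] //.
rewrite /word_op big_cons => /letter_support [m [/IH [v [hv wv mv]] lm um]].
exists v; split=> // [|i si]; last by rewrite mv // um.
pose slab (x : stacked_vertex n.+1) : option X :=
  match x with
  | inl (inl i) => (u (st i)).1 | inl (inr i) => (m (st i)).1 | inr i => (v (st i)).1
  end.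
have upE x : slab (in_upper x) = (vlabel u m x).1 by case: x.
have loE x : slab (in_lower x) = (vlabel m v x).1 by case: x.
have ouE x : slab (in_outer x) = (vlabel u v x).1 by case: x.
have edge x y : stacked_edge (letter_diagram l) (word_diagram w) x y -> slab x = slab y.
  rewrite /stacked_edge inE => /orP[]/imsetP[B BD EB].
    have upI : injective (@in_upper n.+1) by move=> a b [].
    have : x \in (@in_upper n.+1) @: B by rewrite -EB !inE eqxx.
    have : y \in (@in_upper n.+1) @: B by rewrite -EB !inE eqxx orbT.
    case/imsetP => y' y'B yE /imsetP[x' x'B xE]; rewrite xE yE !upE.
    apply: lm; suff -> : [set x'; y'] = B by [].
    by apply: (imset_inj upI); rewrite -EB imsetU1 imset_set1 xE yE.
  have loI : injective (@in_lower n.+1) by move=> [a|a] [b|b] // [->].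
  have : x \in (@in_lower n.+1) @: B by rewrite -EB !inE eqxx.
  have : y \in (@in_lower n.+1) @: B by rewrite -EB !inE eqxx orbT.
  case/imsetP => y' y'B yE /imsetP[x' x'B xE]; rewrite xE yE !loE.
  apply: wv; suff -> : [set x'; y'] = B by [].
  by apply: (imset_inj loI); rewrite -EB imsetU1 imset_set1 xE yE.
have conn x y : connect (stacked_edge (letter_diagram l) (word_diagram w)) x y -> slab x = slab y.
  case/connectP => p; elim: p x => [|z p IHp] x /=; first by move=> _ ->.
  by case/andP=> /edge -> /IHp E1 /E1.
move=> x y /imsetP[[p q]]; rewrite inE /= => /andP[_ /conn]; rewrite !ouE => E.
by case/set2_inj => [[-> ->]|[-> ->]].
Qed.

End WordSupport.

Section MorphismsOnDiagrams.
Variables (A B : pzRingType) (f : {rmorphism A -> B}) (n : nat).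
Variables (s e : nat -> A) (s' e' : nat -> B).
Hypothesis fs : forall a, (a < n)%N -> f (s a) = s' a.
Hypothesis fe : forall a, (a < n)%N -> f (e a) = e' a.

Lemma rmorph_sperm (g : 'S_n.+1) : f (sperm s g) = sperm s' g.
Proof.
rewrite /sperm /perm_word; case: (cid _) => w /= [wn _].
elim: w wn => [|a w IH] /=; first by rewrite !big_nil rmorph1.
by case/andP=> an /IH wE; rewrite !big_cons rmorphM wE fs.
Qed.

Lemma rmorph_eps (p q : 'I_n.+1) : f (eps s e p q) = eps s' e' p q.
Proof.
rewrite /eps; case: pickP => [g /andP[_ /neq_n0 n0]|_]; last by rewrite rmorph0.
by rewrite /cj !rmorphM !rmorph_sperm fe.
Qed.

Lemma rmorph_emat (M : seq ('I_n.+1 * 'I_n.+1)) : f (emat s e M) = emat s' e' M.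
Proof. by rewrite /emat rmorph_prod; apply: eq_bigr => z _; apply: rmorph_eps. Qed.

Lemma rmorph_pm x x' : pm x x' -> pm (f x) (f x').
Proof. by case=> ->; rewrite ?rmorphN; [left|right]. Qed.

End MorphismsOnDiagrams.

(** * Words reduced to a matching times a permutation *)

Section NormalForms.
Variables (A : pzRingType) (n : nat) (s e : nat -> A).
Hypothesis H : brauer_pair n s e.
Local Notation T := (sperm s).
Implicit Types (M : seq ('I_n.+1 * 'I_n.+1)) (g h : 'S_n.+1).

Definition normal x := exists M g, matching M /\ pm x (emat s e M * T g).

Lemma normal1 : normal 1.
Proof.
exists [::], 1%g; split=> //.
by rewrite /emat !big_nil (sperm1 H) mulr1; apply: pm_refl.
Qed.

Lemma normal_sperm h x : normal x -> normal (T h * x).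
Proof.
case=> M [g [wM xE]]; exists (relabel h M), (g * h)%g; rewrite matching_relabel; split=> //.
apply: pm_trans (pmMl _ xE) _.
by rewrite mulrA (sperm_emat H) (spermM H) mulrA; apply: pm_refl.
Qed.

(** The condition [mate M p != q] says that no loop is closed; the two remaining cases are
    reconnection and a new pair. *)
Lemma normal_eps (p q : 'I_n.+1) M g x : p != q -> matching M -> mate M p != q ->
  pm x (emat s e M * T g) -> normal (eps s e p q * x).
Proof.
move=> pq wM pMq xE.
have meet p1 q1 : p1 != q1 -> p1 \in ends M -> mate M p1 != q1 -> normal (eps s e p1 q1 * x).
  move=> p1q1 p1M Mp1; have [p' [N [wN EN mN _ _]]] := extract_pair H wM p1M.
  have p'q : p' != q1 by move: Mp1; rewrite mN mateL.
  have [wM' EM'] := eps_emat_meet H wN p1q1 p'q.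
  exists ((q1, p1) :: relabel (tperm q1 p') N), (g * tperm q1 p')%g; split=> //.
  apply: pm_trans (pmMl _ xE) _; rewrite mulrA (spermM H) mulrA; apply: pmMr.
  by apply: pm_trans EM'; apply: pmMl.
have [pM|pM] := boolP (p \in ends M); first exact: meet.
have [qM|qM] := boolP (q \in ends M).
  have [||M' [g' [wM' E]]] := meet q p _ qM; first by rewrite eq_sym.
    by apply: contraNneq pM => <-; rewrite -mate_neq // mateK // eq_sym mate_neq.
  exists M', g'; split=> //; apply: pm_trans E.
  by rewrite (eps_sym H p) mulNr; right; rewrite opprK.
exists ((p, q) :: M), g; split; first by rewrite matching_cons pq pM qM.
by rewrite emat_cons -mulrA; apply: pmMl.
Qed.

End NormalForms.

(** * Labellings that separate the edges of a diagram *)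

Section DiagramLabels.
Variables (X : finType) (n : nat).
Implicit Types (M : seq ('I_n.+1 * 'I_n.+1)) (g : 'S_n.+1) (x : vertex n.+1).

(* The representative of an edge is its tensor_op end, left tensor_op end or right bottom
   end: the only end that may carry dots in a regular monomial. *)
Definition edge_rep M g x : bool :=
  match x, partner M g x with
  | inl a, inl b => (a < b)%N
  | inr a, inr b => (b < a)%N
  | inl _, inr _ => true
  | inr _, inl _ => false
  end.

Definition edge_cls M g x := if edge_rep M g x then x else partner M g x.

Lemma edge_rep_partner M g x : matching M -> edge_rep M g (partner M g x) = ~~ edge_rep M g x.
Proof.
move=> wM; have := partnerK g wM x; have := partner_neq M g x; rewrite /edge_rep.
case: x => a; case: (partner M g _) => b ne -> //=; move: ne.
  by rewrite -[_ == _]/(b == a) -val_eqE /=; lia.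
by rewrite -[_ == _]/(b == a) -val_eqE /=; lia.
Qed.

Lemma edge_cls_partner M g x : matching M -> edge_cls M g (partner M g x) = edge_cls M g x.
Proof. by move=> wM; rewrite /edge_cls edge_rep_partner // partnerK // if_neg. Qed.

Lemma edge_cls_inj M g x x' : matching M -> edge_cls M g x = edge_cls M g x' ->
  x = x' \/ x = partner M g x'.
Proof.
move=> wM; rewrite /edge_cls.
case: ifP => h; case: ifP => h'; first by left.
- by right.
- by move <-; right; rewrite partnerK.
- by move/(can_inj (partnerK g wM)); left.
Qed.

Lemma edge_cls_id M g x : edge_rep M g x -> edge_cls M g x = x.
Proof. by rewrite /edge_cls => ->. Qed.

(** The colour names the edge. The parity is odd only at the second end of a horizontal edge, where
    the label has to be dual to that of the representative. *)
Definition edge_label M g (F : vertex n.+1 -> X) x : label X :=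
  (Some (F (edge_cls M g x)), ~~ edge_rep M g x && (is_top x == is_top (partner M g x))).

Definition row_word N (w : tword X) (r : 'I_n.+1 -> label X) : tword X :=
  fun i => if strand n N i then r (inord (i - N)) else w i.

Lemma row_word_st N w r a : row_word N w r (st N a) = r a.
Proof. by rewrite /row_word strand_st inord_st. Qed.
Lemma row_word_out N w r i : ~~ strand n N i -> row_word N w r i = w i.
Proof. by rewrite /row_word => /negPf ->. Qed.

Lemma edge_label_rel M g F N w : matching M ->
  diagram_rel N M g (row_word N w (fun a => edge_label M g F (inl a)))
    (row_word N w (fun b => edge_label M g F (inr b))).
Proof.
move=> wM; split=> [x|i si]; last by rewrite !row_word_out.
have vE z : vlabel N (row_word N w (fun a => edge_label M g F (inl a)))
    (row_word N w (fun b => edge_label M g F (inr b))) z = edge_label M g F z.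
  by case: z => a; rewrite /= row_word_st.
rewrite !vE /edge_label edge_cls_partner // edge_rep_partner // partnerK // negbK.
rewrite [is_top x == _]eq_sym /dual.
by case: (is_top (partner M g x) == is_top x); rewrite ?andbT ?andbF ?negbK.
Qed.

End DiagramLabels.

(** * Reading off the diagram of a word from its element *)

Section Tracking.
Variables (K : numFieldType) (n : nat).
Local Notation aff := (affine_periplectic K n.+1).
Local Notation s := (@aff_s K n).
Local Notation e := (@aff_e K n).
Local Notation X := (vertex n.+1).
Let H := at_brauer (aff_affine_triple K n).
Implicit Types (M : seq ('I_n.+1 * 'I_n.+1)) (g : 'S_n.+1).

Lemma rep_sE Y N a : (a < n)%N -> @tensor_rep K Y n.+1 N (s a) = strand_swap K Y N a.
Proof.
move=> an; rewrite -[a]/(nat_of_ord (Ordinal an)) aff_sE.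
exact: (@tensor_rep_gen K Y n.+1 N (inl (inl (Ordinal an)))).
Qed.
Lemma rep_eE Y N a : (a < n)%N -> @tensor_rep K Y n.+1 N (e a) = strand_cup K Y N a.
Proof.
move=> an; rewrite -[a]/(nat_of_ord (Ordinal an)) aff_eE.
exact: (@tensor_rep_gen K Y n.+1 N (inl (inr (Ordinal an)))).
Qed.

Lemma rep_diagram Y N M g : @tensor_rep K Y n.+1 N (emat s e M * sperm s g) =
  emat (strand_swap K Y N) (strand_cup K Y N) M * sperm (strand_swap K Y N) g.
Proof.
rewrite rmorphM /=; congr (_ * _).
  by apply: rmorph_emat => a an; [apply: rep_sE|apply: rep_eE].
by apply: rmorph_sperm => a an; apply: rep_sE.
Qed.

Lemma rep_word Y N w : @tensor_rep K Y n.+1 N (word_elt K w) = word_op K Y N w.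
Proof.
rewrite /word_elt rmorph_prod; apply: eq_bigr => l _.
by rewrite [LHS](@tensor_rep_gen K Y n.+1 N (inl l)); case: l.
Qed.

Lemma sgn_neq0 b : sgn K b <> 0.
Proof. by apply/eqP; rewrite signr_eq0. Qed.

(* Distinct edges of the diagram of (M, g) get distinct labels, so an edge of
   the diagram of a word with the same element is an edge of (M, g). *)
Lemma word_diagram_partner w M g x x' : matching M -> pm (word_elt K w) (emat s e M * sperm s g) ->
  [set x; x'] \in word_diagram w -> x' = x \/ x' = partner M g x.
Proof.
move=> wM wE xx'.
pose w0 : tword X := fun=> (None, false).
pose u := row_word 0 w0 (fun a => edge_label M g id (inl a)).
pose v := row_word 0 w0 (fun b => edge_label M g id (inr b)).
pose dv : tensor K X := fun z => (`[<z = v>])%:R.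
have dvE z : dv z <> 0 -> z = v.
  by rewrite /dv; case: asboolP.
have [b Eb] : exists b, (emat (strand_swap K X 0) (strand_cup K X 0) M * sperm (strand_swap K X 0) g) dv u
    = sgn K b * dv v.
  by apply: (signed_diagram 0 g wM dv u).2 => [|z _ /dvE]; first exact: edge_label_rel.
have nz : word_op K X 0 w dv u <> 0.
  have : pm (word_op K X 0 w)
      (emat (strand_swap K X 0) (strand_cup K X 0) M * sperm (strand_swap K X 0) g).
    by rewrite -rep_word -rep_diagram; apply: (rmorph_pm (@tensor_rep K X n.+1 0)).
  have vv : dv v = 1 by rewrite /dv asboolT.
  rewrite vv mulr1 in Eb.
  have oppE (F : tensor_op K X) : (- F) dv u = - F dv u by [].
  case=> ->; rewrite ?oppE Eb; first exact: sgn_neq0.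
  by move/eqP; rewrite oppr_eq0 => /eqP; apply: sgn_neq0.
have [z [/dvE -> col _]] := word_support nz.
have vE t : vlabel 0 u v t = edge_label M g id t.
  by case: t => a; rewrite /= /u /v row_word_st.
have := col _ _ xx'; rewrite !vE => -[] /esym.
exact: edge_cls_inj.
Qed.

Lemma sperm_letter (a : 'I_n) : @periplectic_class K n.+1 (inl (inl a)) = sperm s (adj_tperm n a).
Proof. by rewrite -aff_sE (sperm_adj_tperm H). Qed.
Lemma eps_letter (a : 'I_n) : @periplectic_class K n.+1 (inl (inr a)) =
  eps s e (pos_left (d := n.+1) a) (pos_right (d := n.+1) a).
Proof.
have an := ltn_ord a.
have -> : pos_left (d := n.+1) a = inord a by apply: val_inj; rewrite /= inordK // ltnW.
have -> : pos_right (d := n.+1) a = inord a.+1 by apply: val_inj; rewrite /= inordK.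
by rewrite -(e_eps H an); apply: esym; apply: aff_eE.
Qed.

Lemma word_elt_cons l w : word_elt K (l :: w) =
  @periplectic_class K n.+1 (inl l) * word_elt K w.
Proof. by rewrite /word_elt big_cons. Qed.

(** Only a cup letter on two strands that are mates in the normal form of the rest could fail. By
    [word_diagram_partner] the two middle vertices would then be joined only to each other, on both
    sides, forming a component inside the middle row: a closed loop. *)
Lemma loop_free_normal w : loop_free w -> normal n s e (word_elt K w).
Proof.
elim: w => [_|l w IH].
  by rewrite /word_elt big_nil; apply: (normal1 H).
move=> /= /andP[nl /IH nw]; rewrite word_elt_cons.
case: l nl => a nl.
  by rewrite sperm_letter; apply: (normal_sperm H).
rewrite eps_letter; set p := pos_left (d := n.+1) a; set q := pos_right (d := n.+1) a.
have pq : p != q by rewrite -val_eqE /= neq_ltn ltnSn.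
have [M [g [wM wE]]] := nw; apply: (normal_eps H pq wM _ wE).
apply/eqP => pMq.
pose S := [pred z : stacked_vertex n.+1 | (z == inl (inr p)) || (z == inl (inr q))].
have Sedge z z' : stacked_edge (letter_diagram (inr a)) (word_diagram w) z z' -> z \in S -> z' \in S.
  rewrite /stacked_edge inE => /orP[]/imsetP[B BD EB] zS.
    have : z \in (@in_upper n.+1) @: B by rewrite -EB !inE eqxx.
    have : z' \in (@in_upper n.+1) @: B by rewrite -EB !inE eqxx orbT.
    case/imsetP => y' y'B yE /imsetP[x' x'B xE].
    move: zS; rewrite xE yE !inE /in_upper /=.
    case/setUP: BD x'B y'B => [/set2P[]->|/imsetP[j]].
    - by rewrite !inE => /orP[]/eqP -> _.
    - by rewrite !inE => /orP[]/eqP -> /orP[]/eqP -> _ /=; rewrite ?eqxx ?orbT.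
    - rewrite !inE negb_or => /andP[jp jq] -> /set2P[]-> _ //=.
      by rewrite -[_ == _]/(j == p) -[inl (inr j) == inl (inr q)]/(j == q) (negPf jp) (negPf jq).
  have : z \in (@in_lower n.+1) @: B by rewrite -EB !inE eqxx.
  have : z' \in (@in_lower n.+1) @: B by rewrite -EB !inE eqxx orbT.
  case/imsetP => y' y'B yE /imsetP[x' x'B xE].
  have xyB : [set x'; y'] \in word_diagram w.
    have loI : injective (@in_lower n.+1) by move=> [c|c] [b|b] // [->].
    suff -> : [set x'; y'] = B by [].
    by apply: (imset_inj loI); rewrite -EB imsetU1 imset_set1 xE yE.
  move: zS; rewrite xE yE !inE; case: x' xyB {xE x'B} => // c xyB.
  rewrite -[_ == _]/(c == p) -[inl (inr c) == inl (inr q)]/(c == q) => /orP[]/eqP E; subst c;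
   case: (word_diagram_partner wM wE xyB) => -> /=; rewrite ?eqxx ?orbT //.
    by rewrite pMq [q == p]eq_sym (negPf pq) /= eqxx orbT.
  have -> : mate M q = p by rewrite -pMq mateK.
  by rewrite (negPf pq) /= eqxx.
have Sconn z z' : connect (stacked_edge (letter_diagram (inr a)) (word_diagram w)) z z' ->
    z \in S -> z' \in S.
  case/connectP => r; elim: r z => [|t r IHr] z /=; first by move=> _ ->.
  by case/andP=> /Sedge E1 /IHr E2 /E2 E3 /E1.
have [x conn] := existsP (forallP nl p).
by have := Sconn _ _ conn; rewrite !inE eqxx => /(_ isT); case: x {conn}.
Qed.

Lemma brauer_edge (D : brauer_diagram n.+1) x : exists2 x', x' != x & [set x; x'] \in val D.
Proof.
case: D => D /= /andP[/and3P[/eqP cD _ _] /forall_inP c2].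
have : x \in cover D by rewrite cD inE.
case/bigcupP => B BD xB; have /cards2P[y [z [yz BE]]] := c2 _ BD.
move: xB; rewrite BE => /set2P[]->.
  by exists z; [rewrite eq_sym|rewrite -BE].
by exists y; [|rewrite setUC -BE].
Qed.

Lemma brauer_edge_uniq (D : brauer_diagram n.+1) x y z : [set x; y] \in val D -> [set x; z] \in val D ->
  y != x -> z = y \/ z = x.
Proof.
case: D => D /= /andP[/and3P[_ /trivIsetP tD _] _] xy xz yx.
have E : [set x; y] = [set x; z].
  apply: contraTeq isT => ne; have := tD _ _ xy xz ne.
  by move/disjointFr => /(_ x); rewrite !inE !eqxx /= => /(_ isT).
have : z \in [set x; y] by rewrite E !inE eqxx orbT.
by rewrite !inE => /orP[]/eqP; [right|left].
Qed.

(** [word_diagram_partner] only says that edges of [D] are edges of the normal form; since every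
    vertex lies on exactly one edge of [D], the two sets of edges coincide. *)
Lemma produces_normal w (D : brauer_diagram n.+1) : word_produces w D ->
  exists M g, [/\ matching M, pm (word_elt K w) (emat s e M * sperm s g) &
    forall x x', x' != x -> ([set x; x'] \in val D) = (x' == partner M g x)].
Proof.
case/andP=> /loop_free_normal [M [g [wM wE]]] /eqP DE; exists M, g; split=> // x x' x'x.
have [y yx xy] := brauer_edge D x.
have yE : y = partner M g x.
  by rewrite -DE in xy; case: (word_diagram_partner wM wE xy) => // E; rewrite E eqxx in yx.
rewrite -yE; apply/idP/eqP => [xx'|-> //].
by case: (brauer_edge_uniq xy xx' yx) => // E; rewrite E eqxx in x'x.
Qed.

End Tracking.

(** * Spanning *)

Section SpanPredicate.
Variables (K : comNzRingType) (V : lmodType K) (I : choiceType) (b : I -> V).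

Definition in_span v := exists (r : seq I) (c : I -> K), v = \sum_(i <- r) c i *: b i.

Lemma in_span0 : in_span 0.
Proof. by exists [::], (fun=> 0); rewrite big_nil. Qed.

Lemma in_spanZ a v : in_span v -> in_span (a *: v).
Proof.
case=> r [c ->]; exists r, (fun i => a * c i); rewrite scaler_sumr.
by apply: eq_bigr => i _; rewrite scalerA.
Qed.

Lemma in_span_gen i : in_span (b i).
Proof. by exists [:: i], (fun=> 1); rewrite big_seq1 scale1r. Qed.

Lemma sum_count (F : I -> V) (r u : seq I) : uniq u -> {subset r <= u} ->
  \sum_(i <- u) F i *+ count_mem i r = \sum_(i <- r) F i.
Proof.
move=> uu; elim: r => [|a r IH] ru.
  by rewrite big_nil big1 // => i _; rewrite mulr0n.
rewrite big_cons -IH => [|i ir]; last by apply: ru; rewrite inE ir orbT.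
under eq_bigr => i _ do rewrite /= mulrnDr.
rewrite big_split /= (bigD1_seq a) //=; last by apply: ru; rewrite inE eqxx.
by rewrite eqxx mulr1n big1 ?addr0 // => i /negPf ia; rewrite eq_sym ia mulr0n.
Qed.

(** The two combinations run over different lists, possibly with repetitions. Over the
    duplicate-free union each coefficient is multiplied by the number of occurrences of its
    index. *)
Lemma in_spanD v v' : in_span v -> in_span v' -> in_span (v + v').
Proof.
case=> r [c ->] [r' [c' ->]]; exists (undup (r ++ r')),
  (fun i => c i *+ count_mem i r + c' i *+ count_mem i r').
under [RHS]eq_bigr => i _ do rewrite scalerDl -!scalerMnl.
rewrite big_split /= !sum_count ?undup_uniq // => i ir; by rewrite mem_undup mem_cat ir ?orbT.
Qed.

End SpanPredicate.

Section DiagramOfPair.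
Variables (n : nat) (M : seq ('I_n.+1 * 'I_n.+1)) (g : 'S_n.+1).
Hypothesis wM : matching M.

Definition pair_diagram : {set {set vertex n.+1}} := [set [set x; partner M g x] | x : vertex n.+1].

Lemma pair_block x z : z \in [set x; partner M g x] -> [set x; partner M g x] = [set z; partner M g z].
Proof. by case/set2P => -> //; rewrite partnerK // setUC. Qed.

Lemma pair_diagram_brauer : is_brauer pair_diagram.
Proof.
apply/andP; split; last first.
  by apply/forall_inP => B /imsetP[x _ ->]; rewrite cards2 [x == _]eq_sym partner_neq.
apply/and3P; split.
- apply/eqP/setP => x; rewrite inE; apply/bigcupP; exists [set x; partner M g x].
    by apply: imset_f.
  by rewrite set21.
- apply/trivIsetP => B C /imsetP[x _ ->] /imsetP[y _ ->]; apply: contraR => /pred0Pn[z /andP[zx zy]].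
  by rewrite (pair_block zx) (pair_block zy).
- by apply/imsetP => -[x _] /setP/(_ x); rewrite !inE eqxx.
Qed.

Lemma pair_diagramE x x' : x' != x -> ([set x; x'] \in pair_diagram) = (x' == partner M g x).
Proof.
move=> x'x; apply/imsetP/eqP => [[z _ E]|->]; last by exists x.
have := pair_block (z := x) (x := z); rewrite -E set21 => /(_ isT) /set2_inj[[_ //]|[_ E']].
by rewrite E' eqxx in x'x.
Qed.

End DiagramOfPair.

Section SpanningTheorem.
Variables (K : numFieldType) (n : nat).
Local Notation aff := (affine_periplectic K n.+1).
Local Notation s := (@aff_s K n).
Local Notation e := (@aff_e K n).
Local Notation y := (@aff_y K n).
Variable lift : brauer_diagram n.+1 -> seq (brauer_letter n.+1).
Hypothesis hlift : forall D, word_produces (lift D) D.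
Let HA := aff_affine_triple K n.
Let H := at_brauer HA.
Implicit Types (M : seq ('I_n.+1 * 'I_n.+1)) (g : 'S_n.+1).

Definition expo_list (i : {ffun 'I_n.+1 -> nat}) : seq 'I_n.+1 :=
  flatten [seq nseq (i k) k | k <- index_enum 'I_n.+1].

Lemma y_monomial_list i : y_monomial K i = ylist y (expo_list i).
Proof.
rewrite /y_monomial /expo_list; elim: (index_enum _) => [|k r IH].
  by rewrite big_nil ylist_nil.
rewrite big_cons IH /= ylist_cat; congr (_ * _).
elim: (i k) => [|c IHc]; first by rewrite expr0 ylist_nil.
by rewrite exprS IHc /= ylist_cons.
Qed.

Lemma count_expo_list i k : count_mem k (expo_list i) = i k.
Proof.
rewrite /expo_list count_flatten -map_comp sumnE big_map (bigD1 k) //=.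
rewrite count_nseq /= eqxx mul1n big1 ?addn0 // => j jk.
by rewrite count_nseq /= (negPf jk).
Qed.

Lemma ylist_monomial (l : seq 'I_n.+1) :
  ylist y l = y_monomial K [ffun k => count_mem k l].
Proof.
rewrite y_monomial_list; apply: (ylist_perm HA); apply/allP => k _ /=.
by rewrite count_expo_list ffunE.
Qed.

(** The word chosen for the diagram of [(M, g)] has a normal form of its own; the two have the same
    edges, hence agree up to sign by [partner_pm]. *)
Lemma lift_pair M g : matching M -> exists D, pm (word_elt K (lift D)) (emat s e M * sperm s g) /\
  forall x x', x' != x -> ([set x; x'] \in val D) = (x' == partner M g x).
Proof.
move=> wM; exists (Sub (pair_diagram M g) (pair_diagram_brauer g wM)).
set D := Sub _ _; have DE x x' : x' != x -> ([set x; x'] \in val D) = (x' == partner M g x).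
  by rewrite SubK; apply: pair_diagramE.
split=> //; have [M' [g' [wM' lE DE']]] := produces_normal K (hlift D).
apply: (pm_trans lE); apply: (partner_pm H wM' wM) => x.
by apply/eqP; rewrite -DE ?partner_neq // DE' ?partner_neq.
Qed.

Lemma regular_spanning : spanning (fun m : regular_data n.+1 => monomial K lift (val m)).
Proof.
apply: aff_ind.
- exact: in_span0.
- by move=> x x'; apply: in_spanD.
- by move=> c x; apply: in_spanZ.
apply: (yfilt_regular HA).
- exact: in_span0.
- by move=> x x'; apply: in_spanD.
- by move=> x; rewrite -scaleN1r; apply: in_spanZ.
move=> M g l l' wM hl hl'; have [D [DE Dp]] := lift_pair g wM.
pose m : monomial_data n.+1 := ([ffun k => count_mem k l], D, [ffun k => count_mem k l']).
have rm : regular m.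
  apply/andP; split; apply/forallP => k; rewrite ffunE; apply/implyP.
    case/existsP => i /andP[ik]; rewrite Dp; last by rewrite -[_ == _]/(k == i) -val_eqE /= neq_ltn ik orbT.
    move=> /eqP kE; apply/eqP/count_memPn; apply: contraTN ik => kl.
    have := partnerK g wM (inl i); rewrite -kE /=; case: eqP => // _ [<-].
    exact: hl.
  rewrite -lt0n -has_count has_pred1 => /hl'[t tE tk].
  have kt : inr k != inr t :> vertex n.+1.
    by rewrite -[_ == _]/(k == t) -val_eqE /= neq_ltn tk orbT.
  apply/existsP; exists t; rewrite tk andTb Dp //.
  have <- : partner M g (inr k) = inr t.
    rewrite /= -tE; case: eqP => // E.
    by move: tk; rewrite tE E permK ltnn.
  by rewrite partnerK.
rewrite !ylist_monomial.
have [] : pm (y_monomial K [ffun k => count_mem k l] * (emat s e M * sperm s g)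
     * y_monomial K [ffun k => count_mem k l']) (monomial K lift m).
  by apply: pmMr; apply: pmMl; apply: pm_sym.
- by move=> ->; apply: (in_span_gen (fun m : regular_data n.+1 => monomial K lift (val m)) (Sub m rm)).
- move=> ->; rewrite -scaleN1r; apply: in_spanZ.
  by apply: (in_span_gen (fun m : regular_data n.+1 => monomial K lift (val m)) (Sub m rm)).
Qed.

End SpanningTheorem.

(** * Leading terms and independence *)

Section JucysMurphyFormula.
Variables (K : comNzRingType) (X : finType).
Local Notation word := (tword X).

Local Ltac wordeq := apply/funext => ?; rewrite !(updE, tswapE);
  repeat (case: eqP => ? //=; subst); try lia; rewrite ?dualK; try by [].

Definition touch_swap (a : nat -> word -> K) (f : tensor K X) m (w : word) p :=
  a p w * f (tswap p m w).
Definition touch_cup (b : nat -> word -> label X -> K) (f : tensor K X) m (w : word) p :=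
  if w m == dual (w p) then \sum_l b p w l * f (upd (upd w p l) m (dual l)) else 0.

(* The summand of index p acts on the positions p and m only; of the
   coefficients, only those of even transpositions matter later. *)
Lemma jm_formula m : exists (a : nat -> word -> K) (b : nat -> word -> label X -> K),
  (forall f w, jucys_murphy (swap_op K X) (cup_op K X) m f w =
     \sum_(p < m) (touch_swap a f m w p + touch_cup b f m w p)) /\
  (forall p w, (p < m)%N -> (w p).2 = false -> (w m).2 = false -> a p w = 1).
Proof.
elim: m => [|m [a [b [E a1]]]].
  by exists (fun _ _ => 0), (fun _ _ _ => 0); split=> // f w; rewrite big_ord0.
(* The new index $p=m$ comes from $s_m+\varepsilon_m$. The terms with $p<m$ are conjugated by $s_m$,
   which contributes two signs: [sg w] before the touch, and after it the sign given by the new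
   label at [p] and the old label at [m]. *)
pose sg (w : word) := sgn K ((w m).2 && (w m.+1).2).
exists (fun p w => if p == m then sg w else
   sg w * a p (tswap m m.+1 w) * sgn K ((w p).2 && (w m).2)),
  (fun p w l => if p == m then sgn K l.2 else
   sg w * b p (tswap m m.+1 w) l * sgn K ((dual l).2 && (w m).2)).
have Sm : (m == m.+1) = false by apply/negbTE; clear; lia.
have mS : (m.+1 == m) = false by apply/negbTE; clear; lia.
have ltm p : (p < m)%N -> (p == m) = false /\ (p == m.+1) = false.
  by clear=> pm; split; apply/negbTE; lia.
split=> [f w|p w]; last first.
  rewrite ltnS leq_eqVlt; case: eqP => [-> _ _ h2|_ /= pm h1 h2].
    by rewrite /sg h2 andbF.
  have [p1 p2] := ltm _ pm.
  by rewrite /sg h2 andbF h1 /= !mul1r mulr1 a1 // tswapE ?p1 ?p2 ?Sm ?eqxx.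
rewrite big_ord_recr /= /touch_swap /touch_cup eqxx -addrA; congr (_ + _).
rewrite -/(sg w) E mulr_sumr; apply: eq_bigr => -[p pm] _ /=.
have [p1 p2] := ltm _ pm; rewrite p1 mulrDr /touch_swap /touch_cup; congr (_ + _).
  have -> : tswap p m.+1 w = tswap m m.+1 (tswap p m (tswap m m.+1 w)) by wordeq.
  rewrite !tswapE ?p1 ?p2 ?Sm ?mS ?eqxx ?[m == p]eq_sym ?[m.+1 == p]eq_sym ?p1 ?p2.
  by rewrite !mulrA.
rewrite !tswapE ?p1 ?p2 ?Sm ?mS ?eqxx.
case: ifP => _; last by rewrite mulr0.
rewrite mulr_sumr; apply: eq_bigr => l _.
have -> : upd (upd w p l) m.+1 (dual l) =
   tswap m m.+1 (upd (upd (tswap m m.+1 w) p l) m (dual l)) by wordeq.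
rewrite !(updE, tswapE) ?p1 ?p2 ?Sm ?mS ?eqxx ?[m == p]eq_sym ?[m.+1 == p]eq_sym ?p1 ?p2.
by rewrite !mulrA.
Qed.

End JucysMurphyFormula.

(** * Distance from a reference word in the auxiliary factors *)

Section LeadingTerms.
Variables (K : comNzRingType) (X : finType) (n N : nat) (v : tword X).
Local Notation word := (tword X).
Local Notation st := (st (n := n) N).
Local Notation y := (fun a : 'I_n.+1 => jucys_murphy (swap_op K X) (cup_op K X) (st a)).
Implicit Types (w : word) (h : tensor K X).

(* Tensor factors below N are auxiliary; v is the reference word. *)
Definition adeg w := (\sum_(p < N) (w p != v p))%N.

(** Such an [h] sees only words within distance [c] of the reference word. Since [y] extends this
    range by one ([jm_slow]), a product of fewer than [N] of them cannot connect two words that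
    differ in all [N] auxiliary positions. *)
Definition slow c h := forall w, (c < adeg w)%N -> h w = 0.

Lemma adeg_upd w p l : (p < N)%N ->
  (adeg (upd w p l) + (w p != v p) = adeg w + (l != v p))%N.
Proof.
move=> pN; rewrite /adeg [in LHS](bigD1 (Ordinal pN)) //= [in RHS](bigD1 (Ordinal pN)) //= updE eqxx.
rewrite (eq_bigr (fun i : 'I_N => (w i != v i) : nat)) => [|i ip].
  by clear; lia.
by rewrite updE (_ : (nat_of_ord i == p) = false) //; apply: negbTE ip.
Qed.

Lemma adeg_upd_out w i l : (N <= i)%N -> adeg (upd w i l) = adeg w.
Proof.
move=> Ni; apply: eq_bigr => p _; rewrite updE (_ : (nat_of_ord p == i) = false) //.
by apply/negbTE; have := ltn_ord p; lia.
Qed.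

Lemma N_st a : (N <= st a)%N. Proof. exact: leq_addr. Qed.

Lemma adeg_touch w p l l' a : (adeg w <= (adeg (upd (upd w p l) (st a) l')).+1)%N.
Proof.
rewrite adeg_upd_out ?N_st //; case: (ltnP p N) => pN; last by rewrite adeg_upd_out.
by have := adeg_upd w l pN; case: (w p != v p); case: (l != v p); lia.
Qed.

Lemma adeg_touch_lt w p l l' a : (adeg (upd (upd w p l) (st a) l') < adeg w)%N ->
  [/\ (p < N)%N, w p != v p & l = v p].
Proof.
rewrite adeg_upd_out ?N_st //; case: (ltnP p N) => pN; last by rewrite adeg_upd_out ?ltnn.
by have := adeg_upd w l pN; case: (eqVneq l (v p)) => [->|_]; case: (w p != v p); split=> //; lia.
Qed.

(* The element of a strand changes at most one auxiliary position. *)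
Lemma jm_slow a c h : slow c h -> slow c.+1 (y a h).
Proof.
move=> hc w cw; have [aa [b [-> _]]] := jm_formula K X (st a).
have tz p l l' : h (upd (upd w p l) (st a) l') = 0.
  by apply: hc; have := adeg_touch w p l l' a; lia.
apply: big1 => p _; rewrite /touch_swap /touch_cup /tswap tz mulr0 add0r.
by case: ifP => // _; apply: big1 => l _; rewrite tz mulr0.
Qed.

(** At maximal distance a summand survives only if it restores one auxiliary position [p] to its
    reference label. The two alternatives are the transposition, where strand and position trade
    labels, and the cup, where the labels are dual before and after. *)
Lemma jm_lead_ex a c h w : slow c h -> adeg w = c.+1 -> y a h w <> 0 ->
  exists p l', [/\ (p < N)%N, w p != v p, h (upd (upd w p (v p)) (st a) l') <> 0 &
    (w (st a) = v p /\ l' = w p) \/ (w (st a) = dual (w p) /\ l' = dual (v p))].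
Proof.
move=> hc wc; have [aa [b [-> _]]] := jm_formula K X (st a).
have nz p l l' : h (upd (upd w p l) (st a) l') <> 0 -> [/\ (p < N)%N, w p != v p & l = v p].
  move=> hnz; apply: (@adeg_touch_lt w p l l' a); rewrite ltnNge; apply/negP => le.
  by apply: hnz; apply: hc; rewrite -wc.
move=> sum0; have [p] : exists p : 'I_(st a), touch_swap aa h (st a) w p + touch_cup b h (st a) w p <> 0.
  by apply: contrapT => nex; apply: sum0; apply: big1 => p _; apply: contrapT => pn; apply: nex; exists p.
rewrite /touch_swap /touch_cup; have [h0|h0] := pselect (h (tswap p (st a) w) = 0); last first.
  have [pN wp E] := nz _ _ _ h0; move=> _; exists p, (w p); split=> //; last by left.
  by rewrite -E.
rewrite h0 mulr0 add0r; case: eqP => // E lsum.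
have [l hl] : exists l, h (upd (upd w p l) (st a) (dual l)) <> 0.
  apply: contrapT => nex; apply: lsum; apply: big1 => l _.
  have [->|hl] := pselect (h (upd (upd w p l) (st a) (dual l)) = 0); first by rewrite mulr0.
  by case: nex; exists l.
have [pN wp El] := nz _ _ _ hl; exists p, (dual (v p)); split=> //; last by right.
by rewrite -El.
Qed.

(** Even labels exclude the cup, as a dual would be odd, and make the coefficient of the
    transposition 1. As the reference label at [p] occurs nowhere else among the auxiliary
    positions, only one transposition is left. *)
Lemma jm_lead_eq a c h w p : slow c h -> adeg w = c.+1 ->
  (forall q, (q < N)%N -> (w q).2 = false) -> (w (st a)).2 = false ->
  (p < N)%N -> w p != v p -> w (st a) = v p ->
  (forall q, (q < N)%N -> v q = v p -> q = p) ->
  y a h w = h (upd (upd w p (v p)) (st a) (w p)).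
Proof.
move=> hc wc we ae pN wp wap uniqp; have [aa [b [-> a1]]] := jm_formula K X (st a).
have nz q l l' : [\/ h (upd (upd w q l) (st a) l') = 0 | [/\ (q < N)%N, w q != v q & l = v q]].
  have [h0|hnz] := pselect (h (upd (upd w q l) (st a) l') = 0); first by left.
  right; apply: (@adeg_touch_lt w q l l' a); rewrite ltnNge; apply/negP => le.
  by apply: hnz; apply: hc; rewrite -wc.
have pa : (p < st a)%N by apply: leq_trans pN (N_st a).
have cup0 q : touch_cup b h (st a) w q = 0.
  rewrite /touch_cup; case: eqP => // E; apply: big1 => l _.
  have [->|[qN _ _]] := nz q l (dual l); first by rewrite mulr0.
  by move: ae; rewrite E /dual /= we.
rewrite (bigD1 (Ordinal pa)) //= cup0 addr0 big1 => [|q qp].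
  have ap : aa p w = 1 by apply: a1 => //; apply: we.
  by rewrite addr0 /touch_swap /= ap mul1r /tswap wap.
rewrite cup0 addr0 /touch_swap /tswap; have [->|[qN _ E]] := nz q (w (st a)) (w q); first by rewrite mulr0.
by move: qp; rewrite -val_eqE /= (uniqp q) ?eqxx // -E wap.
Qed.

Lemma ylist_slow l c h : slow c h -> slow (size l + c) (ylist y l h).
Proof.
elim: l => [|r l IH] hc; first by rewrite ylist_nil.
by rewrite ylist_cons; apply: jm_slow; apply: IH.
Qed.

Variable Y : finType.
Variable cl : X -> Y.
Definition lcol (l : label X) : option Y := omap cl l.1.

Definition aux_coloured w := forall p, (p < N)%N -> lcol (w p) = lcol (v p).
(** The stock of class [x] still to be restored. In a leading term each [y] on a strand of class [x]
    consumes exactly one unit, so exponents can be read off. *)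
Definition used x w := (\sum_(p < N) ((w p != v p) && (lcol (v p) == Some x)))%N.

Lemma used_upd x w p : (p < N)%N -> w p != v p ->
  used x w = (used x (upd w p (v p)) + (lcol (v p) == Some x))%N.
Proof.
move=> pN wp; rewrite /used [in LHS](bigD1 (Ordinal pN)) //= [in RHS](bigD1 (Ordinal pN)) //= updE eqxx wp eqxx /= add0n addnC.
congr (_ + _)%N; apply: eq_bigr => i ip.
by rewrite updE (_ : (nat_of_ord i == p) = false) //; apply: negbTE ip.
Qed.

Lemma used_upd_out x w i l : (N <= i)%N -> used x (upd w i l) = used x w.
Proof.
move=> Ni; apply: eq_bigr => p _; rewrite updE (_ : (nat_of_ord p == i) = false) //.
by apply/negbTE; have := ltn_ord p; lia.
Qed.

(** Every surviving trade takes place between a strand and an auxiliary position of the same class.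
    Hence the classes of strands never change, strands outside [l] keep their labels, and the stock
    of each class drops by the number of [y]'s applied to it. *)
Lemma ylist_lead_ex l c h w : slow c h -> adeg w = (size l + c)%N -> aux_coloured w ->
  ylist y l h w <> 0 -> exists w', [/\ h w' <> 0, aux_coloured w' /\ adeg w' = c,
    forall a, lcol (w' (st a)) = lcol (w (st a)),
    forall a, a \notin l -> w' (st a) = w (st a) &
    forall x, used x w = (used x w' + count (fun r => lcol (w (st r)) == Some x) l)%N].
Proof.
elim: l w => [|r l IH] w hc wc wi.
  by rewrite ylist_nil => hw; exists w; split=> // x; rewrite addn0.
rewrite ylist_cons => hw.
have [p [l' [pN wp hw' cases]]] := jm_lead_ex (ylist_slow hc) wc hw.
set w1 := upd _ _ _ in hw'.
have inj a b : (st a == st b) = (a == b) by rewrite eqn_add2l.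
have pst a : (p == st a) = false by apply/negbTE; have := N_st a; lia.
have stp a : (st a == p) = false by rewrite eq_sym pst.
have w1c : adeg w1 = (size l + c)%N.
  rewrite /w1 adeg_upd_out ?N_st //; have := adeg_upd w (v p) pN.
  by rewrite wc wp eqxx /=; clear; lia.
have w1i : aux_coloured w1.
  move=> q qN; rewrite /w1 !updE (_ : (q == st r) = false); last by apply/negbTE; have := N_st r; lia.
  by case: eqP => [->|_] //; apply: wi.
have cl' : lcol l' = lcol (w (st r)) /\ lcol (v p) = lcol (w (st r)).
  by case: cases => -[E ->]; rewrite E /lcol /= -/(lcol _) -/(lcol _) ?(wi _ pN).
have w1s a : lcol (w1 (st a)) = lcol (w (st a)).
  by rewrite /w1 !updE inj; case: eqP => [->|_]; [case: cl'|rewrite stp].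
have [w' [hw2 [w'i w'c] E1 E2 E3]] := IH w1 hc w1c w1i hw'.
exists w'; split=> //.
- by move=> a; rewrite E1 w1s.
- move=> a; rewrite inE negb_or => /andP[ar al]; rewrite E2 // /w1 !updE inj (negPf ar) stp //.
- move=> x; rewrite (used_upd x pN wp) -(used_upd_out x (upd w p (v p)) l' (N_st r)) -/w1 E3.
  rewrite /= (eq_count (a2 := fun r0 => lcol (w (st r0)) == Some x)); last by move=> a /=; rewrite w1s.
  by case: cl' => _ ->; rewrite -!addnA; congr (_ + _)%N; rewrite addnC.
Qed.

End LeadingTerms.

(** * The matrix entry attached to a dotted diagram *)

Section DottedDiagram.
Variables (K : comNzRingType) (n k : nat).
Variables (M : seq ('I_n.+1 * 'I_n.+1)) (g : 'S_n.+1) (dots : vertex n.+1 -> nat).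
Hypotheses (wM : matching M) (dots_rep : forall x, dots x != 0%N -> edge_rep M g x).
Hypothesis dots_sum : (\sum_x dots x = k)%N.
Local Notation V := (vertex n.+1).
(** A representative of an edge together with a height on it. Heights run up to the number of dots
    of the edge, which is at most [k]. *)
Definition bead_colour : finType := (V * 'I_k.+1)%type.
Local Notation X := bead_colour.
Local Notation word := (tword X).
Local Notation st := (st (n := n) k).
Local Notation y := (fun a : 'I_n.+1 => jucys_murphy (swap_op K X) (cup_op K X) (st a)).
Implicit Types (L : seq ('I_n.+1 * 'I_n.+1)) (f : 'S_n.+1) (x : V) (a b : 'I_n.+1) (t : V -> nat) (l : seq 'I_n.+1) (h : tensor K X).

(** One auxiliary factor for each dot: [(x, r)] is the [r]-th dot of the edge represented by [x]. *)
Definition beads : seq (V * nat) := [seq (x, r) | x <- index_enum V, r <- iota 0 (dots x)].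
Definition bead p := nth (inl ord0 : V, 0%N) beads p.
Definition bcol x r : label X := (Some (x, inord r), false).

(* State t: the strand of the edge at x carries the r-th colour of x with
   r = t x, having traded its colour with the beads (x, r), r < t x. *)
Definition aux_word t : word := fun p =>
  if (p < k)%N then bcol (bead p).1 (if ((bead p).2 < t (bead p).1)%N then (bead p).2 else (bead p).2.+1)
  else (None, false).
(** The heights at the moment when the diagram acts: the dots at top vertices have been applied,
    those at bottom vertices have not. *)
Definition halfway x := if is_top x then dots x else 0%N.
(** The end of an edge that carries no dots keeps the same label in all states. That label must suit
    the diagram when it acts, hence the height [halfway], independent of [t]. *)
Definition vertex_label t x : label X :=
  if edge_rep M g x then bcol x (t x) else edge_label M g (fun x' => (x', inord (halfway x'))) x.
Definition state (iota : 'I_n.+1 -> V) t : word :=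
  row_word k (aux_word t) (fun a => vertex_label t (iota a)).
Definition source := state inl (fun=> 0%N).
Definition target := state inr dots.
Definition delta_target : tensor K X := fun w => (`[<w = target>])%:R.

Local Notation adeg := (adeg k target).
Local Notation slow := (slow k target).

Lemma size_beads : size beads = k.
Proof.
rewrite size_allpairs_dep sumnE big_map -dots_sum.
by apply: eq_bigr => x _; rewrite size_iota.
Qed.

Lemma mem_beads x r : ((x, r) \in beads) = (r < dots x)%N.
Proof.
apply/allpairsPdep/idP => [[x' [r' [_ hr [-> ->]]]]|hr]; first by move: hr; rewrite mem_iota.
by exists x, r; rewrite mem_index_enum mem_iota.
Qed.

Lemma uniq_beads : uniq beads.
Proof.
apply: allpairs_uniq_dep => [|x _|]; [exact: index_enum_uniq|exact: iota_uniq|].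
by move=> [x r] [x' r'] _ _ /= [-> ->].
Qed.

Lemma bead_bound p : (p < k)%N -> ((bead p).2 < dots (bead p).1)%N.
Proof.
move=> pk; rewrite -mem_beads -surjective_pairing; apply: mem_nth.
by rewrite size_beads.
Qed.

Lemma dots_le x : (dots x <= k)%N.
Proof. by rewrite -dots_sum (bigD1 x) //= leq_addr. Qed.

Lemma bcol_inj x x' r r' : (r <= k)%N -> (r' <= k)%N -> bcol x r = bcol x' r' -> x = x' /\ r = r'.
Proof.
by move=> rk r'k [-> /(congr1 val)] /=; rewrite !inordK ?ltnS // => ->.
Qed.

Lemma out_aux p : (p < k)%N -> ~~ strand n k p.
Proof. by rewrite /strand; lia. Qed.

Lemma state_aux iota t p : (p < k)%N -> state iota t p =
  bcol (bead p).1 (if ((bead p).2 < t (bead p).1)%N then (bead p).2 else (bead p).2.+1).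
Proof. by move=> pk; rewrite /state row_word_out ?out_aux // /aux_word pk. Qed.

Lemma state_st iota t a : state iota t (st a) = vertex_label t (iota a).
Proof. by rewrite /state row_word_st. Qed.

Lemma target_aux p : (p < k)%N -> target p = bcol (bead p).1 (bead p).2.
Proof. by move=> pk; rewrite /target state_aux // bead_bound. Qed.

Lemma state_target p iota t : (p < k)%N ->
  (state iota t p != target p) = (t (bead p).1 <= (bead p).2)%N.
Proof.
move=> pk; rewrite state_aux // target_aux //; have := bead_bound pk.
have := dots_le (bead p).1; case: (ltnP _ (t _)) => h1 h2 h3; first by rewrite eqxx.
by apply/eqP => /bcol_inj [||_]; lia.
Qed.

Lemma state_coloured iota t : aux_coloured k target fst (state iota t).
Proof. by move=> p pk; rewrite state_aux // target_aux. Qed.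

Lemma vertex_label_colour t x : lcol fst (vertex_label t x) = Some (edge_cls M g x).
Proof. by rewrite /vertex_label; case: ifP => // h; rewrite /lcol /= edge_cls_id. Qed.

Lemma adeg_source : adeg source = k.
Proof.
rewrite /adeg (eq_bigr (fun=> 1%N)) ?sum_nat_const ?card_ord ?muln1 // => p _.
by rewrite state_target.
Qed.

Lemma used_source x : used k target fst x source = dots x.
Proof.
rewrite /used (eq_bigr (fun p : 'I_k => (bead p).1 == x : nat)) => [|p _]; last first.
  by rewrite state_target // target_aux.
rewrite -[in LHS]size_beads -(big_mkord xpredT (fun p => ((bead p).1 == x : nat))).
rewrite -(big_nth (inl ord0 : V, 0%N) xpredT (fun z => (z.1 == x) : nat)).
rewrite big_allpairs_dep /= (bigD1 x) //= eqxx [X in (_ + X)%N]big1 ?addn0 => [|z /negPf zx].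
  by rewrite big_const_seq count_predT size_iota iter_addn_0 mul1n.
by rewrite big1 // => r _; rewrite zx.
Qed.

Lemma used_target x : used k target fst x target = 0%N.
Proof. by apply: big1 => p _; rewrite eqxx. Qed.

Lemma delta_slow : slow 0 delta_target.
Proof.
move=> w; rewrite /delta_target; case: asboolP => // ->.
by rewrite [adeg _]big1 // => p _; rewrite eqxx.
Qed.

Lemma y_step iota a t c h : injective iota -> slow c h -> adeg (state iota t) = c.+1 ->
  (t (iota a) < dots (iota a))%N ->
  let t' x := (t x + (iota a == x))%N in
  adeg (state iota t') = c /\ y a h (state iota t) = h (state iota t').
Proof.
move=> iI hc wc ta t'.
pose p := index (iota a, t (iota a)) beads.
have pk : (p < k)%N by rewrite -size_beads index_mem mem_beads.
have bp : bead p = (iota a, t (iota a)) by rewrite /bead nth_index // mem_beads.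
have ra : edge_rep M g (iota a) by apply: dots_rep; rewrite -lt0n; apply: leq_ltn_trans ta.
have vp : target p = bcol (iota a) (t (iota a)) by rewrite target_aux // bp.
have wp : state iota t p = bcol (iota a) (t (iota a)).+1 by rewrite state_aux // bp /= ltnn.
have wpv : state iota t p != target p by rewrite state_target // bp.
have wa : state iota t (st a) = target p by rewrite state_st vp /vertex_label ra.
have uniqp q : (q < k)%N -> target q = target p -> q = p.
  move=> qk; rewrite !target_aux // => /bcol_inj[].
  - by apply: leq_trans (dots_le (bead q).1); apply: ltnW; apply: bead_bound.
  - by apply: leq_trans (dots_le (bead p).1); apply: ltnW; apply: bead_bound.
  move=> E1 E2; apply/eqP; rewrite -(nth_uniq (inl ord0 : V, 0%N) _ _ uniq_beads) ?size_beads //.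
  by rewrite -/(bead q) -/(bead p) (surjective_pairing (bead q)) E1 E2 -surjective_pairing.
have E : upd (upd (state iota t) p (target p)) (st a) (state iota t p) = state iota t'.
  apply: (word_eq (N := k) (n := n)) => [b|i si].
    rewrite updE; case: eqVneq => [/addnI/val_inj ->|ba].
      by rewrite state_st /vertex_label ra /t' eqxx addn1 wp.
    rewrite upd_neq; last by apply/eqP => E; move: pk; rewrite -E stE; lia.
    rewrite !state_st /vertex_label /t' (_ : (iota a == iota b) = false) ?addn0 //.
    by apply: contraNF ba => /eqP/iI ->.
  rewrite !updE (_ : (i == st a) = false); last by apply: contraNF si => /eqP ->; apply: strand_st.
  rewrite /state; case: eqP => [->|ip].
    rewrite row_word_out ?out_aux // /aux_word pk vp bp /= /t' eqxx addn1.
    by rewrite ltnSn.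
  rewrite !row_word_out // /aux_word; case: ifP => // ik; congr bcol.
  rewrite /t'; case: eqP => [Ei|_]; last by rewrite addn0.
  have ne : (bead i).2 <> t (bead i).1.
    move=> E2; apply: ip; apply: uniqp => //.
    by rewrite target_aux // vp E2 Ei.
  by congr (if _ then _ else _); clear -ne; lia.
split; last first.
  rewrite (jm_lead_eq hc wc _ _ pk) ?E //.
  - by move=> q qk; rewrite state_aux.
  - by rewrite wa vp.
rewrite -E adeg_upd_out ?N_st //; have := adeg_upd target (state iota t) (target p) pk.
by rewrite wpv eqxx wc; clear; lia.
Qed.

Lemma ylist_state iota l t c h : injective iota -> slow c h ->
  adeg (state iota t) = (size l + c)%N ->
  (forall x, t x + count (fun a => iota a == x) l <= dots x)%N ->
  let t' x := (t x + count (fun a => iota a == x) l)%N in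
  adeg (state iota t') = c /\ ylist y l h (state iota t) = h (state iota t').
Proof.
move=> iI hc; elim: l t => [|a l IH] t wc tl t'.
  rewrite ylist_nil; suff -> : t' = t by [].
  by apply/funext => x; rewrite /t' addn0.
have ta : (t (iota a) < dots (iota a))%N.
  by apply: leq_trans (tl (iota a)); rewrite /= eqxx addnA addn1 leq_addr.
have [w1c E1] := y_step iI (ylist_slow hc) wc ta.
have tE x : (t x + (iota a == x) + count (fun b => iota b == x) l)%N = t' x.
  by rewrite -addnA.
have [|w2c E2] := IH _ w1c; first by move=> x; rewrite tE; apply: tl.
rewrite ylist_cons; split.
- by rewrite -w2c; congr (adeg (state _ _)); apply/funext => x; rewrite tE.
- by rewrite [LHS]E1 E2; congr (h (state _ _)); apply/funext => x; rewrite tE.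
Qed.

Lemma count_inl l x : (forall a, count_mem a l = dots (inl a)) ->
  count (fun a => inl a == x :> V) l = halfway x.
Proof.
move=> cl; rewrite /halfway; case: x => a /=; last by rewrite (eq_count (a2 := pred0)) ?count_pred0.
by rewrite -cl; apply: eq_count.
Qed.

Lemma count_inr l x : (forall b, count_mem b l = dots (inr b)) ->
  (halfway x + count (fun b => inr b == x :> V) l = dots x)%N.
Proof.
move=> cl; rewrite /halfway; case: x => a /=; first by rewrite (eq_count (a2 := pred0)) ?count_pred0 ?addn0.
by rewrite -cl; apply: eq_count.
Qed.

Lemma middle_rel : diagram_rel k M g (state inl halfway) (state inr halfway).
Proof.
have E iota : state iota halfway = row_word k (aux_word halfway)
    (fun a => edge_label M g (fun x => (x, inord (halfway x))) (iota a)).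
  congr row_word; apply/funext => a; rewrite /vertex_label; case: ifP => // ra.
  by rewrite /edge_label edge_cls_id // ra.
by rewrite !E; apply: edge_label_rel.
Qed.

Lemma signed_slow L f (W : tensor_op K X) c h :
  signed (diagram_rel k L f) W -> slow c h -> slow c (W h).
Proof.
move=> SW hc w cw; apply: (SW h w).1 => w' [_ aux]; apply: hc.
by rewrite [adeg w'](eq_bigr (fun p : 'I_k => (w p != target p) : nat)) // => p _; rewrite aux ?out_aux.
Qed.

Lemma related_adeg L f w w' : diagram_rel k L f w w' -> adeg w' = adeg w.
Proof. by case=> _ aux; apply: eq_bigr => p _; rewrite aux ?out_aux. Qed.

Lemma related_coloured L f w w' : diagram_rel k L f w w' ->
  aux_coloured k target fst w -> aux_coloured k target fst w'.
Proof. by case=> _ aux wc p pk; rewrite aux ?out_aux // wc. Qed.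

(** A bottom vertex that is not a representative carries no dots, so its label is already that of
    the target. A bottom representative lies on a horizontal edge whose other end is of this kind,
    and the diagram relation then determines its label. *)
Lemma middle_uniq l w : (forall b, count_mem b l = dots (inr b)) ->
  adeg (state inl halfway) = size l -> diagram_rel k M g (state inl halfway) w ->
  ylist y l delta_target w <> 0 -> w = state inr halfway.
Proof.
move=> cl wc rw nz; have [rw1 rw2] := rw; have [mw1 mw2] := middle_rel.
have adw : adeg w = (size l + 0)%N by rewrite (related_adeg rw) wc addn0.
have [w' [dw' _ _ E _]] := ylist_lead_ex delta_slow adw (related_coloured rw (state_coloured _ _)) nz.
have w'E : w' = target by move: dw'; rewrite /delta_target; case: asboolP.
subst w'; apply: (word_eq (N := k) (n := n)) => [b|i si]; last by rewrite rw2 // mw2.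
have nonrep b' : ~~ edge_rep M g (inr b') -> w (st b') = state inr halfway (st b').
  move=> /negPf nr; rewrite -E; first by rewrite /target !state_st /vertex_label nr.
  by apply/count_memPn; rewrite cl; apply: contraFeq nr; apply: dots_rep.
have [rb|] := boolP (edge_rep M g (inr b)); last by apply: nonrep.
have nr := edge_rep_partner g (inr b) wM; rewrite rb in nr.
case Eb : (partner M g (inr b)) nr => [a|b'] nr; first by move: rb; rewrite /edge_rep Eb.
have Eb' := nonrep b' (negbT nr).
have Eb2 : partner M g (inr b') = inr b by rewrite -Eb partnerK.
have := rw1 (inr b'); have := mw1 (inr b').
by rewrite Eb2 /= Eb' => -> ->.
Qed.

(** The only contributing path leads from the source to [state inl halfway] by the top dots, to
    [state inr halfway] by the diagram, and to the target by the bottom dots. Its value is the sign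
    of the diagram entry. *)
Lemma lead_diag l l' (W : tensor_op K X) : signed (diagram_rel k M g) W ->
  (forall a, count_mem a l = dots (inl a)) -> (forall b, count_mem b l' = dots (inr b)) ->
  (size l + size l' = k)%N -> ylist y l (W (ylist y l' delta_target)) source <> 0.
Proof.
move=> SW cl cl' szk.
have inlI : injective (inl : 'I_n.+1 -> V) by move=> a b [].
have inrI : injective (inr : 'I_n.+1 -> V) by move=> a b [].
have slow2 : slow (size l') (ylist y l' delta_target).
  by rewrite -[size l']addn0; apply: ylist_slow delta_slow.
have [|w1c ->] := ylist_state inlI (signed_slow SW slow2) (etrans adeg_source (esym szk)).
  by move=> x; rewrite add0n count_inl // /halfway; case: ifP.
have tE : (fun x : V => (0 + count (fun a => inl a == x) l)%N) = halfway.
  by apply/funext => x; rewrite add0n count_inl.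
rewrite tE in w1c *.
have [sg ->] : exists sg : bool, W (ylist y l' delta_target) (state inl halfway)
    = sgn K sg * ylist y l' delta_target (state inr halfway).
  apply: (SW _ _).2 => [|w' rw nz]; first exact: middle_rel.
  exact: (middle_uniq cl' w1c rw nz).
have w2c : adeg (state inr halfway) = (size l' + 0)%N by rewrite (related_adeg middle_rel) w1c addn0.
have [|_ ->] := ylist_state inrI delta_slow w2c.
  by move=> x; rewrite count_inr.
have -> : (fun x : V => (halfway x + count (fun b => inr b == x) l')%N) = dots.
  by apply/funext => x; rewrite count_inr.
by rewrite /delta_target asboolT // mulr1; apply/eqP; rewrite signr_eq0.
Qed.

(** A nonzero entry provides a path of words. The [y]'s preserve the classes of strands, and classes
    agree along the edges of [(L, f)], so these are edges of [(M, g)]. Every bead has to be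
    restored, so each edge carries as many [y]'s as it has beads; all of them sit at
    representatives, which fixes the exponents. *)
Lemma lead_offdiag L f l l' (W : tensor_op K X) : matching L -> signed (diagram_rel k L f) W ->
  (forall a, a \in l -> edge_rep L f (inl a)) -> (forall b, b \in l' -> edge_rep L f (inr b)) ->
  (size l + size l' = k)%N -> ylist y l (W (ylist y l' delta_target)) source <> 0 ->
  [/\ partner L f =1 partner M g, forall a, count_mem a l = dots (inl a) &
      forall b, count_mem b l' = dots (inr b)].
Proof.
move=> wL SW rl rl' szk nz.
have slow2 : slow (size l') (ylist y l' delta_target).
  by rewrite -[size l']addn0; apply: ylist_slow delta_slow.
have [w1 [nz1 [c1 ad1] col1 _ us1]] := ylist_lead_ex (signed_slow SW slow2)
  (etrans adeg_source (esym szk)) (state_coloured _ _) nz.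
have [w2 [rw nz2]] : exists w2, diagram_rel k L f w1 w2 /\ ylist y l' delta_target w2 <> 0.
  apply: contrapT => nex; apply: nz1; apply: (SW _ _).1 => w2 rw.
  by apply: contrapT => nz2; apply: nex; exists w2.
have ad2 : adeg w2 = (size l' + 0)%N by rewrite (related_adeg rw) ad1 addn0.
have [w3 [dw3 _ col3 _ us3]] := ylist_lead_ex delta_slow ad2 (related_coloured rw c1) nz2.
have w3E : w3 = target by move: dw3; rewrite /delta_target; case: asboolP.
subst w3; have [rw1 rw2] := rw.
have colE x : lcol fst (vlabel k w1 w2 x) = Some (edge_cls M g x).
  case: x => a /=; first by rewrite col1 /source state_st vertex_label_colour.
  by rewrite -col3 /target state_st vertex_label_colour.
have pE x : partner L f x = partner M g x.
  have : edge_cls M g (partner L f x) = edge_cls M g x.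
    apply: Some_inj; rewrite -!colE rw1; by case: ifP.
  by case/(edge_cls_inj wM) => // /eqP; rewrite (negPf (partner_neq _ _ _)).
have repE x : edge_rep L f x = edge_rep M g x by have := pE x; rewrite /edge_rep; case: x => a ->.
have us x : dots x = (count (fun a => inl a == x) l + count (fun b => inr b == x) l')%N.
  rewrite -used_source us1.
  have -> : used k target fst x w1 = used k target fst x w2.
    by apply: eq_bigr => p _; rewrite rw2 ?out_aux.
  rewrite us3 used_target add0n addnC; congr (_ + _)%N; apply: eq_in_count => a al.
    by rewrite /= /source state_st vertex_label_colour edge_cls_id -?repE ?rl.
  by rewrite /= -col3 /target state_st vertex_label_colour edge_cls_id -?repE ?rl'.
split=> // a; rewrite us.
  by rewrite [X in (_ + X)%N](eq_count (a2 := pred0)) // count_pred0 addn0; apply: eq_count.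
by rewrite [X in (X + _)%N](eq_count (a2 := pred0)) // count_pred0 add0n; apply: eq_count.
Qed.

End DottedDiagram.

Lemma signed_pm (K : comNzRingType) (X : finType) (C : tword X -> tword X -> Prop) (U U' : tensor_op K X) :
  pm U' U -> signed C U -> signed C U'.
Proof.
case=> -> SU; first exact: SU.
move=> h w; have [S1 S2] := SU h w; split=> [h0|w'' Cw h0].
  by rewrite -[LHS]/(- U h w) S1 ?oppr0.
by have [b E] := S2 w'' Cw h0; exists (~~ b); rewrite -[LHS]/(- U h w) E sgnN mulNr.
Qed.

(** * Linear independence of the regular monomials *)

Section Independence.
Variables (K : numFieldType) (n : nat).
Local Notation aff := (affine_periplectic K n.+1).
Local Notation s := (@aff_s K n).
Local Notation e := (@aff_e K n).
Local Notation y := (@aff_y K n).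
Variable lift : brauer_diagram n.+1 -> seq (brauer_letter n.+1).
Hypothesis hlift : forall D, word_produces (lift D) D.
Implicit Types (M : seq ('I_n.+1 * 'I_n.+1)) (g : 'S_n.+1).

Lemma regular_rep D M g i j : regular (i, D, j) -> matching M ->
  (forall x x', x' != x -> ([set x; x'] \in val D) = (x' == partner M g x)) ->
  (forall a, i a != 0%N -> edge_rep M g (inl a)) /\ (forall b, j b != 0%N -> edge_rep M g (inr b)).
Proof.
move=> /andP[/forallP ri /forallP rj] wM DE; split=> a na.
  have [//|nr] := boolP (edge_rep M g (inl a)).
  have := DE (partner M g (inl a)) (inl a); have := partner_neq M g (inl a).
  move: nr; rewrite /edge_rep partnerK //; case: (partner M g (inl a)) => // b.
  rewrite -leqNgt eqxx => ba ne ba1.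
  have {}ne : b != a by [].
  case/negP: na; apply: (implyP (ri a)); apply/existsP; exists b.
  by rewrite ltn_neqAle -[_ == _ :> nat]/(b == a) ne ba ba1 // eq_sym.
case/existsP: (implyP (rj a) na) => b /andP[ba].
rewrite setUC DE => [/eqP E|].
  by rewrite /edge_rep -E.
by rewrite -[_ == _]/(b == a) -val_eqE neq_ltn ba.
Qed.

Lemma rep_ylist X N l : @tensor_rep K X n.+1 N (ylist y l) =
  ylist (fun a : 'I_n.+1 => jucys_murphy (swap_op K X) (cup_op K X) (st N a)) l.
Proof.
rewrite /ylist rmorph_prod; apply: eq_bigr => a _.
exact: (@tensor_rep_gen K X n.+1 N (inr a)).
Qed.

Lemma rep_monomial X N i D j h w :
  @tensor_rep K X n.+1 N (monomial K lift (i, D, j)) h w =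
  let y := fun a : 'I_n.+1 => jucys_murphy (swap_op K X) (cup_op K X) (st N a) in
  ylist y (expo_list i) (@tensor_rep K X n.+1 N (word_elt K (lift D)) (ylist y (expo_list j) h)) w.
Proof.
rewrite /= -!rep_ylist -!y_monomial_list /monomial.
by rewrite !(rmorphM (@tensor_rep K X n.+1 N)).
Qed.

Definition mdeg (m : monomial_data n.+1) := (size (expo_list m.1.1) + size (expo_list m.2))%N.

Lemma rep_normal X N D : exists M g, [/\ matching M,
  signed (diagram_rel N M g) (@tensor_rep K X n.+1 N (word_elt K (lift D))) &
  forall x x', x' != x -> ([set x; x'] \in val D) = (x' == partner M g x)].
Proof.
have [M [g [wM lE DE]]] := produces_normal K (hlift D).
exists M, g; split=> //; apply: signed_pm (signed_diagram N g wM).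
by rewrite -rep_diagram; apply: (rmorph_pm (@tensor_rep K X n.+1 N)).
Qed.

Lemma brauer_diagram_ext (D D' : brauer_diagram n.+1) :
  (forall x x', x' != x -> ([set x; x'] \in val D) = ([set x; x'] \in val D')) -> D = D'.
Proof.
move=> E; apply: val_inj; apply/setP => B.
case: D D' E => D /= /andP[_ /forall_inP cD] [D' /= /andP[_ /forall_inP cD']] E.
apply/idP/idP => BD.
  by have /cards2P[x [z [xz BE]]] := cD _ BD; rewrite BE -E -?BE // eq_sym.
by have /cards2P[x [z [xz BE]]] := cD' _ BD; rewrite BE E -?BE // eq_sym.
Qed.

Lemma separating_functional m : regular m -> exists (X : finType) N h w,
  @tensor_rep K X n.+1 N (monomial K lift m) h w <> 0 /\
  forall m', regular m' -> (mdeg m' <= mdeg m)%N -> m' <> m ->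
    @tensor_rep K X n.+1 N (monomial K lift m') h w = 0.
Proof.
case: m => [[i D] j] rm; set k := mdeg _.
have [M [g [wM _ DE]]] := rep_normal void 0 D.
pose dots (x : vertex n.+1) := match x with inl a => i a | inr b => j b end.
have [ri rj] := regular_rep rm wM DE.
have dots_rep x : dots x != 0%N -> edge_rep M g x by case: x.
have size_expo f : size (expo_list f) = (\sum_a f a)%N.
  by rewrite /expo_list size_flatten /shape -map_comp sumnE big_map;
     apply: eq_bigr => a _; rewrite /= size_nseq.
have dots_sum : (\sum_x dots x = k)%N.
  by rewrite big_sumType /k /mdeg !size_expo.
exists (bead_colour n k), k, (@delta_target K n k M g dots), (@source n k M g dots).
split.
  have [M' [g' [wM' SW DE']]] := rep_normal (bead_colour n k) k D.
  have pE x : partner M g x = partner M' g' x.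
    by apply/eqP; rewrite -DE' ?partner_neq // DE ?partner_neq.
  rewrite rep_monomial; apply: lead_diag => //; try by move=> a; rewrite count_expo_list.
  apply: signed_ext SW => w w'; split=> -[h1 h2]; split=> // x; by have := h1 x; rewrite pE.
case=> [[i' D'] j'] rm' m'k ne; rewrite rep_monomial.
have [M' [g' [wM' SW DE']]] := rep_normal (bead_colour n k) k D'.
have [ri' rj'] := regular_rep rm' wM' DE'.
move: m'k; rewrite leq_eqVlt => /orP[/eqP m'k|m'k]; last first.
  (* In lower degree there are fewer than [k] factors [y], while the source differs from the target
     in all [k] auxiliary positions. *)
  apply: (ylist_slow (signed_slow wM dots_sum SW (ylist_slow (delta_slow (k := k) (M := M) (g := g) (dots := dots) K)))).
  by rewrite (adeg_source g wM dots_sum) addn0.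
apply: contrapT => /(lead_offdiag wM dots_sum wM' SW) [].
- by move=> a; rewrite -has_pred1 has_count count_expo_list lt0n; apply: ri'.
- by move=> a; rewrite -has_pred1 has_count count_expo_list lt0n; apply: rj'.
- by [].
move=> pE ci cj; apply: ne; congr (_, _, _).
- by apply/ffunP => a; rewrite -(count_expo_list i') ci.
- apply: brauer_diagram_ext => x x' x'x; by rewrite DE // DE' // pE.
- by apply/ffunP => a; rewrite -(count_expo_list j') cj.
Qed.

Lemma regular_independent : lin_independent (fun m : regular_data n.+1 => monomial K lift (val m)).
Proof.
move=> r c ur sum0.
have Hb m : m \in r -> (mdeg (val m) <= \max_(m' <- r) mdeg (val m'))%N.
  by move=> mr; rewrite (big_rem m) //= leq_maxl.
move: (\max_(m' <- r) mdeg (val m'))%N Hb => B Hb.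
(* Descending induction on the degree, as strong induction on its distance to the bound [B]:
   monomials of higher degree have coefficient 0 by hypothesis, and the others are annihilated by
   the functional of [m]. *)
suff S b m : m \in r -> (B - mdeg (val m) = b)%N -> c m = 0 by move=> m mr; apply: S erefl.
elim/ltn_ind: b m => b IH m mr mb.
have [X [N [h [w [nz sep]]]]] := separating_functional (valP m).
have := congr1 (fun z => @tensor_rep K X n.+1 N z h w) sum0.
rewrite raddf_sum raddf0 tensor_op_sumE (bigD1_seq m) //= big_seq_cond big1 ?addr0 => [|m' /andP[m'r m'm]].
  rewrite tensor_repZ => /eqP; rewrite mulf_eq0 => /orP[/eqP //|/eqP]; by case/nz.
rewrite tensor_repZ -[LHS]/(c m' * _); case: (leqP (mdeg (val m')) (mdeg (val m))) => le.
  by rewrite sep ?mulr0 //; [exact: valP|move=> /val_inj E; rewrite E eqxx in m'm].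
by rewrite (IH (B - mdeg (val m'))%N) ?mul0r //; rewrite -mb; apply: ltn_sub2l (leq_trans le (Hb _ m'r)) le.
Qed.

End Independence.

Theorem theorem5p1 (R : realType) (d : nat) (hd : (0 < d)%N)
  (lift : brauer_diagram d -> seq (brauer_letter d))
  (hlift : forall g : brauer_diagram d, word_produces (lift g) g) :
  is_basis (fun m : regular_data d => monomial (R[i])%C lift (val m)).
Proof.
case: d hd lift hlift => // n _ lift hlift; split.
  exact: (@regular_independent (R[i])%C n lift hlift).
exact: (@regular_spanning (R[i])%C n lift hlift).
Qed.
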